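(* Assume the free odd generation conjecture holds for $\mathfrak{dm}_0$. Then for every $N\ge2$, $\ker(D_{<N})\cap\mathcal Z^{\mathfrak f}_N=\mathbb Q\,\zeta^{\mathfrak f}(N)$.
   Context: Formal MZVs: $\mathcal X=\{x_0,x_1\}$, $\mathbb Q\langle\mathcal X\rangle$ free noncommutative polynomials (weight = number of letters), $ш$ shuffle product. $\mathcal Z^{\mathfrak f}=(\mathbb Q\langle\mathcal X\rangle,ш)/R$, $R$ the ideal generated by $x_0,x_1$ and $u ш v-\iota(\iota^{-1}(u)*\iota^{-1}(v))$ for $u\in\mathbb Q\mathbf1+x_0\mathbb Q\langle\mathcal X\rangle x_1$, $v\in\mathbb Q\mathbf1+\mathbb Q\langle\mathcal X\rangle x_1$, where $\iota(y_{k_1}\cdots y_{k_d})=x_0^{k_1-1}x_1\cdots x_0^{k_d-1}x_1$ and $*$ is the stuffle product on $\mathbb Q\langle y_1,y_2,\dots\rangle$ ($y_iu*y_jv=y_i(u*y_jv)+y_j(y_iu*v)+y_{i+j}(u*v)$). $\zeta^{\mathfrak f}(w)$ is the class of $w$, $\zeta^{\mathfrak f}(N)=\zeta^{\mathfrak f}(x_0^{N-1}x_1)$; $\mathcal Z^{\mathfrak f}_N$ the weight-$N$ part. Goncharov coaction: $\mathcal A^{\mathfrak f}=\mathcal Z^{\mathfrak f}/(\zeta^{\mathfrak f}(2))$ with projection $\alpha$; $\Delta_{\mathrm{Gon}}:\mathcal Z^{\mathfrak f}\to\mathcal A^{\mathfrak f}\otimes\mathcal Z^{\mathfrak f}$,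 $\zeta^{\mathfrak f}(w)\mapsto(\alpha\circ\zeta^{\mathfrak f}\otimes\zeta^{\mathfrak f})(\Delta_{\mathrm{Gon}}(w))$ (well defined), where on words $\Delta_{\mathrm{Gon}}(\varepsilon_1\cdots\varepsilon_n)=\sum_{k}\sum_{0<i_1<\dots<i_k<n+1}\big(\mathop{ш}_{p=0}^{k}I(\varepsilon_{i_p};\varepsilon_{i_p+1}\cdots\varepsilon_{i_{p+1}-1};\varepsilon_{i_{p+1}})\big)\otimes\varepsilon_{i_1}\cdots\varepsilon_{i_k}$, $i_0=0$, $i_{k+1}=n+1$, $\varepsilon_0=x_1$, $\varepsilon_{n+1}=x_0$, and $I(x_1;f;x_0)=f$, $I(x_0;f;x_1)=S(f)$ with $S(\varepsilon_1\cdots\varepsilon_m)=(-1)^m\varepsilon_m\cdots\varepsilon_1$, $I(\varepsilon;f;\varepsilon)=(\text{coefficient of }\mathbf1\text{ in }f)\mathbf1$. Let $\mathcal A^{\mathfrak f}_{>0}$ be the positive-weight part, $\mathcal L^{\mathfrak f}=\mathcal A^{\mathfrak f}_{>0}/(\mathcal A^{\mathfrak f}_{>0})^2$ (weight graded), $\pi_{2r+1}:\mathcal A^{\mathfrak f}_{>0}\to\mathcal L^{\mathfrak f}_{2r+1}$ the projection. Define $D_{2r+1}=(\pi_{2r+1}\otimes\mathrm{id})\circ(\Delta_{\mathrm{Gon}}-\mathbf1\otimes\mathrm{id}):\mathcal Z^{\mathfrak f}\to\mathcal L^{\mathfrak f}_{2r+1}\otimes\mathcal Z^{\mathfrak f}$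 and $D_{<N}=\bigoplus_{3\le2r+1<N}D_{2r+1}$. $\mathfrak{dm}_0$ and the free odd generation conjecture: $\mathfrak{dm}_0$ is the space of $\psi\in\mathbb Q\langle\mathcal X\rangle$ with vanishing coefficients of $x_0,x_1,x_0x_1$, $\psi$ primitive for the shuffle coproduct (concatenation-multiplicative, $x_i$ primitive), and $\psi_*=\Pi_{\mathcal Y}(\psi)+\sum_{n\ge2}\frac{(-1)^{n-1}}{n}(\Pi_{\mathcal Y}(\psi)|y_n)y_1^n$ primitive for the concatenation-multiplicative coproduct $\Delta_*(y_i)=y_i\otimes\mathbf1+\mathbf1\otimes y_i+\sum_{j=1}^{i-1}y_j\otimes y_{i-j}$ ($\Pi_{\mathcal Y}(x_0^{k_1-1}x_1\cdots x_0^{k_d-1}x_1x_0^{k_{d+1}-1})=y_{k_1}\cdots y_{k_d}$ if $k_{d+1}=1$, else $0$), with Ihara bracket $\{f,g\}=d_f(g)-d_g(f)+[f,g]$, $d_f(x_0)=0$, $d_f(x_1)=[x_1,f]$. The conjecture states $(\mathfrak{dm}_0,\{-,-\})$ is isomorphic as a weight-graded Lie algebra to the free Lie algebra on $s_3,s_5,\dots$ with $s_{2n+1}$ of weight $2n+1$. *)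

(* Defs.v *)
From HB Require Import structures.
From mathcomp Require Import all_boot all_order all_algebra.
Set Implicit Arguments. Unset Strict Implicit. Unset Printing Implicit Defensive.
Import Order.TTheory GRing.Theory Num.Theory.
Local Open Scope ring_scope.

(* A word in X = {x0, x1}: false = x0, true = x1.  Weight = length. *)
Definition word := seq bool.
(* Elements of Q<X> are given by their coefficient functions. *)
Definition xpoly := word -> rat.
Definition ispoly (p : xpoly) : Prop :=
  exists n : nat, forall w : word, (n <= size w)%N -> p w = 0.
Definition homog (N : nat) (p : xpoly) : Prop :=
  forall w : word, size w != N -> p w = 0.

Definition pzero : xpoly := fun _ => 0.
Definition padd (p q : xpoly) : xpoly := fun w => p w + q w.
Definition psub (p q : xpoly) : xpoly := fun w => p w - q w.
Definition pscale (c : rat) (p : xpoly) : xpoly := fun w => c * p w.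
Definition pword (u : word) : xpoly := fun w => (w == u)%:R.
Definition wpart (n : nat) (p : xpoly) : xpoly :=
  fun w => if size w == n then p w else 0.

Definition gconcat {T : Type} (p q : seq T -> rat) : seq T -> rat :=
  fun w => \sum_(i < (size w).+1) p (take i w) * q (drop i w).
Definition gcomm {T : Type} (p q : seq T -> rat) : seq T -> rat :=
  fun w => gconcat p q w - gconcat q p w.

Fixpoint allmasks (n : nat) : seq bitseq :=
  if n is n'.+1 then [seq b :: m | b <- [:: false; true], m <- allmasks n']
  else [:: [::]].
Definition allwords (n : nat) : seq word := allmasks n.

Definition pshuffle (p q : xpoly) : xpoly :=
  fun w => \sum_(m <- allmasks (size w)) p (mask m w) * q (mask (map negb m) w).

Fixpoint stuffle (a : seq nat) : seq nat -> seq (seq nat) :=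
  match a with
  | [::] => fun b => [:: b]
  | i :: a' =>
      fix stb (b : seq nat) : seq (seq nat) :=
        match b with
        | [::] => [:: i :: a']
        | j :: b' => [seq i :: c | c <- stuffle a' b]
                     ++ [seq j :: c | c <- stb b']
                     ++ [seq (i + j)%N :: c | c <- stuffle a' b']
        end
  end.

(* iota(y_{k1}...y_{kd}) = x0^{k1-1} x1 ... x0^{kd-1} x1 *)
Definition iotaY (y : seq nat) : word :=
  flatten [seq rcons (nseq k.-1 false) true | k <- y].
(* inverse of iota on words that are empty or end in x1 *)
Fixpoint toY_aux (k : nat) (w : word) : seq nat :=
  match w with
  | [::] => [::]
  | false :: w' => toY_aux k.+1 w'
  | true :: w' => k.+1 :: toY_aux 0 w'
  end.
Definition toY (w : word) : seq nat := toY_aux 0 w.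
Definition isYword (w : word) : bool := (w == [::]) || last false w.

Definition stcoef (a b w : word) : rat :=
  if isYword a && isYword b then
    (count_mem w [seq iotaY c | c <- stuffle (toY a) (toY b)])%:R
  else 0.
(* the bilinear map (u,v) |-> iota(iota^{-1}(u) * iota^{-1}(v)) (weight preserving) *)
Definition pstuffle (u v : xpoly) : xpoly :=
  fun w => \sum_(i < (size w).+1) \sum_(a <- allwords i)
             \sum_(b <- allwords (size w - i)) u a * v b * stcoef a b w.

Definition conv_poly (u : xpoly) : Prop :=
  forall w, u w != 0 -> (w == [::]) || ((head true w == false) && last false w).
Definition yend_poly (v : xpoly) : Prop := forall w, v w != 0 -> isYword w.

Inductive span (P : xpoly -> Prop) : xpoly -> Prop :=
| span0 : span P pzero
| spanS (c : rat) (g f : xpoly) : P g -> span P f -> span P (padd (pscale c g) f)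
| spanE (f g : xpoly) : span P f -> (forall w, f w = g w) -> span P g.

Definition genR (g : xpoly) : Prop :=
  (forall w, g w = pword [:: false] w) \/ (forall w, g w = pword [:: true] w) \/
  exists u v : xpoly, [/\ ispoly u, ispoly v, conv_poly u, yend_poly v &
                     forall w, g w = psub (pshuffle u v) (pstuffle u v) w].

Definition idealR_elt (h : xpoly) : Prop :=
  exists g p : xpoly, [/\ genR g, ispoly p & forall w, h w = pshuffle g p w].
Definition inR (f : xpoly) : Prop := span idealR_elt f.

(* zeta^f(N) is the class of x0^{N-1} x1 *)
Definition zetaN (N : nat) : xpoly := pword (rcons (nseq N.-1 false) true).

(** * Preimage in Q<X> of (A^f_{>0})^2, i.e. kernel of Q<X> -> A^f_{>0}/(A^f_{>0})^2
      (on positive weight): R + (zeta^f(2)) + span{a ш b : a, b of positive weight} *)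
Definition inI (f : xpoly) : Prop :=
  span (fun h => idealR_elt h \/
          (exists p, ispoly p /\ forall w, h w = pshuffle (pword [:: false; true]) p w) \/
          (exists a b, [/\ ispoly a, ispoly b, a [::] = 0, b [::] = 0 &
                          forall w, h w = pshuffle a b w])) f.

(** * Tensors Q<X> (x) Q<X>, as coefficient functions on pairs of words *)
Definition tens := word -> word -> rat.
Definition ptens (p q : xpoly) : tens := fun a b => p a * q b.
Inductive tspan (P : tens -> Prop) : tens -> Prop :=
| tspan0 : tspan P (fun _ _ => 0)
| tspanS (c : rat) (g f : tens) : P g -> tspan P f ->
    tspan P (fun a b => c * g a b + f a b)
| tspanE (f g : tens) : tspan P f -> (forall a b, f a b = g a b) -> tspan P g.

(* T maps to 0 under Q<X> (x) Q<X> -> L^f_{2r+1} (x) Z^f, where the left map is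
   u |-> pi_{2r+1}(class of u); its kernel is (ker) (x) Q<X> + Q<X> (x) R. *)
Definition kerD (r : nat) (T : tens) : Prop :=
  tspan (fun t =>
    (exists k q, [/\ ispoly k, ispoly q, inI (wpart r.*2.+1 k) &
                   forall a b, t a b = ptens k q a b]) \/
    (exists p rho, [/\ ispoly p, ispoly rho, inR rho &
                   forall a b, t a b = ptens p rho a b])) T.

Definition Ipiece (a : bool) (f : word) (b : bool) : option (rat * word) :=
  if a == b then (if f is [::] then Some (1, [::]) else None)
  else if a then Some (1, f) else Some ((-1) ^+ size f, rev f).

(* split eps_0 eps_1 ... eps_n eps_{n+1} along selected positions (mask) *)
Fixpoint gpieces (a : bool) (acc : word) (w : word) (m : bitseq)
  : seq (bool * word * bool) :=
  match w, m with
  | e :: w', true :: m' => (a, acc, e) :: gpieces e [::] w' m'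
  | e :: w', false :: m' => gpieces a (rcons acc e) w' m'
  | _, _ => [:: (a, acc, false)]
  end.

Definition gleft (ps : seq (bool * word * bool)) : xpoly :=
  foldr (fun pc acc => match Ipiece pc.1.1 pc.1.2 pc.2 with
                       | Some (c, f) => pscale c (pshuffle (pword f) acc)
                       | None => pzero
                       end) (pword [::]) ps.

(* Delta_Gon(w), eps_0 = x1, eps_{n+1} = x0 *)
Definition gon (w : word) : tens :=
  fun a b => \sum_(m <- allmasks (size w))
               (mask m w == b)%:R * gleft (gpieces true [::] w m) a.

(* (Delta_Gon - 1 (x) id)(f) for f homogeneous of weight N *)
Definition Tf (N : nat) (f : xpoly) : tens :=
  fun a b => \sum_(w <- allwords N) f w * gon w a b - (a == [::])%:R * f b.

Definition deltaSh (psi : xpoly) : tens := fun a b =>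
  \sum_(w <- allwords (size a + size b)) psi w *
    (count (fun m => (mask m w == a) && (mask (map negb m) w == b))
           (allmasks (size w)))%:R.
Definition sh_primitive (psi : xpoly) : Prop :=
  forall a b, deltaSh psi a b = (b == [::])%:R * psi a + (a == [::])%:R * psi b.

Definition ypoly := seq nat -> rat.
(* psi_* ; Pi_Y(psi) has coefficient psi(iota y) at y *)
Definition psiStar (psi : xpoly) : ypoly := fun y =>
  psi (iotaY y) +
  (if (2 <= size y)%N && (y == nseq (size y) 1%N)
   then (-1) ^+ (size y).-1 / (size y)%:R * psi (iotaY [:: size y]) else 0).

Definition dLetter (i : nat) : seq (seq nat * seq nat) :=
  ([:: i], [::]) :: ([::], [:: i]) ::
  [seq ([:: j], [:: (i - j)%N]) | j <- iota 1 i.-1].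
Fixpoint dStar (y : seq nat) : seq (seq nat * seq nat) :=
  match y with
  | [::] => [:: ([::], [::])]
  | i :: y' => [seq (p.1 ++ q.1, p.2 ++ q.2) | p <- dLetter i, q <- dStar y']
  end.
(* coefficient of a (x) b in Delta_*(phi); Y-words of weight n <-> words of
   length n that are empty or end in x1 *)
Definition deltaStar (phi : ypoly) (a b : seq nat) : rat :=
  \sum_(w <- allwords (sumn a + sumn b))
     (isYword w)%:R * phi (toY w) * (count_mem (a, b) (dStar (toY w)))%:R.
Definition st_primitive (phi : ypoly) : Prop :=
  forall a b : seq nat, all (fun k => 0 < k)%N a -> all (fun k => 0 < k)%N b ->
    deltaStar phi a b = (b == [::])%:R * phi a + (a == [::])%:R * phi b.

Definition dm0 (psi : xpoly) : Prop :=
  [/\ ispoly psi, psi [:: false] = 0, psi [:: true] = 0 & psi [:: false; true] = 0]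
  /\ sh_primitive psi /\ st_primitive (psiStar psi).

(* d_f(g), d_f derivation for concatenation, d_f(x0)=0, d_f(x1)=[x1,f] *)
Definition pderiv (f g : xpoly) : xpoly := fun u =>
  \sum_(i < (size u).+1) \sum_(j < (size u).+1 | (i <= j)%N)
     g (take i u ++ true :: drop j u) * gcomm (pword [:: true]) f (drop i (take j u)).
Definition ihara (f g : xpoly) : xpoly :=
  fun u => pderiv f g u - pderiv g f u + gcomm f g u.

(** * Free Lie algebra on s_3, s_5, ... (LGen n stands for s_{2n+3}),
      realized as Lie polynomials in the free associative algebra *)
Inductive LieTerm : Type := LGen of nat | LBr of LieTerm & LieTerm.
Definition apoly := seq nat -> rat.
Fixpoint evalA (t : LieTerm) : apoly :=
  match t with
  | LGen n => fun w => (w == [:: n])%:R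
  | LBr t1 t2 => gcomm (evalA t1) (evalA t2)
  end.
Fixpoint evalI (sigma : nat -> xpoly) (t : LieTerm) : xpoly :=
  match t with
  | LGen n => sigma n
  | LBr t1 t2 => ihara (evalI sigma t1) (evalI sigma t2)
  end.
Definition lincombA (c : seq (rat * LieTerm)) : apoly :=
  fun w => \sum_(x <- c) x.1 * evalA x.2 w.
Definition lincombI (sigma : nat -> xpoly) (c : seq (rat * LieTerm)) : xpoly :=
  fun w => \sum_(x <- c) x.1 * evalI sigma x.2 w.

(* Free odd generation conjecture: a weight-graded Lie algebra isomorphism
   Lie(s_3,s_5,...) -> (dm_0, {,}), s_{2n+3} |-> sigma n. *)
Definition free_odd_generation : Prop :=
  exists sigma : nat -> xpoly,
    [/\ (forall n, dm0 (sigma n) /\ homog (n.*2 + 3) (sigma n)),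
        (forall c, (forall w, lincombA c w = 0) <-> (forall w, lincombI sigma c w = 0)),
        (forall c, dm0 (lincombI sigma c)) &
        (forall psi, dm0 psi -> exists c, forall w, psi w = lincombI sigma c w)].

(* Main.v *)
(** A polynomial psi of weight n defines D_psi = (psi (x) id) Delta_Gon. The linear forms killing
R, zeta(2) and products are exactly the elements of dm_0, so ker D_{<N} is the set of f with
D_psi f in R for all psi in dm_0 of odd weight < N; for psi in dm_0 of odd weight D_psi is a
derivation of both products, hence preserves R, and psi |-> D_psi turns the Ihara bracket into a
commutator. If dm_0 is generated in odd weights, then D_psi f in R propagates from the generators
to all of dm_0, except for the generator of weight N itself when N is odd.

If D_psi f is in R for all psi, the Euler operator sum_w w D_{psi_w}, with (psi_w) dual to the
indecomposables, acts by k on products of k indecomposables modulo longer ones; it kills f, so f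
lies in (zeta(2)) + R, and since zeta(2) is not a zero divisor modulo R, f is a multiple of
zeta(2)^(N/2) modulo R. In weight N even, both f and zeta(N) are such multiples; in weight N odd, one
first subtracts a multiple of zeta(N) to make D_psi f vanish for the generator psi of weight N.

That zeta(N) and the powers of zeta(2) are not in R is seen on the regularized truncated harmonic
sums H_n: the stuffle relations hold exactly for each n, the shuffle relations up to
O((log n)^K / n), while H_n(zeta(N)) and H_n(zeta(2))^k are at least 1. *)
From HB Require Import structures.
From mathcomp Require Import all_boot all_order all_algebra.
From mathcomp Require Import boolp functions.
From mathcomp Require Import ring zify.
Set Implicit Arguments. Unset Strict Implicit. Unset Printing Implicit Defensive.
Import Order.TTheory GRing.Theory Num.Theory.
Local Open Scope ring_scope.

Require Import Defs.

(** * The shuffle algebra *)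

(** Everything is done on the dual side: [D n psi] is the transpose of g |-> psi g + d_psi(g), so
    composites appear in reversed order and identities are checked by stripping letters from words.

    The delicate point is the stuffle Leibniz rule. Read on Y-words, [D n psi] does not commute with
    stripping a first letter y_k; the defect pairs psi with a factor placed either before x0^{k-1}
    or between x0^{k-1} and x1. Factors of the second kind have to be read backwards, and it is in
    odd weight that the antipode gives psi(rev a) = psi(a), so that both kinds are expressed by the
    same tails of psi. These tails are all stuffle-primitive. In even weight the symmetry fails, and
    there elements of dm_0 are reached as Ihara brackets. The correction term in psi_* contributes a
    multiple of F |-> F(y_1^n ++ .), which cancels when one factor is convergent, as it is in the
    relations defining R.

    That zeta(2) is not a zero divisor modulo R comes from the Euler operator again: D_psi commutes
    with multiplication by zeta(2), so torsion descends in weight until it would give a power of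
    zeta(2) inside R. *)

Definition sha : Type := word -> rat^o.
HB.instance Definition _ := GRing.Lmodule.copy sha (word -> rat^o).

Lemma shaD (f g : sha) w : (f + g) w = f w + g w. Proof. by []. Qed.
Lemma shaN (f : sha) w : (- f) w = - f w. Proof. by []. Qed.
Lemma shaZ (c : rat) (f : sha) w : (c *: f) w = c * f w. Proof. by []. Qed.
Lemma sha0 w : (0 : sha) w = 0. Proof. by []. Qed.
Lemma sha_sum I r (P : pred I) (F : I -> sha) w :
  (\sum_(i <- r | P i) F i) w = \sum_(i <- r | P i) F i w.
Proof. by elim/big_rec2: _ => // i y1 y2 _ <-. Qed.
Definition shaE := (shaD, shaN, shaZ, sha0, sha_sum).

(** Transpose of concatenation with the letter [a] on the left. It is a derivation of the shuffle
    product, so shuffle identities are proved by induction on the word. *)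
Definition lder (a : bool) (f : sha) : sha := fun w => f (a :: w).

Lemma lderE a (f : sha) w : f (a :: w) = lder a f w. Proof. by []. Qed.

Lemma lderP (f g : sha) : f [::] = g [::] -> (forall a, lder a f = lder a g) -> f = g.
Proof. by move=> h0 h; apply/funext => -[|a w] //; rewrite lderE h. Qed.

Lemma lder_is_linear a : linear (lder a). Proof. by []. Qed.
HB.instance Definition _ a :=
  GRing.isLinear.Build rat sha sha _ (lder a) (lder_is_linear a).

Lemma big_allmasksS (V : nmodType) n (F : bitseq -> V) :
  \sum_(m <- allmasks n.+1) F m =
    \sum_(m <- allmasks n) F (false :: m) + \sum_(m <- allmasks n) F (true :: m).
Proof. by rewrite /= cats0 big_cat !big_map. Qed.

(** Each coefficient of a shuffle is a finite sum, so all coefficient functions form a ring;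
    finiteness is carried separately by [ispoly]. *)
Definition shm (f g : sha) : sha := pshuffle f g.
Definition sh1 : sha := fun w => (w == [::])%:R.

Lemma shm_nil f g : shm f g [::] = f [::] * g [::].
Proof. by rewrite /shm /pshuffle /= big_seq1. Qed.
Lemma lder_shm a f g : lder a (shm f g) = shm (lder a f) g + shm f (lder a g).
Proof.
by apply/funext => w; rewrite shaD addrC /lder /shm /pshuffle [size _]/= big_allmasksS.
Qed.

Lemma shmC : commutative shm.
Proof.
move=> f g; apply/funext => w; elim: w f g => [|a w ih] f g; first by rewrite !shm_nil mulrC.
by rewrite !lderE !lder_shm !shaD ih (ih f) addrC.
Qed.
Lemma shmDl : left_distributive shm +%R.
Proof.
move=> f g h; apply/funext => w; rewrite shaD; elim: w f g h => [|a w ih] f g h.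
  by rewrite !shm_nil mulrDl.
by rewrite !lderE !lder_shm linearD !shaD !ih addrACA.
Qed.
Lemma shmA : associative shm.
Proof.
move=> f g h; apply/funext => w; elim: w f g h => [|a w ih] f g h.
  by rewrite !shm_nil mulrA.
rewrite !lderE !lder_shm shmDl (shmC f (_ + _)) shmDl !(shmC _ f) !shaD !ih.
by rewrite addrA.
Qed.
Lemma sh1m : left_id sh1 shm.
Proof.
move=> f; apply/funext => w; elim: w f => [|a w ih] f; first by rewrite shm_nil mul1r.
rewrite lderE lder_shm shaD ih -[RHS]add0r; congr (_ + _).
have -> : lder a sh1 = 0 by apply/funext.
have /(addrI (shm 0 f)) <- // : shm 0 f + 0 = shm 0 f + shm 0 f by rewrite -shmDl !addr0.
Qed.
Lemma sh1_neq0 : sh1 != 0 :> sha.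
Proof. by apply/eqP => /(congr1 (fun f : sha => f [::])) /eqP; rewrite sha0 /sh1 eqxx oner_eq0. Qed.
HB.instance Definition _ :=
  GRing.Zmodule_isComNzRing.Build sha shmA shmC sh1m shmDl sh1_neq0.
Lemma shm_scaleAl (c : rat) (f g : sha) : c *: shm f g = shm (c *: f) g.
Proof.
apply/funext => w; rewrite shaZ; elim: w f g => [|a w ih] f g.
  by rewrite !shm_nil mulrA.
by rewrite !lderE !lder_shm linearZ !shaD mulrDr !ih.
Qed.
HB.instance Definition _ := GRing.Lmodule_isLalgebra.Build rat sha shm_scaleAl.
Lemma shm_scaleAr (c : rat) (f g : sha) : c *: (f * g) = f * (c *: g).
Proof. by rewrite mulrC scalerAl mulrC. Qed.
HB.instance Definition _ := GRing.Lalgebra_isAlgebra.Build rat sha shm_scaleAr.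

Lemma sha_nil (f g : sha) : (f * g) [::] = f [::] * g [::].
Proof. exact: shm_nil. Qed.
Lemma lderM a (f g : sha) : lder a (f * g) = lder a f * g + f * lder a g.
Proof. exact: lder_shm. Qed.
Lemma sha1E w : (1 : sha) w = (w == [::])%:R. Proof. by []. Qed.
Lemma mulE (f g : sha) : pshuffle f g = f * g. Proof. by []. Qed.

(** * Sums over words and the pairing in weight n *)

Lemma mem_allwords n w : (w \in allwords n) = (size w == n).
Proof.
elim: n w => [|n ih] [|a w] //=; rewrite cats0 mem_cat.
  by apply/negbTE/negP => /orP[] /mapP[].
rewrite eqSS -ih; have inj b : injective (cons b : word -> word) by move=> x y [].
by case: a; rewrite ?mem_map //; [rewrite -[RHS]orFb|rewrite -[RHS]orbF]; congr (_ || _);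
  apply/negbTE/negP => /mapP[].
Qed.

Lemma uniq_allwords n : uniq (allwords n).
Proof.
elim: n => //= n ih; rewrite cats0 cat_uniq !map_inj_uniq ?ih /= ?andbT => [|x y []//|x y []//].
by apply/hasPn => w /mapP[u _ ->]; apply/negP => /mapP[].
Qed.

Lemma big_allwords_eq (V : nmodType) n x (F : word -> V) :
  \sum_(b <- allwords n | b == x) F b = if size x == n then F x else 0.
Proof.
have [hx|hx] := eqVneq (size x) n.
  by rewrite -big_filter filter_pred1_uniq ?uniq_allwords ?big_seq1 // mem_allwords hx.
rewrite big_seq_cond big1 // => b /andP[]; rewrite mem_allwords => hb1 /eqP hb2.
by rewrite -hb2 hb1 in hx.
Qed.

Lemma big_allwords_delta n x (F : word -> rat) :
  \sum_(b <- allwords n) F b * (b == x)%:R = if size x == n then F x else 0.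
Proof.
rewrite -big_allwords_eq [RHS]big_mkcond; apply: eq_bigr => b _.
by case: eqP; rewrite ?mulr1 ?mulr0.
Qed.

Lemma big_allwords_cat (V : nmodType) i j (F : word -> V) :
  \sum_(w <- allwords (i + j)) F w = \sum_(a <- allwords i) \sum_(b <- allwords j) F (a ++ b).
Proof.
elim: i F => [|i ih] F; first by rewrite big_seq1.
by rewrite addSn !big_allmasksS !ih.
Qed.

Lemma big_allwords_rev (V : nmodType) n (F : word -> V) :
  \sum_(w <- allwords n) F (rev w) = \sum_(w <- allwords n) F w.
Proof.
rewrite -(big_map rev xpredT F); apply: perm_big; apply: uniq_perm.
- by rewrite map_inj_uniq ?uniq_allwords //; exact: (can_inj revK).
- exact: uniq_allwords.
move=> w; rewrite mem_allwords -{1}(revK w) mem_map; last exact: (can_inj revK).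
by rewrite mem_allwords size_rev.
Qed.

Lemma eq_big_allwords (V : nmodType) n (F G : word -> V) :
  (forall w, size w = n -> F w = G w) ->
  \sum_(w <- allwords n) F w = \sum_(w <- allwords n) G w.
Proof. by move=> h; apply: eq_big_seq => w; rewrite mem_allwords => /eqP /h. Qed.

Definition pr n (phi f : sha) : rat := \sum_(w <- allwords n) phi w * f w.
Definition rstrip (v : word) (f : sha) : sha := fun u => f (u ++ v).
Definition M n (psi f : sha) : sha := fun v => pr n psi (rstrip v f).

Lemma pr_is_linear n phi : linear_for *%R (pr n phi).
Proof.
move=> c f g; rewrite /pr [c * _]big_distrr -big_split; apply: eq_bigr => w _ /=.
by rewrite shaD shaZ; ring.
Qed.
HB.instance Definition _ n phi :=
  GRing.isLinear.Build rat sha rat _ (pr n phi) (pr_is_linear n phi).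
Lemma prC n phi f : pr n phi f = pr n f phi.
Proof. by apply: eq_bigr => w _; rewrite mulrC. Qed.
Lemma M_is_linear n psi : linear (M n psi).
Proof. by move=> c f g; apply/funext => v; rewrite /M shaD shaZ -linearP. Qed.
HB.instance Definition _ n phi :=
  GRing.isLinear.Build rat sha sha _ (M n phi) (M_is_linear n phi).

Lemma prS n phi f : pr n.+1 phi f =
  pr n (lder false phi) (lder false f) + pr n (lder true phi) (lder true f).
Proof. exact: big_allmasksS. Qed.
Lemma pr0 phi f : pr 0 phi f = phi [::] * f [::]. Proof. exact: big_seq1. Qed.
Lemma M_nil n psi f : M n psi f [::] = pr n psi f.
Proof. by apply: eq_bigr => w _; rewrite /rstrip cats0. Qed.
Lemma pr_eql n (phi phi' f : sha) : (forall w, size w = n -> phi w = phi' w) ->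
  pr n phi f = pr n phi' f.
Proof. by move=> h; apply: eq_big_allwords => w /h ->. Qed.
Lemma pr_eqr n (phi f f' : sha) : (forall w, size w = n -> f w = f' w) ->
  pr n phi f = pr n phi f'.
Proof. by move=> h; apply: eq_big_allwords => w /h ->. Qed.
Lemma pr_pword n phi w : pr n phi (pword w) = if size w == n then phi w else 0.
Proof. exact: big_allwords_delta. Qed.

(** A mask of a concatenation is a pair of masks, so deconcatenation is multiplicative for the
    shuffle product. *)
Lemma rstripM v (f g : sha) : rstrip v (f * g) =
  \sum_(m <- allmasks (size v)) rstrip (mask m v) f * rstrip (mask (map negb m) v) g.
Proof.
apply/funext => u; rewrite shaE /rstrip -[LHS]/(pshuffle f g _) /pshuffle size_cat big_allwords_cat.
rewrite exchange_big; apply: eq_bigr => m2 _; apply: eq_big_allwords => m1 h1.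
by rewrite map_cat !mask_cat ?size_map.
Qed.

(** Primitivity by duality: pairing with [psi] is a point derivation at the augmentation [f |-> f
    [::]], so it vanishes on products of two series without constant term. *)
Definition prim n (psi : sha) :=
  forall f g : sha, pr n psi (f * g) = pr n psi f * g [::] + f [::] * pr n psi g.
Definition derivation (R : pzRingType) (T : R -> R) := forall f g, T (f * g) = T f * g + f * T g.

Lemma M_deriv n psi : prim n psi -> derivation (M n psi).
Proof.
move=> h f g; apply/funext => v; rewrite shaD /M rstripM linear_sum -big_split /=.
by apply: eq_bigr => m _; rewrite h.
Qed.

Lemma size_maskC (m : bitseq) (w : word) : size m = size w ->
  (size (mask m w) + size (mask (map negb m) w) = size w)%N.
Proof. by elim: m w => [|[] m ih] [|a w] //= [/ih h]; rewrite ?addSn ?addnS h. Qed.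

Lemma big_allwords_delta2 n (x y : word) (F : word -> word -> rat) :
  (size x + size y = n)%N ->
  \sum_(i < n.+1) \sum_(b <- allwords i) \sum_(c <- allwords (n - i))
     F b c * ((x == b)%:R * (y == c)%:R) = F x y.
Proof.
move=> hxy; have hx : (size x < n.+1)%N by lia.
have e (i : 'I_n.+1) : \sum_(b <- allwords i) \sum_(c <- allwords (n - i))
     F b c * ((x == b)%:R * (y == c)%:R) = if size x == i then F x y else 0.
  under eq_bigr => b _.
    under eq_bigr => c _ do rewrite mulrA [y == c]eq_sym.
    rewrite big_allwords_delta [x == b]eq_sym (_ : (if _ then _ else _) =
      (if size y == (n - i)%N then F b y else 0) * (b == x)%:R); last by case: ifP; rewrite ?mul0r.
    over.
  rewrite big_allwords_delta; case: eqP => // hi; by rewrite -hi -hxy addKn eqxx.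
rewrite (eq_bigr _ (fun i _ => e i)) (bigD1 (Ordinal hx)) //= eqxx big1 ?addr0 // => i hi.
by case: eqP => // h; case/eqP: hi; apply/val_inj.
Qed.

Lemma pr_mul_deltaSh n (psi f g : sha) : pr n psi (f * g) =
  \sum_(i < n.+1) \sum_(b <- allwords i) \sum_(c <- allwords (n - i))
     deltaSh psi b c * (f b * g c).
Proof.
transitivity (\sum_(i < n.+1) \sum_(b <- allwords i) \sum_(c <- allwords (n - i))
  \sum_(a <- allwords n) \sum_(m <- allmasks n)
     psi a * (f b * g c) * ((mask m a == b)%:R * (mask (map negb m) a == c)%:R)).
  rewrite /pr; under [RHS]eq_bigr do under eq_bigr do rewrite exchange_big.
  under [RHS]eq_bigr do rewrite exchange_big; rewrite [RHS]exchange_big.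
  apply: eq_big_allwords => a ha; rewrite -[(_ * g) a]/(pshuffle f g a) /pshuffle ha mulr_sumr.
  under [RHS]eq_bigr do under eq_bigr do rewrite exchange_big.
  under [RHS]eq_bigr do rewrite exchange_big; rewrite [RHS]exchange_big.
  apply: eq_big_allwords => m hm.
  by rewrite (big_allwords_delta2 (fun b c => psi a * (f b * g c))) ?size_maskC ?hm ?ha.
apply: eq_bigr => i _; apply: eq_big_allwords => b hb; apply: eq_big_allwords => c hc.
rewrite /deltaSh hb hc subnKC -1?ltnS // mulr_suml; apply: eq_big_allwords => a ha.
rewrite -mulr_sumr mulrAC ha; congr (_ * _ * _).
by rewrite -sum1_count natr_sum [RHS]big_mkcond; apply: eq_bigr => m _; case: eqP; case: eqP;
  rewrite ?mulr0 ?mul0r ?mulr1.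
Qed.

Lemma sh_primitive_prim n psi : sh_primitive psi -> (0 < n)%N -> prim n psi.
Proof.
move=> h n0 f g; rewrite pr_mul_deltaSh.
under eq_bigr do under eq_bigr do under eq_bigr do rewrite h mulrDl.
under eq_bigr do under eq_bigr do rewrite big_split /=.
under eq_bigr do rewrite big_split /=.
rewrite big_split /=; congr (_ + _).
  rewrite big_ord_recr big1 /= ?add0r => [|i _].
    by rewrite subnn /pr mulr_suml; apply: eq_bigr => b _; rewrite big_seq1 mul1r mulrA.
  apply: big1 => b _; rewrite big_seq; apply: big1 => c; rewrite mem_allwords => hc.
  have i_n := ltn_ord i; suff /negbTE -> : c != [::] by rewrite !mul0r.
  by apply/eqP => hc0; rewrite hc0 /= eq_sym subn_eq0 leqNgt i_n in hc.
rewrite big_ord_recl [X in _ + X]big1 ?addr0 => [|i _].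
  by rewrite /= big_seq1 subn0 /pr mulr_sumr; apply: eq_bigr => c _; rewrite mul1r; ring.
rewrite big_seq; apply: big1 => b; rewrite mem_allwords => hb; apply: big1 => c _.
suff /negbTE -> : b != [::] by rewrite !mul0r.
by apply/eqP => hb0; rewrite hb0 /= in hb.
Qed.

(** * Pairing the coaction with a linear form *)

(* For T the contraction of psi with a prefix, Dw is (psi (x) id) of Delta_Gon: a gap of the
   subword selected by Delta_Gon contributes only when its two ends differ, whence the special
   role of the letter x0 (see [pr_Tf]). *)
Fixpoint Dw (T : sha -> sha) (w : word) (f : sha) : rat :=
  match w with
  | [::] => T f [::]
  | true :: w' => Dw T w' (lder true f)
  | false :: w' => Dw T w' (lder false f) + T f (false :: w') - T (lder false f) w'
  end.
Definition Dop T f : sha := fun w => Dw T w f.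

Lemma lder_true_Dop T f : lder true (Dop T f) = Dop T (lder true f). Proof. by []. Qed.
Lemma lder_false_Dop T f : lder false (Dop T f) =
  Dop T (lder false f) + (lder false (T f) - T (lder false f)).
Proof. by apply/funext => w; rewrite !shaE addrA. Qed.

Lemma Dop_is_linear (T : {linear sha -> sha}) : linear (Dop T).
Proof.
move=> c f g; apply/funext => w; rewrite shaD shaZ /Dop.
elim: w f g => [|[] w ih] f g /=; first by rewrite linearP.
  by rewrite linearP ih.
by rewrite ![lder _ _]linearP /= !(linearP T) ih !shaE; ring.
Qed.
HB.instance Definition _ (T : {linear sha -> sha}) :=
  GRing.isLinear.Build rat sha sha _ (Dop T) (Dop_is_linear T).

(** [Dop T] commutes with [lder true], and its commutator with [lder false] is that of [T]. A
    commutator of derivations is a derivation, so the Leibniz rule propagates along the word. *)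
Lemma Dop_deriv (T : {linear sha -> sha}) : derivation T -> derivation (Dop T).
Proof.
move=> h f g; apply/funext => w; elim: w f g => [|[] w ih] f g.
- by rewrite shaD !sha_nil -[RHS]/(T f [::] * _ + _ * T g [::]) -!sha_nil -shaD -h.
- rewrite !lderE lder_true_Dop !(lderM, linearD) /= !lderM !lder_true_Dop !shaD !ih !shaD.
  by ring.
rewrite !lderE lder_false_Dop !(lderM, linearD) /= !lderM !lder_false_Dop !h !(lderM, linearD) /=.
by rewrite !(mulrDl, mulrDr, mulNr, mulrN, shaD, shaN) !ih !lderM !shaD; ring.
Qed.

Definition D n psi : sha -> sha := Dop (M n psi).
HB.instance Definition _ n psi := GRing.Linear.on (D n psi).

Lemma D_nil n psi f : D n psi f [::] = pr n psi f. Proof. exact: M_nil. Qed.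
Lemma D_deriv n psi : prim n psi -> derivation (D n psi).
Proof. by move=> h; apply: Dop_deriv; apply: M_deriv. Qed.

Lemma homogP N (f : sha) : homog N f -> f = \sum_(w <- allwords N) f w *: (pword w : sha).
Proof.
move=> h; apply/funext => w; rewrite sha_sum.
have := big_allwords_delta N w f; rewrite (_ : (if _ then _ else _) = f w); last first.
  by case: ifP => // /negbT /h ->.
by move=> {1}<-; apply: eq_bigr => u _; rewrite shaZ /pword eq_sym.
Qed.

Lemma lder_pword a b w : lder a (pword (b :: w)) = (a == b)%:R *: (pword w : sha) :> sha.
Proof.
by apply/funext => u; rewrite /lder shaZ /pword eqseq_cons -mulnb natrM.
Qed.
Lemma lder_pword_nil a : lder a (pword [::]) = 0 :> sha. Proof. exact/funext. Qed.

(** The antipode identity of the shuffle Hopf algebra. After a left derivative, the letter stripped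
    from the reversed prefix in term k + 1 is the one stripped from the suffix in term k, with
    opposite sign. *)
Lemma pword_antipode (w : word) : w != [::] ->
  \sum_(k < (size w).+1) (-1) ^+ k *: ((pword (rev (take k w)) : sha) * pword (drop k w)) = 0.
Proof.
move=> w0; set n := size w; apply: lderP => [|a].
  rewrite sha_sum big1 ?sha0 // => k _; rewrite shaZ sha_nil /pword.
  rewrite eq_sym [_ == drop _ _]eq_sym -!size_eq0 size_rev size_take size_drop -/n.
  have : n != 0%N by rewrite size_eq0.
  have [hk|hk] := ltnP k n => hn; last by rewrite (negbTE hn) mul0r mulr0.
  by rewrite subn_eq0 leqNgt hk !mulr0.
rewrite linear_sum linear0 /=; under eq_bigr do rewrite linearZ /= lderM scalerDr.
rewrite big_split /= big_ord_recl take0 -[rev [::]]/([::]) lder_pword_nil mul0r scaler0 add0r.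
rewrite [X in _ + X]big_ord_recr /= drop_size lder_pword_nil mulr0 scaler0 addr0 -big_split /=.
apply: big1 => k _; rewrite /bump /= add1n (take_nth false) ?rev_rcons // lder_pword.
rewrite [in X in _ + X](drop_nth false) // lder_pword exprS mulN1r scaleNr.
by rewrite -scalerAl -scalerAr addNr.
Qed.

(** Paired with a primitive form, only the two extreme terms of the antipode identity survive; the
    others are products of positive weights. *)
Lemma prim_antipode n psi (w : word) : prim n psi -> (0 < n)%N -> size w = n ->
  psi (rev w) = - ((-1) ^+ n * psi w).
Proof.
move=> h n0 hw; have w0 : w != [::] by rewrite -size_eq0 hw -lt0n.
have := congr1 (pr n psi) (pword_antipode w0); rewrite linear0 linear_sum hw /= => e.
have : \sum_(i < n.+1) (-1) ^+ i * (pr n psi (pword (rev (take i w))) * (drop i w == [::])%:R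
   + (take i w == [::])%:R * pr n psi (pword (drop i w))) = 0.
  rewrite -[RHS]e; apply: eq_bigr => i _; rewrite linearZ /= h; congr (_ * (_ * _ + _ * _)).
    by rewrite /pword eq_sym.
  by rewrite /pword [[::] == _]eq_sym -!size_eq0 size_rev.
case: n n0 hw h {e} => // n _ hw h; rewrite big_ord_recl big_ord_recr big1 /= => [|i _].
  rewrite take0 drop0 /bump /= add1n -hw take_size drop_size eqxx expr0 !pr_pword size_rev hw eqxx.
  rewrite (negbTE w0) /= size_rev hw eqxx !(mulr0, mul0r, mulr1, mul1r, add0r, addr0).
  by move/eqP; rewrite addr_eq0 => /eqP ->; rewrite mulrN opprK mulrA -expr2 sqrr_sign mul1r.
rewrite /bump /= add1n -!size_eq0 size_take size_drop hw ltnS; have := ltn_ord i.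
by move=> hi; rewrite hi subSS subn_eq0 leqNgt hi /=; ring.
Qed.

Definition eps_nil (f : word) : rat := (f == [::])%:R.
(** Sign with which I(a; f; b) pairs with a primitive form, relative to f: the antipode S(f) pairs
    as -f, and equal ends give 0. *)
Definition sgap (a b : bool) : rat := a%:R - b%:R.

Lemma pshuffle_nil f g : pshuffle f g [::] = f [::] * g [::].
Proof. exact: shm_nil. Qed.

Lemma pscaleE c (f : xpoly) : pscale c f = c *: (f : sha). Proof. by []. Qed.

Lemma gleft_nil a acc e ps :
  gleft ((a, acc, e) :: ps) [::] = eps_nil acc * gleft ps [::].
Proof.
have hn f : pword f [::] = eps_nil f by rewrite /pword /eps_nil eq_sym.
rewrite /= /Ipiece; case: eqP => [_|hae].
  by case: acc => [|x acc]; rewrite /pscale ?pshuffle_nil /eps_nil ?mul1r ?mul0r.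
case: a hae => hae; first by rewrite /pscale pshuffle_nil hn mul1r.
rewrite /pscale pshuffle_nil hn /eps_nil.
case: acc => [|x acc]; first by rewrite expr0 mul1r.
by rewrite rev_cons -[_ == [::]]size_eq0 size_rcons !mul0r mulr0.
Qed.

(** A primitive form sees a product of gaps only if all but one are empty: either the first gap
    carries the whole weight, or the remaining ones do. *)
Lemma pr_gleft n psi a acc e ps : prim n psi -> (0 < n)%N ->
  pr n psi (gleft ((a, acc, e) :: ps)) =
    sgap a e * pr n psi (pword acc) * gleft ps [::] + eps_nil acc * pr n psi (gleft ps).
Proof.
move=> h n0; have h0 : pr n psi (pword [::]) = 0 by rewrite pr_pword; case: n n0 {h}.
rewrite /= /Ipiece; case: eqP => [->|hae].
  rewrite /sgap subrr !mul0r add0r; case: acc => [|x acc].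
    by rewrite pscaleE mulE scale1r h h0 mul0r add0r.
  by rewrite -[pzero]/(0 : sha) linear0 mul0r.
have hn f : pword f [::] = eps_nil f by rewrite /pword /eps_nil eq_sym.
case: a hae => hae.
  rewrite pscaleE mulE scale1r h /sgap hn.
  by case: e hae => //; rewrite subr0 mul1r.
rewrite pscaleE mulE linearZ /= h /sgap.
case: e hae => // _; rewrite hn sub0r mulrDr; congr (_ + _).
  rewrite !pr_pword size_rev; case: eqP => [hs|_]; last by rewrite !(mul0r, mulr0).
  by rewrite (prim_antipode h n0 hs) hs !mulrA mulrN mulrA -expr2 sqrr_sign !mulN1r mul1r.
case: acc => [|x acc]; first by rewrite expr0 mul1r.
by rewrite /eps_nil rev_cons -[rcons _ _ == _]size_eq0 size_rcons !mul0r mulr0.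
Qed.

(** The empty word on the left requires every gap to be empty, which the full mask alone
    achieves. *)
Lemma gleft_nil_sum a acc w b : \sum_(m <- allmasks (size w))
    (mask m w == b)%:R * gleft (gpieces a acc w m) [::] = eps_nil acc * (w == b)%:R.
Proof.
elim: w a acc b => [|x w ih] a acc b.
  rewrite big_seq1 -[gpieces _ _ _ _]/([:: (a, acc, false)]).
  by rewrite gleft_nil [gleft [::]]/= /pword eqxx mulr1 mulrC.
rewrite [size _]/= big_allmasksS.
have -> : \sum_(m <- allmasks (size w)) (mask (false :: m) (x :: w) == b)%:R *
    gleft (gpieces a acc (x :: w) (false :: m)) [::] = 0.
  transitivity (\sum_(m <- allmasks (size w)) (mask m w == b)%:R *
    gleft (gpieces a (rcons acc x) w m) [::]); first by [].
  by rewrite ih {1}/eps_nil -size_eq0 size_rcons mul0r.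
rewrite add0r; case: b => [|y b]; first by rewrite big1 ?mulr0 // => m _; rewrite mul0r.
transitivity (\sum_(m <- allmasks (size w)) eps_nil acc * (x == y)%:R *
    ((mask m w == b)%:R * gleft (gpieces x [::] w m) [::])).
  apply: eq_bigr => m _; rewrite -[gpieces _ _ _ _]/((a, acc, x) :: gpieces x [::] w m) gleft_nil.
  by rewrite [mask _ _]/= eqseq_cons -mulnb natrM; ring.
by rewrite -mulr_sumr ih {2}/eps_nil eqseq_cons -mulnb natrM /= mul1r mulrA.
Qed.

Lemma cat_inj_size (T : eqType) (u u' c c' : seq T) :
  u ++ c = u' ++ c' -> size c = size c' -> u = u' /\ c = c'.
Proof.
move=> e hc; have hs : size u = size u'.
  by have := congr1 size e; rewrite !size_cat hc => /addIn.
by move/eqP: e; rewrite eqseq_cat // => /andP[/eqP-> /eqP->].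
Qed.

(** Contribution of the masks whose current gap carries the whole weight n: past this gap every
    letter is selected, so the rest of the word must be [b]. *)
Fixpoint lastpiece n (psi : sha) (acc w b : word) : rat :=
  match w with
  | [::] => (b == [::])%:R * pr n psi (pword acc)
  | x :: w' => (x :: w' == b)%:R * pr n psi (pword acc) + lastpiece n psi (rcons acc x) w' b
  end.

Definition gonsum n psi a acc w b := \sum_(m <- allmasks (size w))
    (mask m w == b)%:R * pr n psi (gleft (gpieces a acc w m)).

Lemma gonsumE n psi a acc w b : prim n psi -> (0 < n)%N ->
  gonsum n psi a acc w b = sgap a (head false b) * lastpiece n psi acc w b +
   (if w is x :: w' then if b is y :: b' then eps_nil acc * (x == y)%:R * gonsum n psi x [::] w' b'
      else 0 else 0).
Proof.
move=> h n0; have h0 : pr n psi 1 = 0 by rewrite pr_pword; case: n n0 {h}.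
elim: w a acc b => [|x w ih] a acc b.
  rewrite /gonsum big_seq1 -[gpieces _ _ _ _]/([:: (a, acc, false)]) pr_gleft // [gleft [::]]/= h0 mulr0 !addr0.
  by rewrite /pword eqxx mulr1 /= eq_sym mulrCA; case: b => [|y b] //; rewrite !mul0r !mulr0.
rewrite {1}/gonsum [size _]/= big_allmasksS.
have -> : \sum_(m <- allmasks (size w)) (mask (false :: m) (x :: w) == b)%:R *
    pr n psi (gleft (gpieces a acc (x :: w) (false :: m))) = gonsum n psi a (rcons acc x) w b by [].
rewrite ih (_ : (if w is _ :: _ then _ else 0) = 0) ?addr0; last first.
  by case: w {ih} => // y w; case: b => // z b; rewrite /eps_nil -size_eq0 size_rcons !mul0r.
rewrite [lastpiece _ _ _ (_ :: _) _]/= mulrDr [RHS]addrAC [RHS]addrC; congr (_ + _).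
case: b => [|y b]; first by rewrite big1 ?mul0r ?mulr0 ?addr0 // => m _; rewrite mul0r.
have -> : \sum_(m <- allmasks (size w)) (mask (true :: m) (x :: w) == y :: b)%:R *
    pr n psi (gleft (gpieces a acc (x :: w) (true :: m))) =
  (x == y)%:R * (sgap a x * pr n psi (pword acc) *
     (\sum_(m <- allmasks (size w)) (mask m w == b)%:R * gleft (gpieces x [::] w m) [::])
   + eps_nil acc * gonsum n psi x [::] w b).
  move: (pr n psi (pword acc)) (fun m => @pr_gleft n psi a acc x (gpieces x [::] w m) h n0) => P hP.
  have e m : (mask (true :: m) (x :: w) == y :: b)%:R *
      pr n psi (gleft (gpieces a acc (x :: w) (true :: m))) =
    (x == y)%:R * (sgap a x * P) * ((mask m w == b)%:R * gleft (gpieces x [::] w m) [::]) +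
    (x == y)%:R * eps_nil acc * ((mask m w == b)%:R * pr n psi (gleft (gpieces x [::] w m))).
    rewrite -[gpieces _ _ _ (true :: m)]/((a, acc, x) :: gpieces x [::] w m) hP.
    by rewrite [mask (true :: m) _]/= eqseq_cons -mulnb natrM; ring.
  by rewrite (eq_bigr _ (fun m _ => e m)) big_split -!mulr_sumr mulrDr !mulrA.
rewrite gleft_nil_sum -[eps_nil [::]]/(1 : rat) mul1r eqseq_cons -mulnb natrM [head _ _]/=.
by case: eqP => [->|_]; rewrite !(mul0r, mul1r, mulr0, addr0) //=; ring.
Qed.

Lemma lastpiece_big n psi acc w b : (size w < size b)%N -> lastpiece n psi acc w b = 0.
Proof.
elim: w acc => [|x w ih] acc; first by case: b => //= *; rewrite mul0r.
move=> hb; rewrite /= ih ?addr0; last by move: hb => /=; lia.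
by case: eqP => [e|]; rewrite ?mul0r //; rewrite -e ltnn in hb.
Qed.

Lemma lastpieceE n psi acc w b : (size b <= size w)%N ->
  lastpiece n psi acc w b = M n psi (pword (acc ++ w)) b.
Proof.
have M1 a (c : word) : M n psi (pword (a ++ c)) c = pr n psi (pword a).
  apply: pr_eqr => u _; rewrite /rstrip /pword; congr (_ %:R); congr nat_of_bool.
  by apply/eqP/eqP => [/cat_inj_size[]|->].
elim: w acc b => [|x w ih] acc b /=.
  by case: b => // _; rewrite M1 mul1r.
rewrite leq_eqVlt => /orP[/eqP hb|]; last first.
  rewrite ltnS => hb; rewrite ih // cat_rcons (_ : (_ == b) = false) ?mul0r ?add0r //.
  by apply/negbTE/eqP => e; rewrite -e /= ltnn in hb.
have -> : lastpiece n psi (rcons acc x) w b = 0 by rewrite lastpiece_big ?hb.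
rewrite addr0; case: eqP => [<-|e]; first by rewrite M1 mul1r.
rewrite mul0r /M /pr big1 // => u _; rewrite /rstrip /pword.
by case: eqP => [/cat_inj_size[]//|_] => [_ /esym /e|]; rewrite ?mulr0.
Qed.

(** The gap after the letter [a] ends at the next selected letter, or at eps_{n+1} = x0 if none is
    left; this is the default [false] of [head]. *)
Fixpoint Dgap n psi a (b : word) (f : sha) : rat :=
  sgap a (head false b) * M n psi f b + (if b is y :: b' then Dgap n psi y b' (lder y f) else 0).

(** Each sign [sgap a y] is a difference of contributions of its two ends, and regrouping them
    letter by letter gives the terms of [Dw] at x0. A left end x0 in place of x1 removes one term
    [M]. *)
Lemma DgapE n psi a b f : Dgap n psi a b f = D n psi f b - (~~ a)%:R * M n psi f b.
Proof.
elim: b a f => [|y b ih] a f.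
  by rewrite /= /D /Dop /= /sgap subr0 addr0; case: a => /=; ring.
rewrite [LHS]/= ih {2}/D /Dop [Dw _ _ _]/= /sgap; case: y => /=; case: a;
  rewrite -/(Dop (M n psi) _ b) -/(D n psi) -/(D n psi _) /lder /=; ring.
Qed.

Lemma M_pword_big n psi w b : (size w < size b)%N -> M n psi (pword w) b = 0.
Proof.
move=> hb; rewrite /M /pr big1 // => u _; rewrite /rstrip /pword; case: eqP => [e|_].
  by rewrite -e size_cat ltnNge leq_addl in hb.
by rewrite mulr0.
Qed.

Lemma gonsum_Dgap n psi a w b : prim n psi -> (0 < n)%N ->
  gonsum n psi a [::] w b = Dgap n psi a b (pword w).
Proof.
move=> h n0; elim: w a b => [|x w ih] a b; rewrite gonsumE //.
  have -> : lastpiece n psi [::] [::] b = M n psi (pword [::]) b.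
    by have [hb|hb] := leqP (size b) 0; [apply: lastpieceE | rewrite lastpiece_big ?M_pword_big].
  case: b => [|y b] //=; congr (_ + _).
  by rewrite lder_pword_nil DgapE !linear0 /= mulr0 subr0.
have -> : lastpiece n psi [::] (x :: w) b = M n psi (pword (x :: w)) b.
  have [hb|hb] := leqP (size b) (size (x :: w)); first exact: lastpieceE.
  by rewrite lastpiece_big ?M_pword_big.
case: b => [|y b] //=; congr (_ + _); rewrite ih mul1r lder_pword eq_sym DgapE [RHS]DgapE.
case: eqP => [->|_]; first by rewrite mul1r scale1r.
by rewrite mul0r scale0r !linear0 /= mulr0 subr0.
Qed.

Lemma pr_Tf N n psi f b : homog N f -> prim n psi -> (0 < n)%N ->
  pr n psi (Tf N f ^~ b) = D n psi f b.
Proof.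
move=> hf h n0; rewrite [in RHS](homogP hf) linear_sum /= sha_sum.
transitivity (\sum_(w <- allwords N) f w * pr n psi (gon w ^~ b)).
  rewrite /pr; under [RHS]eq_bigr do rewrite mulr_sumr.
  rewrite exchange_big; apply: eq_big_allwords => a ha; rewrite /Tf.
  (* The subtracted 1 (x) id sits in weight 0 on the left, invisible to [pr n psi] for n > 0. *)
  have -> : (a == [::]) = false by apply/negbTE; rewrite -size_eq0 ha -lt0n.
  by rewrite mul0r subr0 mulr_sumr; apply: eq_bigr => w _; ring.
apply: eq_bigr => w _; rewrite linearZ /= shaZ; congr (_ * _).
rewrite (_ : D n psi _ b = Dgap n psi true b (pword w)); last by rewrite DgapE mul0r subr0.
rewrite -gonsum_Dgap // /gonsum /pr; under [RHS]eq_bigr do rewrite mulr_sumr.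
rewrite exchange_big; apply: eq_bigr => a _; rewrite /gon mulr_sumr.
by apply: eq_bigr => m _; ring.
Qed.

(** * Weights, convergent words and the action on zeta(N) *)

Lemma yend_polyP v : yend_poly v <-> forall w, v (rcons w false) = 0.
Proof.
split=> [h w|h w hw]; last first.
  by case/lastP: w hw => // w []; rewrite /isYword ?h ?eqxx // last_rcons orbT.
by apply/eqP/negP => /negP /h; rewrite /isYword last_rcons -size_eq0 size_rcons.
Qed.
Lemma conv_polyP u : conv_poly u <-> yend_poly u /\ lder true u = 0.
Proof.
split=> [h|[h1 h2] w hw].
  split=> [w /h /orP[/eqP->//|/andP[_ hl]]|]; first by rewrite /isYword hl orbT.
  apply/funext => w; apply/eqP/negP => /negP hw.
  by have := h (true :: w); rewrite lderE => /(_ hw).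
have := h1 w hw; rewrite /isYword => /orP[->//|->]; rewrite andbT.
by case: w hw => [|[] w] //; rewrite lderE h2 eqxx.
Qed.

Lemma M_eq0 n psi (f : sha) w : (forall u, size u = (n + size w)%N -> f u = 0) -> M n psi f w = 0.
Proof.
move=> h; rewrite /M /pr big_seq big1 // => a; rewrite mem_allwords => ha.
by rewrite /rstrip h ?mulr0 // size_cat (eqP ha).
Qed.
Lemma D_eq0 n psi (f : sha) w : (forall u, size u = (n + size w)%N -> f u = 0) -> D n psi f w = 0.
Proof.
rewrite /D /Dop; elim: w f => [|a w ih] f h; first exact: M_eq0.
have h' u : size u = (n + size w)%N -> lder a f u = 0 by move=> hu; apply: h; rewrite /= hu addnS.
by case: a h h' => h h' /=; rewrite ih // !M_eq0 // addr0 subr0.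
Qed.

Lemma D_homog n psi N f : homog (n + N) f -> homog N (D n psi f).
Proof.
move=> h w hw; apply: D_eq0 => u hu; apply: h; rewrite hu eqn_add2l.
exact: hw.
Qed.
Lemma D_homog0 n psi N f : (N < n)%N -> homog N f -> D n psi f = 0.
Proof.
move=> hN h; apply/funext => w; apply: D_eq0 => u hu; apply: h.
by apply/eqP; lia.
Qed.
Lemma D_ispoly n psi f : ispoly f -> ispoly (D n psi f).
Proof.
by case=> B h; exists B => w hw; apply: D_eq0 => u hu; apply: h; rewrite hu; lia.
Qed.

Lemma M_yend n psi f : yend_poly f -> yend_poly (M n psi f).
Proof.
move=> /yend_polyP h; apply/yend_polyP => w; rewrite /M /pr big1 // => a _.
by rewrite /rstrip -rcons_cat h mulr0.
Qed.
Lemma lder_yend a f : yend_poly f -> yend_poly (lder a f).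
Proof. by move=> /yend_polyP h; apply/yend_polyP => w; rewrite /lder -rcons_cons h. Qed.
Lemma D_yend n psi f : yend_poly f -> yend_poly (D n psi f).
Proof.
move=> h; apply/yend_polyP => w; rewrite /D /Dop; elim: w f h => [|a w ih] f h.
  rewrite /= !M_nil (_ : M n psi f [:: false] = 0) ?addr0 ?subrr //.
  by have /yend_polyP := @M_yend n psi _ h => /(_ [::]).
have hM := yend_polyP (M n psi f); have := @M_yend n psi _ h => /hM {}hM.
have := @M_yend n psi _ (@lder_yend false _ h) => /yend_polyP hM'.
case: a; rewrite /= ih ?hM' -?rcons_cons ?hM ?subrr ?addr0 //; exact: lder_yend.
Qed.
Lemma D_conv n psi f : conv_poly f -> conv_poly (D n psi f).
Proof.
move=> /conv_polyP[h1 h2]; apply/conv_polyP; split; first exact: D_yend.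
by rewrite lder_true_Dop h2 linear0.
Qed.

Lemma homog0P f : homog 0 f -> f = f [::] *: 1 :> sha.
Proof. by move=> /homogP {1}->; rewrite big_seq1. Qed.

Lemma D_homogn n psi f : homog n f -> D n psi f = pr n psi f *: 1.
Proof. by rewrite -[in homog _](addn0 n) => /(@D_homog n psi) /homog0P ->; rewrite D_nil. Qed.

Lemma homog_pword w : homog (size w) (pword w).
Proof. by move=> u hu; rewrite /pword; case: eqP => // e; rewrite e eqxx in hu. Qed.

Lemma pword_nseqM a i j : (pword (nseq i a) : sha) * pword (nseq j a) =
  'C(i + j, i)%:R *: (pword (nseq (i + j) a) : sha).
Proof.
elim: i j => [|i ih] j; first by rewrite bin0 scale1r mul1r.
elim: j => [|j ihj]; first by rewrite addn0 binn scale1r mulr1.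
apply: lderP => [|b]; first by rewrite sha_nil shaZ /pword /= !mulr0.
rewrite lderM !addSn linearZ /= !lder_pword -!scalerAl -!scalerAr (ih j.+1).
have -> : (pword (a :: nseq i a) : sha) * pword (nseq j a) = 'C(i.+1 + j, i.+1)%:R *: (pword (nseq (i.+1 + j) a) : sha) :> sha.
  exact: ihj.
rewrite addSn !addnS (binS (i + j).+1 i) natrD.
by rewrite !scalerA -scalerDl; congr (_ *: _); ring.
Qed.

(** The word a^n is 1/n times the shuffle of a with a^{n-1}, a product of positive weights once n >
    1. *)
Lemma prim_nseq n psi a : prim n psi -> (1 < n)%N -> psi (nseq n a) = 0.
Proof.
case: n => [|[|n]] // h _; have := h (pword (nseq 1 a)) (pword (nseq n.+1 a)).
rewrite pword_nseqM linearZ /= add1n bin1 mulr0 mul0r addr0 pr_pword /= size_nseq eqxx.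
by move/eqP; rewrite mulf_eq0 pnatr_eq0 /= => /eqP.
Qed.

Definition z1 k : sha := pword (rcons (nseq k false) true).
(** A prefix of length n <= k of x0^k x1 is x0^n, on which [psi] vanishes. *)
Lemma D_z1 n psi k : (forall j, (0 < j)%N -> psi (nseq j false) = 0) -> (0 < n <= k)%N ->
  D n psi (z1 k) = 0.
Proof.
move=> h; have M0 j : (0 < n <= j)%N -> M n psi (z1 j) = 0.
  move=> /andP[n0 hj]; apply/funext => w; rewrite /M /pr big_seq big1 // => a.
  rewrite mem_allwords => ha; rewrite /rstrip /z1 /pword; case: eqP => [e|_]; last by rewrite mulr0.
  have : take n (a ++ w) = take n (rcons (nseq j false) true) by rewrite e.
  rewrite take_size_cat ?(eqP ha) // -cats1 takel_cat ?size_nseq // take_nseq // => ->.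
  by rewrite h ?mul0r.
elim: k => [|k ih] /andP[n0 hk]; first by rewrite leqNgt n0 in hk.
have hom j : homog j.+1 (z1 j) by have := @homog_pword (rcons (nseq j false) true);
  rewrite size_rcons size_nseq.
apply: lderP => [|[]].
- rewrite D_nil -[X in pr _ _ X]/(pword _) pr_pword size_rcons size_nseq; case: eqP => // e; lia.
- by rewrite lder_true_Dop /z1 /= lder_pword scale0r !linear0.
rewrite lder_false_Dop M0 ?n0 // linear0 sub0r.
have -> : lder false (z1 k.+1) = z1 k by rewrite /z1 /= lder_pword scale1r.
have [hk'|hk'] := leqP n k; first by rewrite -/(D n psi _) ih ?M0 ?n0 // subrr.
(* In this borderline weight [D] and [M] of [z1 k] are both the constant psi(x0^k x1), and they
   cancel. *)
have e : n = k.+1 by lia.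
rewrite -/(D n psi (z1 k)); apply/eqP; rewrite subr_eq0; apply/eqP/funext => w.
case: w => [|a w]; first by rewrite D_nil M_nil.
by rewrite D_eq0 ?M_eq0 // => u hu; apply: hom; rewrite hu e /=; apply/eqP; lia.
Qed.

(** * The Ihara bracket *)

(** [Dop T] is determined by three facts: its constant coefficient is that of [T], it commutes with
    [lder true], and [Dop T - T] commutes with [lder false]. The hypothesis on [T3] is the
    transposed Ihara bracket, for which the commutator satisfies the same three facts. *)
Lemma Dop_commutator (T1 T2 T3 : {linear sha -> sha}) :
  (forall x, T3 x = T1 (T2 x) - T2 (T1 x) + Dop T2 (T1 x) - T1 (Dop T2 x)
     - Dop T1 (T2 x) + T2 (Dop T1 x)) ->
  forall x, Dop T3 x = Dop T2 (Dop T1 x) - Dop T1 (Dop T2 x).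
Proof.
move=> h x; apply/funext => w; elim: w x => [|[] w ih] x.
- rewrite -[LHS]/(T3 x [::]) h !shaE.
  by rewrite -![Dop _ _ [::]]/((_ : sha -> sha) _ [::]) /Dop /=; ring.
- by rewrite lderE lder_true_Dop ih !shaE.
rewrite lderE lder_false_Dop shaD ih !h [RHS]lderE.
have D1B y z : Dop T1 (y + z) = Dop T1 y + Dop T1 z by rewrite linearD.
have D2B y z : Dop T2 (y + z) = Dop T2 y + Dop T2 z by rewrite linearD.
have D1N y : Dop T1 (- y) = - Dop T1 y by rewrite linearN.
have D2N y : Dop T2 (- y) = - Dop T2 y by rewrite linearN.
have LD y z : lder false (y + z) = lder false y + lder false z by rewrite linearD.
have LN y : lder false (- y) = - lder false y by rewrite linearN.
(* What is left uses additivity and the two rules for commuting with [L]; abstracting the operators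
   lets [ring] compare the expansions. *)
move: (lder_false_Dop T1) (lder_false_Dop T2) D1B D2B D1N D2N LD LN {h ih}.
move: (lder false) (Dop T1) (Dop T2) => L D1 D2.
have T1D y z : T1 (y + z) = T1 y + T1 z by rewrite linearD.
have T2D y z : T2 (y + z) = T2 y + T2 z by rewrite linearD.
have T1N y : T1 (- y) = - T1 y by rewrite linearN.
have T2N y : T2 (- y) = - T2 y by rewrite linearN.
move: (T1 : sha -> sha) (T2 : sha -> sha) T1D T2D T1N T2N.
move=> {T1 T2} T1 T2 T1D T2D T1N T2N L1 L2 D1D D2D D1N D2N LD LN.
by rewrite !(L1, L2, D1D, D2D, D1N, D2N, T1D, T2D, T1N, T2N, LD, LN) !shaE; ring.
Qed.


Lemma prM_gconcat n m (f g y : sha) : homog n f -> homog m g ->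
  pr (n + m) (gconcat f g) y = \sum_(a <- allwords n) \sum_(b <- allwords m) f a * g b * y (a ++ b).
Proof.
move=> hf hg; rewrite /pr big_allwords_cat; apply: eq_big_allwords => a ha.
apply: eq_big_allwords => b hb; congr (_ * _); rewrite /gconcat.
have hi : (n < (size (a ++ b)).+1)%N by rewrite size_cat ha hb; lia.
rewrite (bigD1 (Ordinal hi)) //= take_size_cat // drop_size_cat // big1 ?addr0 // => i hne.
rewrite hf ?mul0r // size_take; case: ltnP => h; last first.
  by apply/eqP => e; case/eqP: hne; apply/val_inj => /=; have := ltn_ord i; lia.
by apply/eqP => e; case/eqP: hne; apply/val_inj.
Qed.

Lemma M_gconcat n m (f g x : sha) : homog n f -> homog m g ->
  M (n + m) (gconcat f g) x = M m g (M n f x).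
Proof.
move=> hf hg; apply/funext => w; rewrite /M prM_gconcat // exchange_big.
apply: eq_bigr => b _; rewrite /rstrip /pr mulr_sumr; apply: eq_bigr => a _.
by rewrite catA; ring.
Qed.

Lemma gconcat_homog n m (f g : sha) : homog n f -> homog m g -> homog (n + m) (gconcat f g).
Proof.
move=> hf hg w hw; rewrite /gconcat big1 // => i _.
have [h|h] := eqVneq (size (take i w)) n; last by rewrite hf ?mul0r.
rewrite [X in _ * X]hg ?mulr0 //; apply: contra hw => /eqP <-; rewrite -h.
by rewrite -size_cat cat_take_drop.
Qed.

Definition lstrip (b : word) (f : sha) : sha := fun v => f (b ++ v).
(** Transpose of the derivation d_f: subtracting [M n f] removes the product f g from g |-> f g +
    d_f(g). *)
Definition dop n f x : sha := D n f x - M n f x.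

Lemma dop_true n f x v : dop n f x (true :: v) =
  dop n f (lder true x) v + (M n f (lder true x) v - M n f x (true :: v)).
Proof. by rewrite /dop !shaE lderE lder_true_Dop -/(D n f _); ring. Qed.
Lemma dop_false n f x v : dop n f x (false :: v) = dop n f (lder false x) v.
Proof. by rewrite /dop !shaE lderE lder_false_Dop -/(D n f _) !shaE /lder; ring. Qed.

(** The part of d_f that replaces the i-th letter of [b] by [x1, f]; the leading factor is 0 when
    that letter is x0. *)
Definition dterm n (f x : sha) i (b w : word) : rat := (nth false b i)%:R *
  \sum_(c <- allwords n) f c *
    (x (take i b ++ true :: c ++ drop i.+1 b ++ w) - x (take i b ++ c ++ true :: drop i.+1 b ++ w)).

Lemma dop_cat n f x b w : dop n f x (b ++ w) =
  dop n f (lstrip b x) w + \sum_(i < size b) dterm n f x i b w.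
Proof.
elim: b x => [|a b ih] x; first by rewrite big_ord0 addr0.
have e : \sum_(i < size b) dterm n f (lder a x) i b w =
  \sum_(i < size b) dterm n f x (lift ord0 i) (a :: b) w by apply: eq_bigr.
rewrite [size _]/= big_ord_recl cat_cons.
case: a e => e; rewrite ?dop_true ?dop_false ih e.
  rewrite -addrA; congr (_ + _); rewrite [LHS]addrC; congr (_ + _).
  rewrite /dterm /= drop0 mul1r /M /pr -sumrB; apply: eq_bigr => c _.
  by rewrite /rstrip /lder mulrBr.
by rewrite [X in _ = _ + (X + _)](_ : _ = 0) ?add0r // /dterm /= mul0r.
Qed.

Lemma gcomm_x1 n (f y : sha) : homog n f ->
  pr n.+1 (gcomm (pword [:: true]) f) y = \sum_(c <- allwords n) f c * (y (true :: c) - y (rcons c true)).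
Proof.
move=> hf; have h1 : homog 1 (pword [:: true]) by apply: (@homog_pword [:: true]).
transitivity (pr (1 + n) (gconcat (pword [:: true]) f) y - pr (n + 1) (gconcat f (pword [:: true])) y).
  by rewrite addn1 /pr -sumrB; apply: eq_bigr => w _; rewrite /gcomm mulrBl.
rewrite !prM_gconcat // -[allwords 1]/[:: [:: false]; [:: true]] !big_cons big_nil addr0.
rewrite big1 ?add0r => [|b _]; last by rewrite !mul0r.
rewrite -sumrB; apply: eq_bigr => c _; by rewrite !big_cons big_nil /pword /= !cats1; ring.
Qed.

(** For homogeneous f and g the two cuts of [pderiv] enclose the factor [x1, f] of length n + 1,
    which forces j = i + n + 1. *)
Lemma pderivE n m (f g : sha) u : homog n f -> homog m g -> size u = (n + m)%N ->
  pderiv f g u = \sum_(i < m) g (take i u ++ true :: drop (i + n.+1) u) *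
     gcomm (pword [:: true]) f (drop i (take (i + n.+1) u)).
Proof.
move=> hf hg hu; rewrite /pderiv hu.
have hm : (m <= (n + m).+1)%N by lia.
rewrite (big_ord_widen _ (fun i => g (take i u ++ true :: drop (i + n.+1) u) *
     gcomm (pword [:: true]) f (drop i (take (i + n.+1) u))) hm) [RHS]big_mkcond.
apply: eq_bigr => i _; have hi := ltn_ord i.
have g0 (j : 'I_(n + m).+1) : (i <= j)%N -> j != (i + n.+1)%N :> nat ->
    g (take i u ++ true :: drop j u) = 0.
  move=> hij hj; apply: hg; rewrite size_cat /= size_drop size_take hu; have hj' := ltn_ord j.
  by case: ltnP => ?; apply/eqP; lia.
case: ltnP => him.
  have hj : (i + n.+1 < (n + m).+1)%N by lia.
  rewrite (bigD1 (Ordinal hj)) /=; last by lia.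
  by rewrite big1 ?addr0 // => j /andP[hij hne]; rewrite g0 ?mul0r.
by rewrite big1 // => j hij; rewrite g0 ?mul0r //; have := ltn_ord j; lia.
Qed.

Lemma M_sum n psi (f : sha) : M n psi f = \sum_(b <- allwords n) psi b *: lstrip b f.
Proof. by apply/funext => w; rewrite sha_sum. Qed.

Lemma dop_sum n f I r (F : I -> sha) (c : I -> rat) w :
  dop n f (\sum_(i <- r) c i *: F i) w = \sum_(i <- r) c i * dop n f (F i) w.
Proof.
rewrite /dop (linear_sum (D n f)) (linear_sum (M n f)) -sumrB sha_sum; apply: eq_bigr => i _.
by rewrite !linearZ /= !shaE; ring.
Qed.

(** Transpose of the rule that left multiplication by d_f(g) is the commutator of d_f with left
    multiplication by g. *)
Lemma M_pderiv n m (f g x : sha) : homog n f -> homog m g ->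
  M (n + m) (pderiv f g) x = M m g (dop n f x) - dop n f (M m g x).
Proof.
move=> hf hg; apply/funext => w; rewrite shaD shaN (M_sum m g x) dop_sum.
transitivity (\sum_(b <- allwords m) g b * \sum_(i < m) dterm n f x i b w); last first.
  rewrite {1}/M /pr -sumrB; apply: eq_big_allwords => b hb.
  by rewrite -mulrBr /rstrip dop_cat hb addrC addKr.
under [RHS]eq_bigr do rewrite mulr_sumr.
rewrite [RHS]exchange_big /M /pr.
transitivity (\sum_(u <- allwords (n + m)) \sum_(i < m) g (take i u ++ true :: drop (i + n.+1) u) *
     gcomm (pword [:: true]) f (drop i (take (i + n.+1) u)) * rstrip w x u).
  by apply: eq_big_allwords => u hu; rewrite (pderivE hf hg hu) mulr_suml.
rewrite [LHS]exchange_big; apply: eq_bigr => i _; have hi := ltn_ord i.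
have e1 : (n + m = i + (n.+1 + (m - i.+1)))%N by lia.
have e2 : (m = i + (1 + (m - i.+1)))%N by lia.
have s1 (F : word -> rat) : \sum_(u <- allwords (n + m)) F u = \sum_(p <- allwords i)
    \sum_(s <- allwords (m - i.+1)) \sum_(v <- allwords n.+1) F (p ++ v ++ s).
  rewrite e1 big_allwords_cat; apply: eq_bigr => p _.
  by rewrite big_allwords_cat exchange_big.
have s2 (F : word -> rat) : \sum_(u <- allwords m) F u = \sum_(p <- allwords i)
    \sum_(s <- allwords (m - i.+1)) \sum_(v <- allwords 1) F (p ++ v ++ s).
  rewrite {1}e2 big_allwords_cat; apply: eq_bigr => p _.
  by rewrite big_allwords_cat exchange_big.
rewrite s1 s2; apply: eq_big_allwords => p hp; apply: eq_big_allwords => s hs.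
transitivity (g (p ++ true :: s) * pr n.+1 (gcomm (pword [:: true]) f) (fun v => x (p ++ v ++ s ++ w))).
  rewrite /pr mulr_sumr; apply: eq_big_allwords => v hv.
  rewrite [take (i + _) _]take_cat [drop (i + _) _]drop_cat hp ltnNge leq_addr /= addKn.
  rewrite !take_size_cat // !drop_size_cat //.
  by rewrite /rstrip -!catA mulrA.
rewrite gcomm_x1 // -[allwords 1]/[:: [:: false]; [:: true]] !big_cons big_nil addr0.
rewrite /dterm !nth_cat hp ltnn subnn /= mul0r mulr0 add0r mul1r; congr (_ * _).
have hd : drop i.+1 (p ++ true :: s) = s by rewrite -cat_rcons drop_size_cat ?size_rcons ?hp.
by apply: eq_bigr => c _; rewrite take_size_cat // hd cat_rcons.
Qed.

(** The operators g |-> f g + d_f(g) represent the Ihara bracket by commutators; transposition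
    reverses the order of the factors. *)
Lemma D_ihara n m (f g x : sha) : homog n f -> homog m g ->
  D (n + m) (ihara f g) x = D m g (D n f x) - D n f (D m g x).
Proof.
move=> hf hg; apply: Dop_commutator => {}x /=.
have -> : M (n + m) (ihara f g) x = M (n + m) (pderiv f g) x - M (n + m) (pderiv g f) x
    + (M (n + m) (gconcat f g) x - M (n + m) (gconcat g f) x).
  apply/funext => w; rewrite !shaE /M /pr -!sumrB -big_split.
  by apply: eq_bigr => u _ /=; rewrite /ihara /gcomm; ring.
rewrite M_pderiv // M_gconcat //.
by rewrite {1}[(n + m)%N]addnC M_pderiv // {1}[(n + m)%N]addnC M_gconcat // /dop !linearB /= /D; ring.
Qed.

Lemma pderiv_homog n m (f g : sha) : homog n f -> homog m g -> homog (n + m) (pderiv f g).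
Proof.
move=> hf hg u hu; rewrite /pderiv big1 // => i _; rewrite big1 // => j hij.
have [h|h] := eqVneq (size (take i u ++ true :: drop j u)) m; last by rewrite hg ?mul0r.
have hc : homog (1 + n) (gcomm (pword [:: true]) f).
  have h1 : homog 1 (pword [:: true]) by apply: (@homog_pword [:: true]).
  move=> v hv; rewrite /gcomm (gconcat_homog h1 hf hv) sub0r.
  by rewrite (gconcat_homog hf h1) ?oppr0 // addnC.
rewrite hc ?mulr0 //; apply: contra hu => /eqP; move: h; rewrite size_cat /= !size_drop !size_take.
have := ltn_ord i; have := ltn_ord j.
by case: (ltnP i (size u)); case: (ltnP j (size u)) => *; apply/eqP; lia.
Qed.
Lemma ihara_homog n m (f g : sha) : homog n f -> homog m g -> homog (n + m) (ihara f g).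
Proof.
move=> hf hg u hu; rewrite /ihara /gcomm (pderiv_homog hf hg hu) (gconcat_homog hf hg hu).
by rewrite addnC in hu; rewrite (pderiv_homog hg hf hu) (gconcat_homog hg hf hu) subrr.
Qed.

(** * The stuffle algebra *)

Definition sta : Type := seq nat -> rat^o.
HB.instance Definition _ := GRing.Lmodule.copy sta (seq nat -> rat^o).

Lemma staD (f g : sta) w : (f + g) w = f w + g w. Proof. by []. Qed.
Lemma staN (f : sta) w : (- f) w = - f w. Proof. by []. Qed.
Lemma staZ (c : rat) (f : sta) w : (c *: f) w = c * f w. Proof. by []. Qed.
Lemma sta0 w : (0 : sta) w = 0. Proof. by []. Qed.
Lemma sta_sum I r (P : pred I) (F : I -> sta) w :
  (\sum_(i <- r | P i) F i) w = \sum_(i <- r | P i) F i w.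
Proof. by elim/big_rec2: _ => // i y1 y2 _ <-. Qed.
Definition yd (k : nat) (F : sta) : sta := fun y => F (k :: y).
(** The convention y_0 = 1 turns the coproduct of y_k into the single sum of y_j (x) y_{k-j} over 0
    <= j <= k. *)
Definition Yl (k : nat) (F : sta) : sta := if k is 0 then F else yd k F.
Lemma ydE k (F : sta) y : F (k :: y) = yd k F y. Proof. by []. Qed.
Lemma yd_is_linear k : linear (yd k). Proof. by []. Qed.
HB.instance Definition _ k := GRing.isLinear.Build rat sta sta _ (yd k) (yd_is_linear k).
Lemma Yl_is_linear k : linear (Yl k). Proof. by case: k. Qed.
HB.instance Definition _ k := GRing.isLinear.Build rat sta sta _ (Yl k) (Yl_is_linear k).

Lemma big_dStar (V : nmodType) k y (Phi : seq nat * seq nat -> V) :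
  \sum_(q <- dStar (k :: y)) Phi q =
  \sum_(l <- dLetter k) \sum_(q <- dStar y) Phi (l.1 ++ q.1, l.2 ++ q.2).
Proof. exact: big_allpairs_dep. Qed.

Definition stm (F G : sta) : sta := fun y => \sum_(q <- dStar y) F q.1 * G q.2.
Definition st1 : sta := fun w => (w == [::])%:R.
Lemma stm_nil F G : stm F G [::] = F [::] * G [::].
Proof. exact: big_seq1. Qed.

Lemma stm_cons k F G y : stm F G (k :: y) = stm (yd k F) G y + stm F (yd k G) y
   + \sum_(j <- iota 1 k.-1) stm (yd j F) (yd (k - j) G) y.
Proof. by rewrite /stm big_dStar !big_cons big_map addrA. Qed.

Lemma yd_stm k F G : (0 < k)%N -> yd k (stm F G) = \sum_(j < k.+1) stm (Yl j F) (Yl (k - j) G).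
Proof.
case: k => // k _; apply/funext => y; rewrite sta_sum -[LHS]/(stm F G _) stm_cons.
rewrite big_ord_recl big_ord_recr /= subn0 /bump /= add1n subnn.
have -> : \sum_(j <- iota 1 k) stm (yd j F) (yd (k.+1 - j) G) y =
    \sum_(i < k) stm (Yl (0 + i).+1 F) (Yl (k.+1 - (0 + i).+1) G) y.
  rewrite -[1%N]addn0 iotaDl big_map -{1}[k]subn0 -/(index_iota 0 k) big_mkord.
  apply: eq_bigr => i _; rewrite add1n subSS; have := ltn_ord i.
  by rewrite -subn_gt0; case: (k - i)%N.
by rewrite [X in X + _ = _]addrC -addrA; congr (_ + _); rewrite addrC.
Qed.
(** [dLetter 0] makes the letter 0 primitive; treating it separately gives the ring laws on all
    words, zero letters included. *)
Lemma yd0_stm F G : yd 0 (stm F G) = stm (yd 0 F) G + stm F (yd 0 G).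
Proof. by apply/funext => y; rewrite -[LHS]/(stm F G _) stm_cons big_nil addr0. Qed.
Lemma Yl_stm k F G : Yl k (stm F G) = \sum_(j < k.+1) stm (Yl j F) (Yl (k - j) G).
Proof. by case: k => [|k]; [rewrite big_ord1 | exact: yd_stm]. Qed.

Lemma stmC : commutative stm.
Proof.
move=> F G; apply/funext => y; elim: y F G => [|k y ih] F G; first by rewrite !stm_nil mulrC.
rewrite !ydE; case: k => [|k]; first by rewrite !yd0_stm !staD ih (ih F) addrC.
rewrite !yd_stm // !sta_sum [RHS](reindex_inj rev_ord_inj); apply: eq_bigr => i _.
by rewrite ih /= subSS subKn // -ltnS.
Qed.
Lemma stmDl : left_distributive stm +%R.
Proof.
move=> F G H; apply/funext => y; rewrite staD /stm -big_split.
by apply: eq_bigr => q _; rewrite staD mulrDl.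
Qed.
Lemma stm_scaleAl (c : rat) (F G : sta) : c *: stm F G = stm (c *: F) G.
Proof.
by apply/funext => y; rewrite staZ /stm mulr_sumr; apply: eq_bigr => q _; rewrite staZ mulrA.
Qed.
Lemma stm_suml I r (F : I -> sta) G : stm (\sum_(i <- r) F i) G = \sum_(i <- r) stm (F i) G.
Proof.
apply/funext => y; rewrite sta_sum /stm; under eq_bigr do rewrite sta_sum mulr_suml.
by rewrite exchange_big.
Qed.

Lemma big_triangle (V : nmodType) k (F : nat -> nat -> nat -> V) :
  \sum_(j < k.+1) \sum_(i < j.+1) F i (j - i)%N (k - j)%N =
  \sum_(i < k.+1) \sum_(l < (k - i).+1) F i l (k - i - l)%N.
Proof.
elim: k F => [|k ih] F; first by rewrite !big_ord1.
rewrite big_ord_recr [in RHS]big_ord_recr /= !subnn !big_ord1 subnn.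
under [in RHS]eq_bigr => i _.
  rewrite subSn -1?ltnS // big_ord_recr /= subnn.
  under eq_bigr => l _ do rewrite subSn -1?ltnS //.
  over.
under [in LHS]eq_bigr => j _.
  under eq_bigr => i _ do rewrite subSn -1?ltnS //.
  over.
rewrite big_split /= (ih (fun i l m => F i l m.+1)) -addrA; congr (_ + _).
rewrite [LHS]big_ord_recr /= subnn; congr (_ + _).
by apply: eq_bigr => i _; rewrite subSn -1?ltnS.
Qed.

Lemma stmA : associative stm.
Proof.
move=> F G H; apply/funext => y; elim: y F G H => [|k y ih] F G H.
  by rewrite !stm_nil mulrA.
rewrite !ydE; case: k => [|k].
  by rewrite !yd0_stm stmDl (stmC F (_ + _)) stmDl !(stmC _ F) !staD !ih addrA.
rewrite !yd_stm // !sta_sum.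
have e j : stm (Yl j (stm F G)) (Yl (k.+1 - j) H) y =
    \sum_(i < j.+1) stm (stm (Yl i F) (Yl (j - i) G)) (Yl (k.+1 - j) H) y.
  by rewrite Yl_stm stm_suml sta_sum.
have e' i : stm (Yl i F) (Yl (k.+1 - i) (stm G H)) y =
    \sum_(l < (k.+1 - i).+1) stm (Yl i F) (stm (Yl l G) (Yl (k.+1 - i - l) H)) y.
  by rewrite Yl_stm stmC stm_suml sta_sum; apply: eq_bigr => l _; rewrite stmC.
under [LHS]eq_bigr do rewrite e'. under [RHS]eq_bigr do rewrite e.
rewrite (big_triangle k.+1 (fun i l m => stm (stm (Yl i F) (Yl l G)) (Yl m H) y)).
by apply: eq_bigr => i _; apply: eq_bigr => l _; rewrite ih.
Qed.
Lemma st1m : left_id st1 stm.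
Proof.
move=> F; apply/funext => y; elim: y F => [|k y ih] F; first by rewrite stm_nil mul1r.
have z H : stm (0 : sta) H = 0 by apply/funext => u; rewrite /stm big1 // => q _; rewrite mul0r.
have e j : yd j st1 = 0 by apply/funext.
rewrite stm_cons e z ih add0r big1 ?addr0 // => j _.
by rewrite e z.
Qed.
Lemma st1_neq0 : st1 != 0 :> sta.
Proof. by apply/eqP => /(congr1 (fun f : sta => f [::])) /eqP; rewrite sta0 /st1 eqxx oner_eq0. Qed.
HB.instance Definition _ :=
  GRing.Zmodule_isComNzRing.Build sta stmA stmC st1m stmDl st1_neq0.
HB.instance Definition _ := GRing.Lmodule_isLalgebra.Build rat sta stm_scaleAl.
Lemma stm_scaleAr (c : rat) (f g : sta) : c *: (f * g) = f * (c *: g).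
Proof. by rewrite mulrC scalerAl mulrC. Qed.
HB.instance Definition _ := GRing.Lalgebra_isAlgebra.Build rat sta stm_scaleAr.

Lemma sta_nil (F G : sta) : (F * G) [::] = F [::] * G [::]. Proof. exact: stm_nil. Qed.
Lemma ydM k (F G : sta) : (0 < k)%N -> yd k (F * G) = \sum_(j < k.+1) Yl j F * Yl (k - j) G.
Proof. exact: yd_stm. Qed.
Lemma YlM k (F G : sta) : Yl k (F * G) = \sum_(j < k.+1) Yl j F * Yl (k - j) G.
Proof. exact: Yl_stm. Qed.
Lemma staM (F G : sta) y : (F * G) y = \sum_(q <- dStar y) F q.1 * G q.2. Proof. by []. Qed.

(** * Y-words and their images under iota *)

Definition posw (y : seq nat) := all (fun k => 0 < k)%N y.

Lemma toY_aux_cat j k w : toY_aux j (nseq k false ++ true :: w) = (j + k).+1 :: toY w.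
Proof. by elim: k j => [|k ih] j; rewrite ?addn0 //= ih addSnnS. Qed.
Lemma iotaY_cons k y : iotaY (k.+1 :: y) = nseq k false ++ true :: iotaY y.
Proof. by rewrite /iotaY /= -cats1 -catA. Qed.
Lemma toY_iotaY_cat y w : posw y -> toY (iotaY y ++ w) = y ++ toY w.
Proof.
elim: y => [|[|k] y ih] //= hy; rewrite iotaY_cons -catA cat_cons /toY toY_aux_cat.
by rewrite add0n ih.
Qed.
Lemma iotaYK y : posw y -> toY (iotaY y) = y.
Proof. by move=> hy; rewrite -[iotaY y]cats0 toY_iotaY_cat ?cats0. Qed.
Lemma posw_toY w : posw (toY w).
Proof.
by rewrite /toY; elim: w {1}0%N => [|[] w ih] j //=; rewrite ih.
Qed.
Lemma toY_auxK j w : isYword w -> w != [::] -> iotaY (toY_aux j w) = nseq j false ++ w.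
Proof.
elim: w j => [|a w ih] j //= hw _; case: a hw => hw.
  rewrite iotaY_cons; congr (_ ++ _ :: _); case: (eqVneq w [::]) => [->//|w0].
  by rewrite ih //; move: hw; rewrite /isYword /= (negbTE w0); case: w {ih} w0.
have w0 : w != [::] by case: w hw {ih}.
have e i : nseq i.+1 false ++ w = nseq i false ++ false :: w by elim: i => //= i ->.
rewrite ih //.
by move: hw; rewrite /isYword /= (negbTE w0); case: w {ih e} w0.
Qed.
Lemma toYK w : isYword w -> iotaY (toY w) = w.
Proof. by case: (eqVneq w [::]) => [->//|w0 hw]; rewrite toY_auxK. Qed.
Lemma isYword_iotaY y : isYword (iotaY y).
Proof.
elim: y => [|k y ih] //; rewrite /iotaY /= -/(iotaY y) /isYword last_cat last_rcons.
move: ih; rewrite /isYword; case: (iotaY y) => [|a w] /=; rewrite ?orbT //.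
by rewrite orbC => ->.
Qed.
Lemma size_iotaY y : posw y -> size (iotaY y) = sumn y.
Proof.
by elim: y => [|[|k] y ih] //= hy; rewrite iotaY_cons size_cat size_nseq /= ih //; lia.
Qed.
Lemma sumn_toY w : isYword w -> sumn (toY w) = size w.
Proof. by move=> hw; rewrite -size_iotaY ?posw_toY // toYK. Qed.
Lemma isYword_rcons w a : isYword (rcons w a) = a.
Proof. by rewrite /isYword -size_eq0 size_rcons last_rcons. Qed.
Lemma isYword_cat u w : w != [::] -> isYword (u ++ w) = isYword w.
Proof. by case/lastP: w => // w a _; rewrite -rcons_cat !isYword_rcons. Qed.

Lemma rev_iotaY y : posw y -> rev (iotaY y) ++ [:: true] = true :: iotaY (rev y).
Proof.
elim: y => [|[|k] y ih] // hy; rewrite iotaY_cons rev_cat rev_cons -cats1 ih // rev_nseq.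
by rewrite rev_cons -cats1 /iotaY map_cat flatten_cat /= cats0 -cats1 catA.
Qed.

Lemma dStar_pos y q : posw y -> q \in dStar y ->
  [/\ posw q.1, posw q.2 & (sumn q.1 + sumn q.2 = sumn y)%N].
Proof.
elim: y q => [|k y ih] q; first by rewrite inE => _ /eqP ->.
move=> /andP[k0 hy] /allpairsP[[l r] [/= hl hr ->]] /=; have [h1 h2 h3] := ih r hy hr.
rewrite /posw !all_cat -!/(posw _) h1 h2 !sumn_cat.
move: hl; rewrite !inE => /or3P[/eqP->|/eqP->|/mapP[j hj ->]] /=.
- by rewrite k0 -h3 !addn0 add0n addnA.
- by rewrite k0 -h3 !addn0 add0n addnCA.
move: hj; rewrite mem_iota => /andP[j0 hj]; rewrite j0 !addn0 subn_gt0 addnACA h3.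
have hjk : (j < k)%N by rewrite -(prednK k0) -add1n.
by rewrite hjk subnKC // ltnW.
Qed.

Definition ydelta (a : seq nat) : sta := fun y => (y == a)%:R.
Lemma yd_delta k i a : yd k (ydelta (i :: a)) = (k == i)%:R *: ydelta a.
Proof. by apply/funext => y; rewrite /yd /ydelta staZ eqseq_cons -mulnb natrM. Qed.
Lemma ydelta_nil : ydelta [::] = 1. Proof. by []. Qed.

Lemma ydeltaM_count a b y : (ydelta a * ydelta b) y = (count_mem (a, b) (dStar y))%:R.
Proof.
rewrite staM -sum1_count natr_sum [RHS]big_mkcond; apply: eq_bigr => -[q1 q2] _.
by rewrite /= /ydelta xpair_eqE; case: eqP; case: eqP => _ _; rewrite ?mulr1 ?mulr0 ?mul0r.
Qed.

(** Duality between [dStar] and the recursive stuffle, by comparison of first letters: among the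
    middle terms y_m (x) y_{k-m} only m = i can match, and only when k = i + j. *)
Lemma ydeltaM_stuffle a b y : posw y -> posw a -> posw b ->
  (ydelta a * ydelta b) y = (count_mem y (stuffle a b))%:R.
Proof.
have e (z x : seq nat) : ydelta z x = (count_mem x [:: z])%:R by rewrite /= addn0 eq_sym.
have cm (i k : nat) (x : seq nat) s : (count_mem (k :: x) [seq i :: c | c <- s])%:R =
    (k == i)%:R * (count_mem x s)%:R :> rat.
  rewrite count_map -natrM; congr (_%:R); case: eqP => [->|h] /=.
    by rewrite mul1n; apply: eq_count => c /=; rewrite eqseq_cons eqxx.
  rewrite mul0n -(count_pred0 s); apply: eq_count => c /=; rewrite eqseq_cons.
  by case: eqP => // ik; case: h.
elim: y a b => [|k y ih] a b.
  move=> _ _ _; rewrite sta_nil; case: a => [|i a]; first by rewrite mul1r e.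
  case: b => [|j b]; first by rewrite /= mulr1.
  by rewrite /= mul0r !count_cat !count_map !(eq_count (a2 := pred0)) ?count_pred0.
case: a => [|i a]; first by rewrite ydelta_nil mul1r e.
case: b => [|j b]; first by rewrite ydelta_nil mulr1 e.
move=> /andP[k0 hy] hia hjb; have /andP[i0 ha] := hia; have /andP[j0 hb] := hjb.
transitivity ((k == i)%:R * (ydelta a * ydelta (j :: b)) y +
  ((k == j)%:R * (ydelta (i :: a) * ydelta b) y + (k == (i + j)%N)%:R * (ydelta a * ydelta b) y)); last first.
  by rewrite !ih // -!cm -!natrD -!count_cat.
rewrite -[LHS]/(stm (ydelta (i :: a)) (ydelta (j :: b)) (k :: y)) stm_cons !yd_delta.
rewrite -!/(_ * _ : sta) -!stm_scaleAl -![stm _ (_ *: _)]stm_scaleAr !staZ -addrA; congr (_ + (_ + _)).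
rewrite (eq_bigr (fun m => (ydelta a * ydelta b) y * ((m == i)%:R * ((k - m)%N == j)%:R))) => [|m _].
  rewrite -mulr_sumr mulrC; congr (_ * _); have [hk|hk] := eqVneq k (i + j)%N.
    have hi : i \in iota 1 k.-1 by rewrite mem_iota; lia.
    rewrite (bigD1_seq i) ?iota_uniq //= eqxx mul1r big1 ?addr0 => [|m /negbTE->]; last by rewrite mul0r.
    by rewrite hk addKn eqxx.
  rewrite big_seq big1 // => m; rewrite mem_iota => hm.
  case: eqP => h1; rewrite ?mul0r // mul1r; case: eqP => h2 //.
  by case/eqP: hk; rewrite -h1 -h2; lia.
by rewrite !yd_delta -stm_scaleAl -[stm _ (_ *: _)]stm_scaleAr !staZ mulrA mulrC.
Qed.

Lemma dStar_delta w (Phi : seq nat -> seq nat -> rat) : isYword w ->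
  \sum_(q <- dStar (toY w)) Phi q.1 q.2 =
  \sum_(i < (size w).+1) \sum_(a <- allwords i) \sum_(b <- allwords (size w - i))
    (isYword a && isYword b)%:R * (count_mem (toY a, toY b) (dStar (toY w)))%:R * Phi (toY a) (toY b).
Proof.
move=> hw.
transitivity (\sum_(q <- dStar (toY w)) \sum_(i < (size w).+1) \sum_(a <- allwords i)
    \sum_(b <- allwords (size w - i))
    Phi (toY a) (toY b) * ((iotaY q.1 == a)%:R * (iotaY q.2 == b)%:R)).
  rewrite big_seq [RHS]big_seq; apply: eq_bigr => q /(dStar_pos (posw_toY w))[h1 h2 h3].
  rewrite (big_allwords_delta2 (fun a b => Phi (toY a) (toY b))) ?iotaYK //.
  by rewrite !size_iotaY // h3 sumn_toY.
rewrite exchange_big; apply: eq_bigr => i _; rewrite exchange_big; apply: eq_bigr => a _.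
rewrite exchange_big; apply: eq_bigr => b _; rewrite -mulr_sumr mulrC; congr (_ * _).
rewrite -sum1_count natr_sum [in RHS]big_mkcond mulr_sumr big_seq [RHS]big_seq.
apply: eq_bigr => -[q1 q2] /(dStar_pos (posw_toY w))[/= h1 h2 _].
have e q c : posw q -> (iotaY q == c) = isYword c && (q == toY c).
  move=> hq; apply/eqP/andP => [<-|[hc /eqP->]]; last exact: toYK.
  by rewrite isYword_iotaY iotaYK.
by rewrite !e // xpair_eqE; case: isYword; case: isYword; case: eqP; case: eqP => _ _ //=;
  rewrite ?mul0r ?mulr0 ?mulr1.
Qed.

Definition UY (u : sha) : sta := fun y => u (iotaY y).

Lemma stuffle_pos a b c : posw a -> posw b -> c \in stuffle a b -> posw c.
Proof.
elim: a b c => [|i a iha] b c ha hb; first by rewrite inE => /eqP ->.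
elim: b c hb => [|j b ihb] c hb; first by rewrite inE => /eqP ->.
move: ha hb => ha0 hb0; have /andP[i0 ha] := ha0; have /andP[j0 hb] := hb0.
rewrite [stuffle _ _]/= !mem_cat => /or3P[]/mapP[d hd ->] /=.
- by rewrite i0; apply: iha hd.
- by rewrite j0; apply: ihb hd.
- by rewrite addn_gt0 i0; apply: iha hd.
Qed.

Lemma pstuffleE (u v : sha) w : pstuffle u v w = if isYword w then (UY u * UY v) (toY w) else 0.
Proof.
rewrite /pstuffle /stcoef; case: ifP => hw; last first.
  rewrite big1 // => i _; rewrite big1 // => a _; rewrite big1 // => b _.
  case: ifP => h; rewrite ?mulr0 // (count_memPn _) ?mulr0 //.
  by apply/negP => /mapP[c _ e]; rewrite e isYword_iotaY in hw.
rewrite staM (dStar_delta (fun p q => UY u p * UY v q) hw).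
apply: eq_bigr => i _; apply: eq_bigr => a _; apply: eq_bigr => b _.
case: ifP => h; last by rewrite mulr0 !mul0r.
have /andP[ha hb] := h; rewrite /UY !toYK // mul1r [RHS]mulrC; congr (_ * _).
rewrite -ydeltaM_count ydeltaM_stuffle ?posw_toY //; congr (_%:R).
rewrite count_map; apply: eq_in_count => c hc /=.
have pc : posw c := stuffle_pos (posw_toY a) (posw_toY b) hc.
by apply/eqP/eqP => [<-|->]; rewrite ?iotaYK ?toYK.
Qed.

(** * Pairings and primitivity on Y-words *)

Definition prY n (p F : sta) : rat := \sum_(w <- allwords n | isYword w) p (toY w) * F (toY w).
Definition rstripY (y : seq nat) (F : sta) : sta := fun z => F (z ++ y).
Definition MY n (p F : sta) : sta := fun y => prY n p (rstripY y F).

Lemma prY_is_linear n p : linear_for *%R (prY n p).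
Proof.
move=> c f g; rewrite /prY [c * _]big_distrr -big_split; apply: eq_bigr => w _ /=.
by rewrite staD staZ; ring.
Qed.
HB.instance Definition _ n p :=
  GRing.isLinear.Build rat sta rat _ (prY n p) (prY_is_linear n p).
Lemma MY_is_linear n p : linear (MY n p).
Proof. by move=> c f g; apply/funext => v; rewrite /MY staD staZ -linearP. Qed.
HB.instance Definition _ n p := GRing.isLinear.Build rat sta sta _ (MY n p) (MY_is_linear n p).

Lemma rstripY_nil F : rstripY [::] F = F.
Proof. by apply/funext => z; rewrite /rstripY cats0. Qed.
Lemma MY_nil n p F : MY n p F [::] = prY n p F.
Proof. by rewrite /MY rstripY_nil. Qed.

Lemma big_dStar_cat (V : nmodType) z y (Phi : seq nat -> seq nat -> V) :
  \sum_(q <- dStar (z ++ y)) Phi q.1 q.2 =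
  \sum_(q <- dStar y) \sum_(r <- dStar z) Phi (r.1 ++ q.1) (r.2 ++ q.2).
Proof.
elim: z Phi => [|k z ih] Phi; first by apply: eq_bigr => q _; rewrite big_seq1.
rewrite cat_cons (big_dStar k (z ++ y) (fun q => Phi q.1 q.2)) /=.
under eq_bigr => l _ do rewrite (ih (fun a b => Phi (l.1 ++ a) (l.2 ++ b))).
rewrite exchange_big; apply: eq_bigr => q _.
rewrite (big_dStar k z (fun r => Phi (r.1 ++ q.1) (r.2 ++ q.2))) /=.
by apply: eq_bigr => l _; apply: eq_bigr => r _; rewrite !catA.
Qed.

Lemma rstripYM y (F G : sta) : rstripY y (F * G) =
  \sum_(q <- dStar y) rstripY q.1 F * rstripY q.2 G.
Proof.
apply/funext => z; rewrite sta_sum /rstripY staM.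
exact: (big_dStar_cat z y (fun a b => F a * G b)).
Qed.

Definition primY n (p : sta) :=
  forall F G : sta, prY n p (F * G) = prY n p F * G [::] + F [::] * prY n p G.

Lemma MY_deriv n p : primY n p -> derivation (MY n p).
Proof.
move=> h F G; apply/funext => y; rewrite staD /MY rstripYM linear_sum !staM -big_split /=.
by apply: eq_bigr => q _; rewrite h.
Qed.

Lemma toY_eq_nil a : isYword a -> (toY a == [::]) = (a == [::]).
Proof.
move=> ha; apply/eqP/eqP => [h|->//]; apply/nilP.
by rewrite /nilp -(sumn_toY ha) h.
Qed.

Lemma st_primitive_primY n phi : st_primitive phi -> (0 < n)%N -> primY n phi.
Proof.
move=> h n0 F G; transitivity (\sum_(i < n.+1) \sum_(a <- allwords i) \sum_(b <- allwords (n - i))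
    (isYword a && isYword b)%:R * deltaStar phi (toY a) (toY b) * (F (toY a) * G (toY b))).
  transitivity (\sum_(w <- allwords n | isYword w) \sum_(i < n.+1) \sum_(a <- allwords i)
      \sum_(b <- allwords (n - i)) phi (toY w) * ((isYword a && isYword b)%:R *
      (count_mem (toY a, toY b) (dStar (toY w)))%:R * (F (toY a) * G (toY b)))).
    rewrite /prY big_seq_cond [RHS]big_seq_cond; apply: eq_bigr => w /andP[].
    rewrite mem_allwords => /eqP sw hw.
    rewrite staM (dStar_delta (fun a b => F a * G b) hw) sw mulr_sumr; apply: eq_bigr => i _.
    by rewrite mulr_sumr; apply: eq_bigr => a _; rewrite mulr_sumr.
  rewrite exchange_big; apply: eq_bigr => i _.
  rewrite exchange_big; apply: eq_big_allwords => a ha.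
  rewrite exchange_big; apply: eq_big_allwords => b hb.
  case: andP => [[ya yb]|_]; last by rewrite !mul0r big1 // => *; rewrite !mul0r mulr0.
  rewrite mul1r /deltaStar !sumn_toY // ha hb subnKC -1?ltnS // mulr_suml big_mkcond.
  by apply: eq_bigr => w _; case: isYword => /=; rewrite ?mul0r //; ring.
have e a b : (isYword a && isYword b)%:R * deltaStar phi (toY a) (toY b) * (F (toY a) * G (toY b)) =
    (b == [::])%:R * (if isYword a then phi (toY a) * F (toY a) else 0) * G [::] +
    (a == [::])%:R * F [::] * (if isYword b then phi (toY b) * G (toY b) else 0).
  rewrite (h _ _ (posw_toY a) (posw_toY b)); case ya: (isYword a); case yb: (isYword b) => /=.
  - by rewrite !toY_eq_nil //; case: eqP => [->|_]; case: eqP => [->|_] /=; ring.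
  - by have -> : b == [::] = false by [apply/eqP => e; rewrite e in yb]; rewrite !mul0r mulr0 addr0.
  - by have -> : a == [::] = false by [apply/eqP => e; rewrite e in ya]; rewrite !mul0r mulr0 mul0r addr0.
  - by rewrite !mulr0 !mul0r addr0.
under eq_bigr do under eq_bigr do under eq_bigr do rewrite e.
under eq_bigr do under eq_bigr do rewrite big_split /=.
under eq_bigr do rewrite big_split /=.
rewrite big_split /=; congr (_ + _).
  rewrite big_ord_recr big1 /= ?add0r => [|i _].
    rewrite subnn /prY mulr_suml [RHS]big_mkcond; apply: eq_bigr => a _; rewrite big_seq1 mul1r.
    by case: ifP; rewrite ?mul0r.
  apply: big1 => b _; rewrite big_seq; apply: big1 => c; rewrite mem_allwords => hc.
  have i_n := ltn_ord i; suff /negbTE -> : c != [::] by rewrite !mul0r.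
  by apply/eqP => hc0; rewrite hc0 /= eq_sym subn_eq0 leqNgt i_n in hc.
rewrite big_ord_recl [X in _ + X]big1 ?addr0 => [|i _].
  rewrite /= big_seq1 subn0 /prY mulr_sumr [RHS]big_mkcond; apply: eq_bigr => c _; rewrite mul1r.
  by case: ifP; rewrite ?mulr0.
rewrite big_seq; apply: big1 => b; rewrite mem_allwords => hb; apply: big1 => c _.
suff /negbTE -> : b != [::] by rewrite !mul0r.
by apply/eqP => hb0; rewrite hb0 /= in hb.
Qed.

(** In the coproduct of one letter each factor has length at most one, so reversing a word just
    reverses both factors of its coproduct. *)
Lemma big_dStar_rev (V : nmodType) y (Phi : seq nat -> seq nat -> V) :
  \sum_(q <- dStar (rev y)) Phi q.1 q.2 = \sum_(q <- dStar y) Phi (rev q.1) (rev q.2).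
Proof.
elim: y Phi => [|k y ih] Phi; first by rewrite !big_seq1.
rewrite rev_cons -cats1 big_dStar_cat (big_dStar k [::] (fun q => \sum_(r <- dStar (rev y)) _)) /=.
rewrite (big_dStar k y (fun q => Phi (rev q.1) (rev q.2))) /=.
rewrite big_seq [RHS]big_seq; apply: eq_bigr => l hl.
rewrite big_seq1 /= !cats0 (ih (fun a b => Phi (a ++ l.1) (b ++ l.2))); apply: eq_bigr => q _.
have /andP[h1 h2] : (size l.1 <= 1)%N && (size l.2 <= 1)%N.
  by move: hl; rewrite !inE => /or3P[/eqP->|/eqP->|/mapP[j _ ->]].
by rewrite !rev_cat; congr (Phi (_ ++ _) (_ ++ _));
  [case: l.1 h1 => [|? []] | case: l.2 h2 => [|? []]].
Qed.

Definition revY (F : sta) : sta := fun y => F (rev y).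
Lemma revYM (F G : sta) : revY (F * G) = revY F * revY G.
Proof. by apply/funext => y; rewrite /revY staM (big_dStar_rev y (fun a b => F a * G b)). Qed.

Definition Yw n := [seq toY w | w <- allwords n & isYword w].
Lemma prYE n p F : prY n p F = \sum_(y <- Yw n) p y * F y.
Proof. by rewrite /Yw big_map big_filter. Qed.
Lemma mem_Yw n y : (y \in Yw n) = posw y && (sumn y == n).
Proof.
apply/mapP/andP => [[w]|[hy /eqP hn]].
  by rewrite mem_filter mem_allwords => /andP[hw /eqP hn] ->; rewrite posw_toY sumn_toY ?hn.
by exists (iotaY y); rewrite ?iotaYK // mem_filter isYword_iotaY mem_allwords size_iotaY ?hn ?eqxx.
Qed.
Lemma uniq_Yw n : uniq (Yw n).
Proof.
rewrite map_inj_in_uniq => [|u v]; first exact/filter_uniq/uniq_allwords.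
by rewrite !mem_filter => /andP[hu _] /andP[hv _] e; rewrite -(toYK hu) e toYK.
Qed.
Lemma posw_rev y : posw (rev y) = posw y. Proof. exact: all_rev. Qed.
Lemma perm_rev_Yw n : perm_eq (map rev (Yw n)) (Yw n).
Proof.
have rinj : injective (@rev nat) := can_inj revK.
apply: uniq_perm; [by rewrite map_inj_uniq ?uniq_Yw | exact: uniq_Yw |].
move=> y; rewrite -{1}(revK y) mem_map //.
by rewrite !mem_Yw posw_rev sumn_rev.
Qed.
Lemma prY_rev n p F : prY n (revY p) F = prY n p (revY F).
Proof.
rewrite !prYE; transitivity (\sum_(y <- map rev (Yw n)) p y * revY F y); last exact/perm_big/perm_rev_Yw.
by rewrite [RHS]big_map; apply: eq_bigr => y _; rewrite /revY revK.
Qed.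
Lemma primY_rev n p : primY n p -> primY n (revY p).
Proof. by move=> h F G; rewrite !prY_rev revYM h. Qed.

(** * Right derivatives and shuffling with x0 *)

Definition rder a : sha -> sha := rstrip [:: a].
Lemma rder_is_linear a : linear (rder a). Proof. by []. Qed.
HB.instance Definition _ a := GRing.isLinear.Build rat sha sha _ (rder a) (rder_is_linear a).
Lemma rderE a (f : sha) w : f (rcons w a) = rder a f w.
Proof. by rewrite /rder /rstrip cats1. Qed.
Lemma rderP (f g : sha) : f [::] = g [::] -> (forall a, rder a f = rder a g) -> f = g.
Proof. by move=> h0 h; apply/funext; case/lastP => // w a; rewrite !rderE h. Qed.
Lemma rderM a (f g : sha) : rder a (f * g) = rder a f * g + f * rder a g.
Proof.
rewrite /rder rstripM [size _]/= big_allmasksS !big_seq1 /= addrC.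
by congr (_ * _ + _ * _); apply/funext => w; rewrite /rstrip cats0.
Qed.

Definition x0 : sha := pword [:: false].
Lemma rder_x0 a : rder a x0 = (~~ a)%:R *: 1.
Proof. by apply/funext; case: a => -[|[] [|c w]]. Qed.
Lemma lder_x0 a : lder a x0 = (~~ a)%:R *: 1.
Proof. by rewrite /x0 lder_pword; case: a. Qed.

(** The concatenation f x0. *)
Definition sz (f : sha) : sha := fun w =>
  if w is a :: w' then if last a w' then 0 else f (belast a w') else 0.
Lemma rder_sz a f : rder a (sz f) = (~~ a)%:R *: f.
Proof.
apply/funext => w; rewrite shaZ -rderE -cats1.
have -> : sz f (w ++ [:: a]) = if a then 0 else f w; last by case: a; rewrite /= ?mul0r ?mul1r.
case: w => [|b w] //=.
by rewrite last_cat belast_cat /= cats1 -lastI.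
Qed.
(** The letter x0 is shuffled into f or inserted behind one of the k trailing letters, and these k
    positions give the same word. *)
Lemma x0_sz k f : x0 * iter k sz f = iter k sz (x0 * f) + k%:R *: iter k.+1 sz f.
Proof.
elim: k => [|k ih]; first by rewrite scale0r addr0.
apply: rderP => [|a]; first by rewrite sha_nil -[x0 [::]]/(0 : rat) mul0r shaD shaZ -![iter _ sz _ [::]]/(0 : rat) mulr0 addr0.
rewrite rderM linearD linearZ /= rder_x0 !rder_sz; case: a => /=.
  by rewrite !scale0r mul0r mulr0 scaler0.
by rewrite !scale1r mul1r ih /= addrCA -[in RHS]natr1 scalerDl scale1r [X in _ = _ + X]addrC.
Qed.

Lemma big_allwords_rcons (V : nmodType) n (F : word -> V) :
  \sum_(w <- allwords n.+1) F w =
  \sum_(w <- allwords n) F (rcons w false) + \sum_(w <- allwords n) F (rcons w true).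
Proof.
rewrite -addn1 big_allwords_cat -big_split; apply: eq_bigr => w _ /=.
by rewrite !big_cons big_nil addr0 !cats1.
Qed.
Lemma pr_sz n q f : pr n.+1 q (sz f) = pr n (rder false q) f.
Proof.
rewrite /pr big_allwords_rcons [X in _ + X]big1 ?addr0 => [|w _]; last first.
  by rewrite [sz f _]rderE rder_sz scale0r mulr0.
by apply: eq_bigr => w _; rewrite [sz f _]rderE rder_sz scale1r rderE.
Qed.
Lemma iter_rder k q w : iter k (rder false) q w = q (w ++ nseq k false).
Proof.
elim: k w => [|k ih] w; first by rewrite cats0.
by rewrite iterS -rderE ih cat_rcons.
Qed.
Lemma pr_iter_sz k n q f : pr (k + n) q (iter k sz f) = pr n (iter k (rder false) q) f.
Proof. by elim: k q => [|k ih] q //; rewrite iterS addSn pr_sz ih iterSr. Qed.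

Definition XY (F : sta) : sha := fun w => if isYword w then F (toY w) else 0.
Lemma pr_XY n q F : pr n q (XY F) = prY n (UY q) F.
Proof.
rewrite /pr /prY [RHS]big_mkcond; apply: eq_bigr => w _; rewrite /XY; case: ifP => hw.
  by rewrite /UY toYK.
by rewrite mulr0.
Qed.
Lemma rder_XY F : rder false (XY F) = 0.
Proof. by apply/funext => w; rewrite -rderE /XY isYword_rcons. Qed.

(* [Th] is the Y-word form of multiplication by x0, transposed to coefficient functions
   (see [x0_XY]). *)
Fixpoint Thw (y : seq nat) (F : sta) : rat :=
  if y is k :: y' then Thw y' (yd k F) + k.-1%:R * Yl k.-1 F y' else 0.
Definition Th (F : sta) : sta := fun y => Thw y F.
Lemma yd_Th k F : yd k (Th F) = Th (yd k F) + k.-1%:R *: Yl k.-1 F.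
Proof. by []. Qed.
Lemma Thw_is_linear y : linear_for *%R (Thw y).
Proof.
move=> c f g; elim: y f g => [|k y ih] f g; first by rewrite mulr0 addr0.
by rewrite /= [yd _ _]linearP ih [Yl _ _]linearP /= staD staZ; ring.
Qed.
Lemma Th_is_linear : linear Th.
Proof. by move=> c f g; apply/funext => y; rewrite /Th Thw_is_linear. Qed.
HB.instance Definition _ := GRing.isLinear.Build rat sta sta _ Th Th_is_linear.

Lemma x0_strip j f w : (x0 * f) (nseq j false ++ true :: w) =
  (x0 * ((fun v => f (nseq j false ++ true :: v)) : sha)) w + j%:R * f (nseq j.-1 false ++ true :: w).
Proof.
elim: j f => [|j ih] f.
  by rewrite /= mul0r addr0 lderE lderM lder_x0 scale0r mul0r add0r.
rewrite /= lderE lderM lder_x0 scale1r mul1r shaD ih addrCA; congr (_ + _).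
by case: j {ih} => [|j]; rewrite ?mul0r ?mul1r ?addr0 //
  -[lder false f _]/(f (nseq j.+1 false ++ true :: w)) -[j.+2%:R]natr1 mulrDl mul1r addrC.
Qed.
Lemma x0_XY F y : posw y -> (x0 * XY F) (iotaY y) = Th F y.
Proof.
elim: y F => [|[|k] y ih] F // hy; first by rewrite sha_nil -[x0 [::]]/(0 : rat) mul0r.
rewrite iotaY_cons x0_strip ydE yd_Th staD staZ -ih //; congr (_ + _).
  apply: (congr1 (fun h : sha => (x0 * h) (iotaY y))); apply/funext => v; rewrite /XY /yd.
  rewrite isYword_cat // /toY toY_aux_cat add0n /isYword /=.
  by case: v.
case: k hy => [|k] hy; first by rewrite !mul0r.
by rewrite -[k.+1.-1]/k -iotaY_cons /XY isYword_iotaY iotaYK.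
Qed.

Lemma Yl_Th j F : Yl j (Th F) = Th (Yl j F) + j.-1%:R *: Yl j.-1 F.
Proof. by case: j => [|j]; rewrite ?scale0r ?addr0 // /Yl yd_Th. Qed.

(** On the right-hand side the splitting (i, k - i) arises by lowering either of two indices by one,
    with weights i and k - i; their sum is the weight k on the left. *)
Lemma Th_deriv F G y : posw y -> Th (F * G) y = (Th F * G + F * Th G) y.
Proof.
elim: y F G => [|[|k] y ih] F G // hy; first by rewrite staD !sta_nil mul0r mulr0 addr0.
rewrite !ydE yd_Th linearD /= !ydM // linear_sum /= !staD staZ YlM !sta_sum -big_split /=.
under [in RHS]eq_bigr do rewrite !Yl_Th mulrDl mulrDr -scalerAl -scalerAr !staD !staZ.
under [in LHS]eq_bigr do rewrite ih // staD.
rewrite [in LHS]big_split [in RHS]big_split [X in _ = X + _]big_split [X in _ = _ + X]big_split /=.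
rewrite addrACA; congr (_ + _).
rewrite [X in _ = X + _]big_ord_recl [X in _ = _ + X]big_ord_recr /= subnn !mul0r add0r addr0.
rewrite mulr_sumr -big_split; apply: eq_bigr => i _ /=.
have hi : (i <= k)%N by rewrite -ltnS.
by rewrite /bump /= add0n add1n subSS subSn //= -mulrDl -natrD subnKC.
Qed.

Lemma Th_ones m F : Th F (nseq m 1%N) = 0.
Proof. by elim: m F => [|m ih] F //; rewrite ydE yd_Th staD ih add0r scale0r. Qed.
Lemma Th_nil F : Th F [::] = 0. Proof. by []. Qed.

(** * Double shuffle elements act by stuffle derivations *)

(** Every word is uniquely x0^i appended to a word that is empty or ends in x1. *)
Lemma big_allwords_tail (V : nmodType) n (G : word -> V) :
  \sum_(a <- allwords n) G a =
  \sum_(i < n.+1) \sum_(w <- allwords (n - i) | isYword w) G (w ++ nseq i false).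
Proof.
elim: n G => [|n ih] G; first by rewrite big_ord1 /= !big_cons !big_nil.
rewrite big_allwords_rcons big_ord_recl addrC subn0; congr (_ + _).
  rewrite [RHS]big_mkcond [RHS]big_allwords_rcons [X in _ = X + _]big1 ?add0r => [|w _]; last by rewrite isYword_rcons.
  by apply: eq_bigr => w _; rewrite isYword_rcons cats0.
rewrite (ih (fun w => G (rcons w false))); apply: eq_bigr => i _.
rewrite lift0 subSS; apply: eq_bigr => w _; congr G.
by rewrite -cats1 -catA cats1; congr (_ ++ _); elim: (nat_of_ord i) => //= j ->.
Qed.

Lemma prY_eqr n p F F' : (forall z, posw z -> sumn z = n -> F z = F' z) -> prY n p F = prY n p F'.
Proof.
move=> h; rewrite !prYE; apply: eq_big_seq => z; rewrite mem_Yw => /andP[h1 /eqP h2].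
by rewrite h.
Qed.

Section Racinet.
Variables (n : nat) (psi : sha).
Hypotheses (hp : prim n psi) (n1 : (1 < n)%N) (hodd : odd n) (hst : primY n (psiStar psi)).

(* [pE k] collects the coefficients of psi on words ending in exactly x1 x0^k; vanishing of psi
   on products with x0 makes [pE k.+1] a multiple of [pE k] precomposed with [Th]. *)
Definition pE k : sta := UY (iter k (rder false) psi).
(** Tail 0 is taken from [psiStar psi] instead of [psi], since this is the form assumed
    primitive. *)
Definition pc k : sta := if k is 0 then (psiStar psi : sta) else pE k.
Definition cst : rat := (-1) ^+ n.-1 / n%:R * psi (iotaY [:: n]).
Definition ones := nseq n 1%N.

Lemma posw_ones m : posw (nseq m 1%N). Proof. by elim: m. Qed.
Lemma sumn_ones m : sumn (nseq m 1%N) = m. Proof. by elim: m => //= m ->. Qed.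

Lemma pE_step k F : (k < n)%N ->
  k.+1%:R * prY (n - k.+1) (pE k.+1) F = - prY (n - k) (pE k) (Th F).
Proof.
move=> kn; have : pr n psi (x0 * iter k sz (XY F)) = 0.
  rewrite hp -[x0 [::]]/(0 : rat) mul0r addr0 pr_pword; case: eqP => [e|_]; last by rewrite mul0r.
  by move: n1; rewrite -e.
rewrite x0_sz linearD linearZ /=.
have e1 : n = (k + (n - k))%N by lia.
have e2 : n = (k.+1 + (n - k.+1))%N by lia.
rewrite -[sz (iter k sz _)]/(iter k.+1 sz (XY F)) {1}e1 {2}e2 !pr_iter_sz pr_XY -/(pE k.+1).
have -> : (n - k = (n - k.+1).+1)%N by lia.
move: (n - k.+1)%N => m; rewrite /pr big_allwords_rcons.
have -> : \sum_(w <- allwords m) iter k (rder false) psi (rcons w false) * (x0 * XY F) (rcons w false) =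
    prY m (pE k.+1) F.
  rewrite -pr_XY /pr; apply: eq_bigr => w _; rewrite [(x0 * _) _]rderE rderM rder_x0 rder_XY.
  by rewrite scale1r mul1r mulr0 addr0 rderE.
have -> : \sum_(w <- allwords m) iter k (rder false) psi (rcons w true) * (x0 * XY F) (rcons w true) =
    prY m.+1 (pE k) (Th F).
  rewrite /prY [RHS]big_mkcond big_allwords_rcons [X in _ = X + _]big1 ?add0r => [|w _]; last first.
    by rewrite isYword_rcons.
  apply: eq_bigr => w _; rewrite isYword_rcons -x0_XY ?posw_toY // /pE /UY toYK //.
  by rewrite isYword_rcons.
by rewrite addrAC => /eqP; rewrite addr_eq0 => /eqP <-; rewrite -[in LHS]natr1; ring.
Qed.

Lemma psiStarE y : sumn y = n -> psiStar psi y = pE 0 y + cst * (y == ones)%:R.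
Proof.
move=> hy; rewrite /psiStar /pE /UY /=; congr (_ + _); rewrite /ones.
case: ifP => [/andP[h1 /eqP h2]|/negbT].
  have e : size y = n by rewrite -hy {2}h2 sumn_ones.
  by have -> : y == nseq n 1%N by [rewrite -e -h2]; rewrite e mulr1 /cst.
case: (y =P nseq n 1%N) => [->|_]; last by rewrite mulr0.
by rewrite size_nseq n1 eqxx.
Qed.

(** [psi] and [psiStar psi] differ only at y_1^n, where [Th] vanishes. *)
Lemma prY_pc k F : prY (n - k) (pc k) (Th F) = prY (n - k) (pE k) (Th F).
Proof.
case: k => // ; rewrite subn0 !prYE; apply: eq_big_seq => z; rewrite mem_Yw => /andP[_ /eqP hz].
rewrite /pc psiStarE //; case: eqP => [->|_]; last by rewrite mulr0 addr0.
by rewrite Th_ones !mulr0.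
Qed.

(** Each tail is, up to a nonzero factor, the preceding one composed with the stuffle derivation
    [Th]; primitivity thus passes from [psiStar psi] to all tails. *)
Lemma primY_pc k : (k <= n)%N -> primY (n - k) (pc k).
Proof.
elim: k => [|k ih] kn; first by rewrite subn0.
move=> F G; have {}ih := ih (ltnW kn).
have e H : prY (n - k.+1) (pc k.+1) H = - (k.+1%:R^-1 * prY (n - k) (pc k) (Th H)).
  by rewrite prY_pc -mulrN -pE_step // mulKf // pnatr_eq0.
rewrite !e (prY_eqr (pc k) (F' := Th F * G + F * Th G)); last by move=> z hz _; apply: Th_deriv.
by rewrite linearD /= !ih !Th_nil !(mulr0, mul0r, addr0, add0r); ring.
Qed.

Definition P i := MY (n - i) (pc i).
Definition P' i := MY (n - i) (- revY (pc i)).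
HB.instance Definition _ i := GRing.Linear.on (P i).
HB.instance Definition _ i := GRing.Linear.on (P' i).

Lemma primYN m p : primY m p -> primY m (- p).
Proof.
move=> h F G; have e H : prY m (- p) H = - prY m p H.
  by rewrite /prY -sumrN; apply: eq_bigr => w _; rewrite staN mulNr.
by rewrite !e h; ring.
Qed.
Lemma P_deriv i : (i <= n)%N -> derivation (P i).
Proof. by move=> hi; apply/MY_deriv/primY_pc. Qed.
Lemma P'_deriv i : (i <= n)%N -> derivation (P' i).
Proof. by move=> hi; apply/MY_deriv/primYN/primY_rev/primY_pc. Qed.

(* [Q k 0] is the defect of [D] in the first Y-letter. The products in [QM] also involve [Q k b]
   with [0 < b], which reduce to [Q 1 c] with [0 < c]; those vanish because [Q 1 0] does. *)
Definition T i m (F : sta) : sta := Yl m (P i F) + P' i (Yl m F).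
Definition Q k b (F : sta) : sta := \sum_(i < n.+1) if (b <= k + i)%N then T i (k + i - b) F else 0.

(** Both summands of [T] combine a derivation with the coproduct of y_m; the terms are collected by
    the index b falling on the undifferentiated factor. *)
Lemma TM i m F G : (i <= n)%N ->
  T i m (F * G) = \sum_(b < m.+1) (T i (m - b) F * Yl b G + Yl b F * T i (m - b) G).
Proof.
move=> hi; rewrite /T P_deriv // !linearD /= !YlM linear_sum /=.
under [X in _ + X]eq_bigr do rewrite P'_deriv //.
rewrite big_split [RHS]big_split /= [X in _ = X + _](reindex_inj rev_ord_inj) /=.
have -> : \sum_(j < m.+1) T i (m - (m.+1 - j.+1)) F * Yl (m.+1 - j.+1) G =
  \sum_(j < m.+1) T i j F * Yl (m - j) G.
  by apply: eq_bigr => j _; rewrite subSS subKn // -ltnS.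
rewrite /T; under [X in _ = X + _]eq_bigr do rewrite mulrDl.
under [X in _ = _ + X]eq_bigr do rewrite mulrDr.
by rewrite !big_split /= addrACA.
Qed.

Lemma QM k F G : Q k 0 (F * G) =
  \sum_(b < (k + n).+1) (Q k b F * Yl b G + Yl b F * Q k b G).
Proof.
rewrite {1}/Q; transitivity (\sum_(i < n.+1) \sum_(b < (k + n).+1)
   if (b <= k + i)%N then T i (k + i - b) F * Yl b G + Yl b F * T i (k + i - b) G else 0).
  apply: eq_bigr => i _; rewrite /= subn0 TM -1?ltnS //.
  rewrite (big_ord_widen (k + n).+1 (fun b => T i (k + i - b) F * Yl b G + Yl b F * T i (k + i - b) G)).
    by rewrite big_mkcond.
  by rewrite ltnS leq_add2l -ltnS.
rewrite exchange_big; apply: eq_bigr => b _ /=; rewrite /Q mulr_suml mulr_sumr -big_split.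
by apply: eq_bigr => i _ /=; case: ifP => _; rewrite ?mul0r ?mulr0 ?addr0.
Qed.

(** Defect of [D] at a first letter y_k, as in [D_letter]: psi is paired with a factor in front of
    x0^{k-1} x1, or between x0^{k-1} and x1. *)
Definition R k (F : sta) : sta := fun y => \sum_(a <- allwords n)
  psi a * (F (toY (a ++ rcons (nseq k.-1 false) true) ++ y) -
           F (toY (nseq k.-1 false ++ rcons a true) ++ y)).
(** The corresponding defect of [Dt]; the extra term measures how F |-> F(y_1^n ++ .) fails to
    commute with stripping y_k. *)
Definition dlt k (F : sta) : sta := fun y =>
  R k F y + cst * (F (ones ++ k :: y) - F (k :: ones ++ y)).

Lemma MY_pc0 F y : MY n (pc 0) F y = MY n (pE 0) F y + cst * F (ones ++ y).
Proof.
rewrite /MY !prYE (eq_big_seq (fun z => pE 0 z * F (z ++ y) + cst * F (z ++ y) * (z == ones)%:R)).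
  rewrite big_split; congr (_ + _); rewrite (bigD1_seq ones) ?uniq_Yw //=.
    by rewrite eqxx mulr1 big1 ?addr0 // => z /negbTE ->; rewrite mulr0.
  by rewrite mem_Yw posw_ones sumn_ones eqxx.
move=> z; rewrite mem_Yw => /andP[_ /eqP hz]; rewrite /pc psiStarE // /rstripY; ring.
Qed.
Lemma MY_revpc0 F y : MY n (revY (pc 0)) F y = MY n (revY (pE 0)) F y + cst * F (ones ++ y).
Proof.
have e p : MY n (revY p) F y = MY n p (fun z => F (rev z ++ y)) [::].
  by rewrite /MY rstripY_nil prY_rev.
by rewrite !e MY_pc0 cats0 /ones rev_nseq.
Qed.

Lemma toY_nseq_cat j k w : toY (nseq j false ++ nseq k false ++ true :: w) = (j + k).+1 :: toY w.
Proof. by rewrite catA -nseqD /toY toY_aux_cat. Qed.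

(** In the first half of [R] the trailing x0 of [a] merge with x0^{k-1}. In the second half the
    leading ones do, and reversing [a] makes them trailing. *)
Lemma RE k F y : R k.+1 F y = \sum_(i < n.+1)
   (Yl (k.+1 + i) (MY (n - i) (pE i) F) y - MY (n - i) (revY (pE i)) (Yl (k.+1 + i) F) y).
Proof.
rewrite /R /=; under eq_bigr do rewrite mulrBr; rewrite !sumrB; congr (_ - _).
  rewrite big_allwords_tail; apply: eq_bigr => i _; apply: eq_bigr => w hw.
  rewrite /pE /UY iter_rder toYK //; congr (_ * _); rewrite /rstripY; congr F.
  rewrite -[in LHS](toYK hw) -catA -cats1 toY_iotaY_cat ?posw_toY //.
  by rewrite toY_nseq_cat -catA addSn addnC.
rewrite -big_allwords_rev big_allwords_tail /=.
(* Odd weight enters here: the antipode gives psi(rev a) = psi(a). *)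
have e a : size a = n -> psi (rev a) = psi a.
  by move=> ha; rewrite (prim_antipode hp _ ha) ?(ltnW n1) // -signr_odd hodd expr1; ring.
apply: eq_bigr => i _; rewrite /MY prY_rev /prY big_seq_cond [RHS]big_seq_cond.
apply: eq_bigr => w /andP[]; rewrite mem_allwords => /eqP sw hw.
rewrite e; last by rewrite size_cat size_nseq sw subnK // -ltnS.
rewrite /pE /UY iter_rder toYK //; congr (_ * _); rewrite /revY /rstripY; congr F.
rewrite rev_cat rev_nseq -cats1 -catA -{1}(toYK hw) rev_iotaY ?posw_toY //.
by rewrite toY_nseq_cat iotaYK ?posw_rev ?posw_toY // addSn.
Qed.

Lemma prYN m p F : prY m (- p) F = - prY m p F.
Proof. by rewrite /prY -sumrN; apply: eq_bigr => w _; rewrite staN mulNr. Qed.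
Lemma TE i m F y : T i m F y = Yl m (MY (n - i) (pc i) F) y - MY (n - i) (revY (pc i)) (Yl m F) y.
Proof. by rewrite /T staD; congr (_ + _); rewrite /P' /MY prYN. Qed.

Lemma dltQ k F : dlt k.+1 F = Q k.+1 0 F.
Proof.
apply/funext => y; rewrite /dlt RE /Q sta_sum; under [RHS]eq_bigr do rewrite /= subn0 TE.
rewrite [in LHS]big_ord_recl [in RHS]big_ord_recl !addn0 !subn0 addrAC; congr (_ + _).
rewrite -[Yl k.+1 (MY n (pc _) F) y]/(MY n (pc 0) F (k.+1 :: y)) MY_pc0 MY_revpc0.
rewrite -[Yl k.+1 (MY n (pE _) F) y]/(MY n (pE 0) F (k.+1 :: y)) -[Yl k.+1 F _]/(F (k.+1 :: ones ++ y)).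
by ring.
Qed.

(** [T] acts on prefixes, so it commutes with stripping suffixes and is determined by its constant
    coefficients. *)
Lemma T_rstrip i m F y : T i m F y = T i m (rstripY y F) [::].
Proof.
rewrite /T !staD; congr (_ + _).
  by case: m => [|m]; rewrite /= /P ?/yd /MY; congr prY; apply/funext => z; rewrite /rstripY -catA.
by rewrite /P' /MY; case: m => [|m]; congr prY; apply/funext => z; rewrite /rstripY /= /yd ?cats0.
Qed.
Lemma Q_rstrip k b F y : Q k b F y = Q k b (rstripY y F) [::].
Proof.
rewrite /Q !sta_sum; apply: eq_bigr => i _; case: ifP => _ //; exact: T_rstrip.
Qed.

Lemma primY1 m p : primY m p -> prY m p 1 = 0.
Proof.
move=> h; have := h 1 1; rewrite mulr1 mul1r mulr1 => e.
by apply: (addrI (prY m p 1)); rewrite addr0 -e.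
Qed.

(** For m = 0 the two summands cancel because a one-letter word is its own reversal; for m > 0 each
    is a multiple of a primitive form at 1, which is 0. *)
Lemma T_letter i m c : (i <= n)%N -> T i m (ydelta [:: c]) [::] = 0.
Proof.
move=> hi; have hP := primY_pc hi; have hP' := primYN (primY_rev hP); case: m => [|m].
  rewrite /T staD /P /P' /= !MY_nil.
  rewrite prYN prY_rev (prY_eqr _ (F' := ydelta [:: c])) ?subrr // => z _ _.
  by rewrite /revY /ydelta; congr (_%:R); congr nat_of_bool; rewrite -(inj_eq (can_inj revK)) revK.
rewrite /T staD /= yd_delta linearZ /= staZ /P' MY_nil ydelta_nil (primY1 hP') mulr0 addr0.
rewrite /yd /P /MY (prY_eqr _ (F' := (m.+1 == c)%:R *: (1 : sta))) => [|z _ _].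
  by rewrite linearZ /= (primY1 hP) mulr0.
rewrite staZ /rstripY /ydelta cats1; case: z => [|a z].
  by rewrite eqseq_cons eqxx andbT -[(1 : sta) _]/(1 : rat) mulr1.
by rewrite -[(1 : sta) _]/(0 : rat) mulr0 /= eqseq_cons; case: z => [|? ?]; rewrite /= andbF.
Qed.

Lemma Q1_letter b c : Q 1 b (ydelta [:: c]) [::] = 0.
Proof.
rewrite /Q sta_sum big1 // => i _; case: ifP => // _; apply: T_letter.
by rewrite -ltnS.
Qed.

(** For k = 1 the factor x0^{k-1} is empty, so both positions of [a] give a x1; likewise y_1^n y_1
    and y_1 y_1^n coincide. *)
Lemma dlt1 F : dlt 1 F = 0.
Proof.
apply/funext => y; rewrite /dlt /R big1 => [|a _]; last by rewrite /= cats1 subrr mulr0.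
rewrite add0r (_ : ones ++ 1%N :: y = 1%N :: ones ++ y) ?subrr ?mulr0 // /ones.
by elim: n => //= m ->.
Qed.

(** In [QM] for the product of F with the letter y_c the left side is [dlt 1], hence 0, and at the
    empty word the only surviving term on the right is [Q 1 c F]. *)
Lemma Q1_nil c F : (0 < c)%N -> Q 1 c F [::] = 0.
Proof.
move=> c0; have [hc|hc] := ltnP c n.+2; last first.
  by rewrite /Q sta_sum big1 // => i _; case: ifP => // h; have := ltn_ord i; lia.
have := QM 1 F (ydelta [:: c]); rewrite -dltQ dlt1 => /(congr1 (fun H : sta => H [::])).
rewrite sta0 sta_sum add1n (bigD1 (Ordinal hc)) //= big1 => [|b hb].
  rewrite addr0 staD !sta_nil Q1_letter mulr0 addr0; case: (c) c0 => // c' _ /=.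
  by rewrite yd_delta eqxx scale1r ydelta_nil mulr1 => <-.
rewrite staD !sta_nil Q1_letter mulr0 addr0; case: b hb => [[|b] hb'] hb /=; first by rewrite mulr0.
rewrite yd_delta staZ (_ : (_ == c) = false) ?mul0r ?mulr0 //.
by apply/negP => /eqP e; case/eqP: hb; apply/val_inj.
Qed.
Lemma Q1_eq0 c F : (0 < c)%N -> Q 1 c F = 0.
Proof. by move=> c0; apply/funext => y; rewrite Q_rstrip Q1_nil. Qed.

(** In [QM] the terms with b < k are the defects [dlt (k - b)], and those with b >= k are [Q 1 c]
    with c = b - k + 1 > 0, which vanish. *)
Lemma dltM k F G : (0 < k)%N -> dlt k (F * G) =
  \sum_(b < k) (dlt (k - b) F * Yl b G + Yl b F * dlt (k - b) G).
Proof.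
case: k => // k _; rewrite dltQ QM.
rewrite (big_ord_widen (k.+1 + n).+1 (fun b => dlt (k.+1 - b) F * Yl b G + Yl b F * dlt (k.+1 - b) G)).
  rewrite [RHS]big_mkcond; apply: eq_bigr => b _; case: ltnP => hb.
    rewrite (_ : k.+1 - b = (k - b).+1)%N ?subSn // !dltQ.
    have e H : Q k.+1 b H = Q (k - b).+1 0 H.
      apply: eq_bigr => i _ /=; rewrite (_ : (b <= k.+1 + i)%N); last by lia.
      by congr T; lia.
    by rewrite !e.
  have e H : Q k.+1 b H = 0.
    rewrite -[RHS](@Q1_eq0 (b - k) H) ?subn_gt0 //; apply: eq_bigr => i _.
    have -> : (b <= k.+1 + i)%N = (b - k <= 1 + i)%N by lia.
    by case: ifP => // h; congr T; lia.
  by rewrite !e mul0r mulr0 addr0.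
by lia.
Qed.

Fixpoint DYw (y : seq nat) (F : sta) : rat :=
  if y is k :: y' then DYw y' (yd k F) + R k F y' else prY n (UY psi) F.
Definition DY F : sta := fun y => DYw y F.
(** [DY] with the correction of [psiStar] added. It obeys the stuffle Leibniz rule on all products,
    whereas for [DY] the rule is drawn below with a convergent first factor. *)
Definition Dt F : sta := fun y => DYw y F + cst * F (ones ++ y).

Lemma R_is_linear k : linear (R k).
Proof.
move=> c F G; apply/funext => y; rewrite staD staZ /R mulr_sumr -big_split.
by apply: eq_bigr => a _ /=; rewrite !staD !staZ; ring.
Qed.
HB.instance Definition _ k := GRing.isLinear.Build rat sta sta _ (R k) (R_is_linear k).
Lemma DY_is_linear : linear DY.
Proof.
move=> c F G; apply/funext => y; rewrite staD staZ /DY; elim: y F G => [|k y ih] F G /=.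
  by rewrite linearP.
by rewrite [yd _ _]linearP ih [R _ _]linearP /= staD staZ; ring.
Qed.
HB.instance Definition _ := GRing.isLinear.Build rat sta sta _ DY DY_is_linear.
Lemma Dt_is_linear : linear Dt.
Proof.
move=> c F G; apply/funext => y; rewrite staD staZ /Dt -!/(DY _ _) linearP /= !staD !staZ; ring.
Qed.
HB.instance Definition _ := GRing.isLinear.Build rat sta sta _ Dt Dt_is_linear.

Lemma yd_Dt k F : yd k (Dt F) = Dt (yd k F) + dlt k F.
Proof.
apply/funext => y; rewrite -[LHS]/(DYw y (yd k F) + R k F y + cst * F (ones ++ k :: y)).
by rewrite staD /Dt /dlt -[yd k F (ones ++ y)]/(F (k :: ones ++ y)); ring.
Qed.
Lemma Dt_nil F : Dt F [::] = prY n (psiStar psi) F.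
Proof.
by have := MY_pc0 F [::]; rewrite !MY_nil => ->; rewrite /Dt cats0.
Qed.

(** The commutator of [Dt] with stripping y_k is [dlt k], and [dltM] is the Leibniz rule for that
    commutator. *)
Lemma Dt_deriv F G y : posw y -> Dt (F * G) y = (Dt F * G + F * Dt G) y.
Proof.
elim: y F G => [|[|k] y ih] F G // hy; first by rewrite staD !sta_nil !Dt_nil hst.
rewrite !ydE yd_Dt linearD /= !ydM // linear_sum /= dltM // !staD !sta_sum -big_split /=.
under [in LHS]eq_bigr do rewrite ih // staD.
have e j (H : sta) : Yl j (Dt H) = Dt (Yl j H) + (if j is 0 then 0 else dlt j H).
  by case: j => [|j]; rewrite ?addr0 // /Yl yd_Dt.
under [in RHS]eq_bigr do rewrite !e mulrDl mulrDr !staD addrACA.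
rewrite [in RHS]big_split /=; congr (_ + _).
rewrite [RHS]big_split /= [X in _ = X + _](reindex_inj rev_ord_inj) -big_split [RHS]big_ord_recr /=.
rewrite !subnn mulr0 mul0r !sta0 !addr0; apply: eq_bigr => j _; have hj := ltn_ord j.
rewrite subSS subKn ?(ltnW hj) // staD subSn -1?ltnS //.
Qed.
End Racinet.

(** The differences contributed by the k letters x0 telescope. *)
Lemma D_letter n psi f k w : D n psi f (nseq k false ++ true :: w) =
  D n psi (fun v => f (nseq k false ++ true :: v)) w +
  (M n psi f (nseq k false ++ true :: w) - M n psi (fun v => f (nseq k false ++ v)) (true :: w)).
Proof.
elim: k f => [|k ih] f; first by rewrite /= lderE lder_true_Dop -/(D n psi _) subrr addr0.
rewrite /= lderE lder_false_Dop -/(D n psi _) !shaD ih shaN -!lderE /=.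
by ring.
Qed.

Lemma R_posw n psi k F F' y : (forall z, posw z -> F z = F' z) -> posw y -> R n psi k F y = R n psi k F' y.
Proof.
move=> h hy; apply: eq_bigr => a _; have e w : posw (toY w ++ y) by rewrite /posw all_cat -!/(posw _) posw_toY.
by rewrite !h.
Qed.
Lemma DYw_posw n psi F F' y : (forall z, posw z -> F z = F' z) -> posw y ->
  DYw n psi y F = DYw n psi y F'.
Proof.
elim: y F F' => [|k y ih] F F' h; first by move=> _; apply: prY_eqr => z hz _; exact: h.
move=> /andP[k0 hy] /=; rewrite (R_posw n psi k h hy); congr (_ + _); apply: ih => // z hz.
by rewrite /yd h //= k0.
Qed.
Lemma staM_posw (F F' G G' : sta) y : (forall z, posw z -> F z = F' z) -> (forall z, posw z -> G z = G' z) ->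
  posw y -> (F * G) y = (F' * G') y.
Proof.
move=> hF hG hy; rewrite !staM; apply: eq_big_seq => q /(dStar_pos hy)[h1 h2 _].
by rewrite hF ?hG.
Qed.

Lemma yend_XY f : yend_poly f -> f = XY (UY f).
Proof.
move=> h; apply/funext => w; rewrite /XY; case: ifP => hw; first by rewrite /UY toYK.
by apply/eqP/negP => /negP /h; rewrite hw.
Qed.

Lemma D_UY n psi f y : yend_poly f -> posw y -> D n psi f (iotaY y) = DYw n psi y (UY f).
Proof.
elim: y f => [|[|k] y ih] f hf // hy; first by rewrite /= D_nil {1}(yend_XY hf) pr_XY.
have hs : yend_poly (fun v => f (nseq k false ++ true :: v)).
  move/yend_polyP: hf => hf; apply/yend_polyP => w; rewrite -rcons_cons -rcons_cat; exact: hf.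
rewrite iotaY_cons D_letter ih //= (_ : UY _ = yd k.+1 (UY f)); last first.
  by apply/funext => z; rewrite /UY /yd iotaY_cons.
congr (_ + _); rewrite /M /pr -sumrB; apply: eq_bigr => a _; rewrite -mulrBr; congr (_ * _).
have e u v : UY f (toY (rcons u true) ++ v) = f (rcons u true ++ iotaY v).
  by rewrite /UY /iotaY map_cat flatten_cat -/(iotaY _) toYK // isYword_rcons.
by rewrite /rstrip -!rcons_cat !e !cat_rcons -!catA.
Qed.

Section RacinetX.
Variables (n : nat) (psi : sha).
Hypotheses (hp : prim n psi) (n1 : (1 < n)%N) (hodd : odd n) (hst : primY n (psiStar psi)).

Lemma pstuffle_XY u v : pstuffle u v = XY (UY u * UY v) :> sha.
Proof. by apply/funext => w; rewrite pstuffleE. Qed.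
Lemma XY_yend F : yend_poly (XY F).
Proof. by apply/yend_polyP => w; rewrite /XY isYword_rcons. Qed.

(** The letter y_1 is primitive for the stuffle coproduct; if U has no leading y_1, the whole prefix
    y_1^m falls to V. *)
Lemma strip_ones m (U V : sta) y : yd 1 U = 0 ->
  (U * V) (nseq m 1%N ++ y) = (U * ((fun z => V (nseq m 1%N ++ z)) : sta)) y.
Proof.
move=> hU; elim: m V => [|m ih] V; first by congr (_ _).
rewrite /= ydE ydM // !big_ord_recl big_ord0 /= hU mul0r !addr0 ih.
by [].
Qed.

(** Convergence of u removes its correction at y_1^n, and by [strip_ones] the correction of the
    product is u times that of v; the two occurrences cancel in the Leibniz rule for [Dt]. *)
Lemma D_pstuffle u v : conv_poly u -> yend_poly v ->
  D n psi (pstuffle u v) = (pstuffle (D n psi u) v : sha) + pstuffle u (D n psi v).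
Proof.
move=> hu hv; have [hu1 hu2] := (conv_polyP u).1 hu.
rewrite !pstuffle_XY; apply/funext => w; rewrite shaD.
case hw: (isYword w); last first.
  rewrite {2 3}/XY hw addr0; apply/eqP/negP => /negP h.
  by have := @D_yend n psi _ (@XY_yend (UY u * UY v)) w h; rewrite hw.
rewrite {2 3}/XY hw -{1}(toYK hw) D_UY ?posw_toY //; last exact: XY_yend.
move: (toY w) (posw_toY w) => y hy.
rewrite (@DYw_posw _ _ _ (UY u * UY v)) // => [|z hz]; last first.
  by rewrite /UY /XY isYword_iotaY iotaYK.
have hU : yd 1 (UY u) = 0.
  by apply/funext => z; rewrite /yd /UY (iotaY_cons 0) /= lderE hu2.
have := Dt_deriv hp n1 hodd hst (UY u) (UY v) hy.
rewrite {1}/Dt strip_ones //.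
have -> : Dt n psi (UY u) = DY n psi (UY u).
  apply/funext => z; rewrite /Dt /ones; case: n n1 => // m _ /=.
  by rewrite -[UY u _]/(yd 1 (UY u) _) hU mulr0 addr0.
have -> : Dt n psi (UY v) = DY n psi (UY v) + cst n psi *: ((fun z => UY v (ones n ++ z)) : sta) by [].
rewrite mulrDr -scalerAr addrA staD staZ => /addIr ->; rewrite staD.
congr (_ + _); apply: staM_posw => // z hz; rewrite /DY.
  by rewrite [RHS]D_UY.
by rewrite [RHS]D_UY.
Qed.
End RacinetX.

(** * The ideal of regularized double shuffle relations *)

Lemma xpolyP (f g : xpoly) : (forall w, f w = g w) -> f = g. Proof. by move=> h; apply/funext. Qed.

Lemma span_closed P (f g : sha) (c : rat) : span P f -> span P g -> span P (c *: f + g).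
Proof.
elim=> {f} [hg|a f0 f hf _ ih|f f' _ ih /xpolyP <-] //.
  by rewrite (_ : c *: (pzero : sha) + g = g) //; apply/funext => w; rewrite !shaE mulr0 add0r.
move=> /ih h; have -> : c *: (padd (pscale a f0) f : sha) + g =
  padd (pscale (c * a) f0) (c *: (f : sha) + g) :> sha.
  apply/funext => w; rewrite shaD shaZ.
  rewrite -[padd _ (c *: (f : sha) + g) w]/(c * a * f0 w + (c * f w + g w)) -[padd _ _ w]/(a * f0 w + f w).
  by ring.
exact: spanS.
Qed.
Lemma span_gen P f : P f -> span P f.
Proof.
move=> h; have := spanS 1 h (span0 P).
by rewrite (_ : padd _ _ = f) //; apply/funext => w; rewrite /padd /pscale /pzero mul1r addr0.
Qed.
Lemma spanZ P (c : rat) (f : sha) : span P f -> span P (c *: f).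
Proof. by move=> h; rewrite -[_ *: _]addr0; exact: (span_closed c h (span0 P)). Qed.
Lemma spanD P (f g : sha) : span P f -> span P g -> span P (f + g).
Proof. by move=> hf hg; rewrite -[f]scale1r; apply: span_closed. Qed.
Lemma spanB P (f g : sha) : span P f -> span P g -> span P (f - g).
Proof. by move=> hf hg; rewrite addrC -scaleN1r; apply: span_closed. Qed.
Lemma span_sum P I r (Q : pred I) (F : I -> sha) :
  (forall i, Q i -> span P (F i)) -> span P (\sum_(i <- r | Q i) F i).
Proof. by move=> h; elim/big_rec: _ => [|i f hi]; [exact: span0 | apply/spanD/h]. Qed.
Lemma span_lin P P' (L : {linear sha -> sha}) (f : sha) :
  (forall h, P h -> span P' (L h)) -> span P f -> span P' (L f).
Proof.
move=> hL; elim=> {f} [|a f0 f hf _ ih|f f' _ ih /xpolyP <-] //.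
  by rewrite (_ : L pzero = 0) ?linear0 //; exact: span0.
rewrite -[padd _ _]/(a *: (f0 : sha) + (f : sha)) linearP.
by apply: span_closed => //; apply: hL.
Qed.
Lemma span_annihil P (L : {linear sha -> rat | *%R}) (f : sha) :
  (forall h, P h -> L h = 0) -> span P f -> L f = 0.
Proof.
move=> hL; elim=> {f} [|a f0 f hf _ ih|f f' _ ih /xpolyP <-] //; first exact: linear0.
by rewrite -[padd _ _]/(a *: (f0 : sha) + (f : sha)) linearP /= ih hL ?mulr0 ?addr0.
Qed.

Lemma ispolyD (f g : sha) : ispoly f -> ispoly g -> ispoly (f + g).
Proof.
move=> [a ha] [b hb]; exists (maxn a b) => w; rewrite geq_max => /andP[h1 h2].
by rewrite shaD ha ?hb ?addr0.
Qed.
Lemma ispolyZ (c : rat) (f : sha) : ispoly f -> ispoly (c *: f).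
Proof. by move=> [a ha]; exists a => w hw; rewrite shaZ ha ?mulr0. Qed.
Lemma ispolyM (f g : sha) : ispoly f -> ispoly g -> ispoly (f * g).
Proof.
move=> [a ha] [b hb]; exists (a + b)%N => w hw; rewrite -mulE /pshuffle big_seq big1 // => m.
rewrite mem_allwords => hm; have := size_maskC (eqP hm).
have [h _|h h2] := leqP a (size (mask m w)); first by rewrite ha ?mul0r.
by rewrite [X in _ * X]hb ?mulr0 //; lia.
Qed.
Lemma homog_ispoly N f : homog N f -> ispoly f.
Proof. by move=> h; exists N.+1 => w hw; apply: h; rewrite neq_ltn hw orbT. Qed.
Lemma ispoly_pword w : ispoly (pword w). Proof. exact/homog_ispoly/homog_pword. Qed.
Lemma ispoly1 : ispoly (1 : sha). Proof. exact: (ispoly_pword [::]). Qed.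
Lemma ispoly0 : ispoly (0 : sha). Proof. by exists 0%N. Qed.
Lemma ispoly_wpart n f : ispoly (wpart n f).
Proof. by apply: (@homog_ispoly n) => w hw; rewrite /wpart (negbTE hw). Qed.
Lemma wpart_homog n f : homog n (wpart n f).
Proof. by move=> w hw; rewrite /wpart (negbTE hw). Qed.
Lemma wpart_id n f : homog n f -> wpart n f = f.
Proof. by move=> h; apply/funext => w; rewrite /wpart; case: ifP => // /negbT /h. Qed.
Lemma wpart_is_linear n : linear (wpart n : sha -> sha).
Proof.
move=> c f g; apply/funext => w; rewrite shaD shaZ /wpart.
by case: ifP => _; rewrite ?shaD ?shaZ ?mulr0 ?addr0.
Qed.
HB.instance Definition _ n := GRing.isLinear.Build rat sha sha _ (wpart n : sha -> sha) (wpart_is_linear n).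

Lemma homogM i j (f g : sha) : homog i f -> homog j g -> homog (i + j) (f * g).
Proof.
move=> hf hg w hw; rewrite -mulE /pshuffle big_seq big1 // => m.
rewrite mem_allwords => hm; have := size_maskC (eqP hm).
have [h h2|h _] := eqVneq (size (mask m w)) i; last by rewrite hf ?mul0r.
by rewrite [X in _ * X]hg ?mulr0 //; apply: contra hw => /eqP <-; rewrite -h2 h.
Qed.
Lemma homogZ n (c : rat) (f : sha) : homog n f -> homog n (c *: f).
Proof. by move=> h w /h; rewrite shaZ => ->; rewrite mulr0. Qed.
Lemma homogD n (f g : sha) : homog n f -> homog n g -> homog n (f + g).
Proof. by move=> hf hg w hw; rewrite shaD hf ?hg ?addr0. Qed.
Lemma homogB n (f g : sha) : homog n f -> homog n g -> homog n (f - g).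
Proof. by move=> hf hg w hw; rewrite shaD shaN hf ?hg ?subr0. Qed.

Lemma wpartM N (f g : sha) : wpart N (f * g) = \sum_(i < N.+1) (wpart i f : sha) * wpart (N - i) g.
Proof.
apply/funext => w; rewrite sha_sum {1}/wpart; case: eqP => hw; last first.
  rewrite big1 // => i _; have hi : (i + (N - i) = N)%N by rewrite subnKC // -ltnS.
  apply: (homogM (@wpart_homog i f) (@wpart_homog (N - i) g)); rewrite hi; exact/eqP.
under eq_bigr do rewrite -mulE /pshuffle; rewrite -mulE /pshuffle exchange_big.
rewrite big_seq [RHS]big_seq; apply: eq_bigr => m; rewrite mem_allwords => hm.
have h := size_maskC (eqP hm); have hi : (size (mask m w) < N.+1)%N by lia.
rewrite (bigD1 (Ordinal hi)) //= big1 ?addr0 => [|i hne]; last first.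
  by rewrite {1}/wpart; case: eqP => [e|_]; rewrite ?mul0r //; case/eqP: hne; apply/val_inj; rewrite /= e.
by rewrite /wpart eqxx -hw -h addKn eqxx.
Qed.

Lemma wpart_pstuffle N (u v : sha) :
  wpart N (pstuffle u v) = \sum_(i < N.+1) (pstuffle (wpart i u) (wpart (N - i) v) : sha).
Proof.
apply/funext => w; rewrite sha_sum {1}/wpart /pstuffle; case: eqP => hw; last first.
  symmetry; apply: big1 => i _; apply: big1 => j _; rewrite big_seq; apply: big1 => a; rewrite mem_allwords => /eqP ha.
  rewrite big_seq; apply: big1 => b; rewrite mem_allwords => /eqP hb; rewrite /wpart ha hb.
  case: eqP => hji; rewrite ?mul0r //; case: eqP => hb'; rewrite ?mulr0 ?mul0r //.
  by have := ltn_ord i; have := ltn_ord j; lia.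
rewrite [RHS]exchange_big hw; apply: eq_bigr => j _; rewrite [RHS]exchange_big; apply: eq_big_allwords => a ha.
rewrite [RHS]exchange_big; apply: eq_big_allwords => b hb.
rewrite (bigD1 j) //= big1 ?addr0 => [|i hij]; last first.
  by rewrite /wpart ha; case: eqP => [e|_]; rewrite ?mul0r //; case/eqP: hij; apply/val_inj; rewrite /= e.
by rewrite /wpart ha hb !eqxx.
Qed.

Lemma inR_gen g : genR g -> inR g.
Proof.
move=> h; apply: span_gen; exists g, (1 : sha); split=> //; first exact: ispoly1.
by move=> w; rewrite mulE mulr1.
Qed.
Lemma inRM (f p : sha) : inR f -> ispoly p -> inR (f * p).
Proof.
move=> hf hp.
have lin : linear (fun f : sha => f * p) by move=> c a b; rewrite mulrDl scalerAl.
pose Lp := GRing.isLinear.Build rat sha sha _ (fun f : sha => f * p) lin.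
pose L : {linear sha -> sha} := HB.pack (fun f : sha => f * p) Lp.
apply: (@span_lin _ _ L) hf => h [g [q [hg hq /xpolyP ->]]]; apply: span_gen.
exists g, ((q : sha) * p); split=> //; first exact: ispolyM.
by move=> w; rewrite -[L _]/((g : sha) * q * p) mulE mulrA.
Qed.
Lemma inRMl (f p : sha) : inR f -> ispoly p -> inR (p * f).
Proof. by move=> hf hp; rewrite mulrC; apply: inRM. Qed.

Lemma genR_stuffle u v : ispoly u -> ispoly v -> conv_poly u -> yend_poly v ->
  inR ((u : sha) * v - pstuffle u v).
Proof. by move=> *; apply: inR_gen; right; right; exists u, v; split. Qed.

Lemma wpart_poly_conv n u : conv_poly u -> conv_poly (wpart n u).
Proof. by move=> h w; rewrite /wpart; case: ifP => // _ /h. Qed.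
Lemma wpart_poly_yend n u : yend_poly u -> yend_poly (wpart n u).
Proof. by move=> h w; rewrite /wpart; case: ifP => // _ /h. Qed.

Lemma inR_wpart_gen i g : genR g -> inR (wpart i g).
Proof.
have hx a : inR (wpart i (pword [:: a])).
  case: (eqVneq i 1%N) => [->|hi].
    rewrite wpart_id; last exact: (@homog_pword [:: a]).
    by apply: inR_gen; case: a; [right; left | left].
  have -> : wpart i (pword [:: a]) = pzero; last exact: span0.
  apply/funext => w; rewrite /wpart; case: eqP => // hw; apply: (@homog_pword [:: a]).
  by rewrite hw.
case=> [/xpolyP ->|[/xpolyP ->|[u [v [hu hv cu yv /xpolyP ->]]]]]; [exact: hx | exact: hx |].
rewrite -[psub _ _]/((u : sha) * v - (pstuffle u v : sha)) linearB /= wpartM wpart_pstuffle -sumrB.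
apply: span_sum => j _; apply: genR_stuffle; try exact: ispoly_wpart.
  exact: wpart_poly_conv. exact: wpart_poly_yend.
Qed.
Lemma inR_wpart n (f : sha) : inR f -> inR (wpart n f).
Proof.
apply: (@span_lin _ _ (wpart n : {linear sha -> sha})) => h [g [p [hg hp /xpolyP ->]]].
rewrite /= mulE wpartM; apply: span_sum => i _; apply: inRM; last exact: ispoly_wpart.
exact: inR_wpart_gen.
Qed.

Definition preservesR n psi := forall f : sha, inR f -> inR (D n psi f).

(** The letters x0 and x1 die by weight, and the relation for (u, v) goes to the sum of those for (D
    u, v) and (u, D v), where D u is again convergent. *)
Lemma D_inR_odd n psi : prim n psi -> (1 < n)%N -> odd n -> primY n (psiStar psi) -> preservesR n psi.
Proof.
move=> hp n1 ho hst f; apply: (@span_lin _ _ (D n psi)) => h [g [p [hg hq /xpolyP ->]]] /=.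
rewrite mulE D_deriv //; apply: spanD; last first.
  by apply: inRM; [exact: inR_gen | exact: D_ispoly].
apply: inRM => //.
case: hg => [/xpolyP ->|[/xpolyP ->|[u [v [hu hv cu yv /xpolyP ->]]]]].
- by rewrite (@D_homog0 n psi 1%N _ n1); [exact: span0 | exact: (@homog_pword [:: false])].
- by rewrite (@D_homog0 n psi 1%N _ n1); [exact: span0 | exact: (@homog_pword [:: true])].
rewrite -[psub _ _]/((u : sha) * v - (pstuffle u v : sha)) linearB /= D_deriv // D_pstuffle //.
rewrite opprD addrACA; apply: spanD; apply: genR_stuffle => //; try exact: D_ispoly.
  exact: D_conv. exact: D_yend.
Qed.

Lemma dm0_prim n psi : dm0 psi -> (0 < n)%N -> prim n psi.
Proof. by move=> [_ [h _]]; apply: sh_primitive_prim. Qed.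
Lemma dm0_primY n psi : dm0 psi -> (0 < n)%N -> primY n (psiStar psi).
Proof. by move=> [_ [_ h]]; apply: st_primitive_primY. Qed.
Lemma dm0_nseq psi : dm0 psi -> forall j, (0 < j)%N -> psi (nseq j false) = 0.
Proof.
move=> h [|[|j]] // _; first by case: h => -[].
by apply: (@prim_nseq j.+2) => //; exact: dm0_prim.
Qed.

(** The difference between [psi] and [psiStar psi] is a multiple of the value at y_1^n, which
    satisfies the same rule when u is convergent. *)
Lemma pr_pstuffle n psi u v : dm0 psi -> (0 < n)%N -> conv_poly u -> yend_poly v ->
  pr n psi (pstuffle u v) = pr n psi u * v [::] + u [::] * pr n psi v.
Proof.
move=> h n0 cu yv; have [yu u1] := (conv_polyP u).1 cu.
have [n1|n1] := leqP n 1%N.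
  have -> : n = 1%N by lia.
  have z f : pr 1 psi f = 0.
    by case: h => -[_ h1 h2 _] _; rewrite /pr !big_cons big_nil h1 h2 !mul0r addr0.
  by rewrite !z mul0r mulr0 addr0.
have hU : yd 1 (UY u) = 0.
  by apply/funext => z; rewrite /yd /UY (iotaY_cons 0) /= lderE u1.
have e F : prY n (UY psi) F = prY n (psiStar psi) F - cst n psi * F (ones n).
  have := MY_pc0 psi n1 F [::]; rewrite !MY_nil cats0 => ->; rewrite addrK.
  by apply: eq_bigr.
have eX f : yend_poly f -> pr n psi f = prY n (UY psi) (UY f).
  by move=> yf; rewrite {1}(yend_XY yf) pr_XY.
rewrite (eX _ yu) (eX _ yv) pstuffle_XY pr_XY !e (dm0_primY h n0).
have h1 : UY u (ones n) = 0.
  by rewrite /ones; case: (n) n1 => // m _; rewrite -[UY u _]/(yd 1 (UY u) (nseq m 1%N)) hU.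
have -> : (UY u * UY v) (ones n) = u [::] * UY v (ones n).
  by rewrite -[ones n]cats0 strip_ones // sta_nil /= cats0.
rewrite h1 mulr0 subr0 -[UY u [::]]/(u [::]) -[UY v [::]]/(v [::]); ring.
Qed.

Lemma inI_annihil n psi (f : sha) : dm0 psi -> (0 < n)%N -> inI f -> pr n psi f = 0.
Proof.
move=> h n0; have hp := dm0_prim h n0.
have hw w : (0 < size w)%N -> (forall w', size w' = size w -> psi w' = 0) \/ psi w = 0 -> pr n psi (pword w) = 0.
  by move=> _ hh; rewrite pr_pword; case: eqP => // e; case: hh => [->|].
have hX a p : pr n psi ((pword [:: a] : sha) * p) = 0.
  rewrite hp hw //; last by right; case: h => -[]; case: a.
  by rewrite -[pword _ _]/(0 : rat) !mul0r addr0.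
apply: (@span_annihil _ (pr n psi)) => g [[g' [p [hg hpp /xpolyP ->]]]|[[p [hpp /xpolyP ->]]|]].
- case: hg => [/xpolyP ->|[/xpolyP ->|[u [v [hu hv cu yv /xpolyP ->]]]]]; [exact: hX | exact: hX |].
  rewrite -[psub _ _]/((u : sha) * v - (pstuffle u v : sha)) /= mulE hp linearB /= hp pr_pstuffle // subrr.
  rewrite shaD shaN sha_nil pstuffleE /= sta_nil -[UY u [::]]/(u [::]) -[UY v [::]]/(v [::]).
  by rewrite subrr !mul0r addr0.
- rewrite /= mulE hp hw //; last by right; case: h => -[].
  by rewrite -[pword _ _]/(0 : rat) !mul0r addr0.
by case=> a [b [_ _ ha hb /xpolyP ->]]; rewrite /= mulE hp ha hb mul0r mulr0 addr0.
Qed.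

Lemma D_psi_lin n (c : rat) (a b f : sha) : D n (c *: a + b) f = c *: D n a f + D n b f.
Proof.
have hM x : M n (c *: a + b) x = c *: M n a x + M n b x.
  apply/funext => w; rewrite shaD shaZ /M ![pr n _ (rstrip w x)]prC.
  by rewrite linearP.
apply/funext => w; rewrite shaD shaZ /D /Dop; elim: w f => [|[] w ih] f /=.
- by rewrite hM shaD shaZ.
- exact: ih.
by rewrite ih !hM !shaD !shaZ; ring.
Qed.
Lemma D_psi_ext n (a b f : sha) : (forall w, size w = n -> a w = b w) -> D n a f = D n b f.
Proof.
move=> h; have hM x : M n a x = M n b x by apply/funext => w; exact: pr_eql.
apply/funext => w; rewrite /D /Dop; elim: w f => [|[] w ih] f /=; by rewrite ?ih ?hM.
Qed.
Lemma D_psi_zero n f : D n 0 f = 0.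
Proof.
have := D_psi_lin n (-1) 0 0 f; rewrite scaler0 addr0 scaleN1r => ->; exact: addNr.
Qed.
Lemma D_psi_homog n m (a f : sha) : homog m a -> m != n -> D n a f = 0.
Proof.
move=> h hmn; rewrite -(D_psi_zero n f); apply: D_psi_ext => w hw; apply: h; rewrite hw eq_sym.
by [].
Qed.

(** * Elements of dm_0 as combinations of iterated brackets *)

Fixpoint wt (t : LieTerm) : nat :=
  match t with LGen k => k.*2 + 3 | LBr t1 t2 => wt t1 + wt t2 end.

Section Generated.
Variable sigma : nat -> xpoly.
Hypothesis sigmaP : forall k, dm0 (sigma k) /\ homog (k.*2 + 3) (sigma k).
Hypothesis closedP : forall c, dm0 (lincombI sigma c).
Hypothesis genP : forall psi, dm0 psi -> exists c, forall w, psi w = lincombI sigma c w.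

Lemma wt_gt2 t : (2 < wt t)%N.
Proof. by elim: t => [k|t1 h1 t2 h2] /=; lia. Qed.
Lemma evalI_homog t : homog (wt t) (evalI sigma t).
Proof.
elim: t => [k|t1 h1 t2 h2]; first by case: (sigmaP k).
exact: ihara_homog.
Qed.
Lemma evalI_dm0 t : dm0 (evalI sigma t).
Proof.
have := closedP [:: (1, t)]; congr dm0; apply/funext => w.
by rewrite /lincombI big_seq1 mul1r.
Qed.
Lemma D_br t1 t2 (f : sha) : D (wt (LBr t1 t2)) (evalI sigma (LBr t1 t2)) f =
  D (wt t2) (evalI sigma t2) (D (wt t1) (evalI sigma t1) f) -
  D (wt t1) (evalI sigma t1) (D (wt t2) (evalI sigma t2) f).
Proof. by apply: D_ihara; exact: evalI_homog. Qed.

(** Generators have odd weight, where [D_inR_odd] applies; brackets, whatever their parity, act by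
    commutators. *)
Lemma evalI_preserves t : preservesR (wt t) (evalI sigma t).
Proof.
elim: t => [k|t1 h1 t2 h2] f hf; last first.
  by rewrite D_br; apply: spanB; [apply/h2/h1 | apply/h1/h2].
have k3 : (2 < wt (LGen k))%N := wt_gt2 _; have := evalI_dm0 (LGen k) => hd.
apply: D_inR_odd => //; try lia.
- by apply: dm0_prim => //; lia.
- by rewrite /= oddD odd_double.
by apply: dm0_primY => //; lia.
Qed.

Lemma D_generated n psi (f : sha) : dm0 psi -> exists c : seq (rat * LieTerm),
  D n psi f = \sum_(x <- c | wt x.2 == n) x.1 *: (D n (evalI sigma x.2) f : sha) /\
  (forall w, size w = n -> psi w = \sum_(x <- c | wt x.2 == n) x.1 * evalI sigma x.2 w).
Proof.
move=> /genP[c /xpolyP ->]; exists c; split; last first.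
  move=> w hw; rewrite /lincombI [RHS]big_mkcond; apply: eq_bigr => x _; case: eqP => // h.
  by rewrite evalI_homog ?mulr0 // hw eq_sym; apply/eqP.
elim: c => [|x c ih].
  rewrite big_nil -(D_psi_zero n f); congr D; apply/funext => w; exact: big_nil.
have -> : lincombI sigma (x :: c) = x.1 *: (evalI sigma x.2 : sha) + (lincombI sigma c : sha).
  by apply/funext => w; rewrite shaD shaZ /lincombI big_cons.
rewrite D_psi_lin ih big_cons; case: eqP => // h.
by rewrite (D_psi_homog _ (@evalI_homog x.2)) ?scaler0 ?add0r //; apply/eqP.
Qed.

Lemma dm0_preserves n psi : dm0 psi -> preservesR n psi.
Proof.
move=> h f hf; have [c [-> _]] := D_generated n f h.
by apply: span_sum => x /eqP <-; apply: spanZ; exact: evalI_preserves.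
Qed.
End Generated.

(** * The annihilator of decomposables *)

(** Relations in R are required to involve polynomials, so series are cut at weight n; the weight-n
    pairing does not see the cut. *)
Definition truncXY n (F : sta) : sha := fun w => if (size w <= n)%N then XY F w else 0.
Lemma truncXY_poly n F : ispoly (truncXY n F).
Proof. by exists n.+1 => w hw; rewrite /truncXY leqNgt hw. Qed.
Lemma truncXY_yend n F : yend_poly (truncXY n F).
Proof. by apply/yend_polyP => w; rewrite /truncXY /XY isYword_rcons if_same. Qed.
Lemma truncXY_conv n F : yd 1 F = 0 -> conv_poly (truncXY n F).
Proof.
move=> h; apply/conv_polyP; split; first exact: truncXY_yend.
apply/funext => w; rewrite /lder /truncXY; case: ifP => // _; rewrite /XY; case: ifP => // _.
by rewrite -[toY _]/(1%N :: toY w) ydE h.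
Qed.
Lemma UY_truncXY n F y : posw y -> (sumn y <= n)%N -> UY (truncXY n F) y = F y.
Proof. by move=> hy hn; rewrite /UY /truncXY size_iotaY // hn /XY isYword_iotaY iotaYK. Qed.

Section Annihilator.
Variables (n : nat) (phi : sha).
Hypotheses (n1 : (1 < n)%N) (hphi : homog n phi) (hann : forall f : sha, inI f -> pr n phi f = 0).

Lemma inI_mul (a b : sha) : ispoly a -> ispoly b -> a [::] = 0 -> b [::] = 0 -> inI (a * b).
Proof. by move=> *; apply: span_gen; right; right; exists a, b; split. Qed.
Lemma inI_inR f : inR f -> inI f.
Proof.
move=> h; apply: (@span_lin _ _ idfun) h => g hg; apply: span_gen; by left.
Qed.

Lemma ann_sh : sh_primitive phi.
Proof.
move=> a b; have phi0 : phi [::] = 0 by apply: hphi; rewrite eq_sym -lt0n ltnW.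
have e : deltaSh phi a b = pr (size a + size b) phi ((pword a : sha) * pword b).
  rewrite /deltaSh /pr; apply: eq_bigr => w _; congr (_ * _).
  rewrite -mulE /pshuffle -sum1_count natr_sum big_mkcond; apply: eq_bigr => m _ /=.
  by rewrite /pword; case: eqP => _; case: eqP => _ /=; rewrite ?mulr1 ?mulr0 ?mul0r.
have [hn|hn] := eqVneq (size a + size b)%N n; last first.
  rewrite /deltaSh big_seq big1 => [|w]; last first.
    by rewrite mem_allwords => hw; rewrite hphi ?mul0r // (eqP hw).
  case: eqP => [hb|_]; case: eqP => [ha|_]; rewrite ?mul0r ?mul1r ?add0r ?addr0 //.
  - by rewrite ha hb phi0 addr0.
  - by rewrite hphi //; rewrite hb addn0 in hn.
  - by rewrite hphi //; rewrite ha add0n in hn.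
rewrite e; case: eqP => [hb|hb]; case: eqP => [ha|ha].
- by rewrite ha hb phi0 !mulr0 addr0 -[pword [::]]/(1 : sha) mulr1 pr0 phi0 mul0r.
- by rewrite hb mul1r mul0r addr0 -[pword [::]]/(1 : sha) mulr1 pr_pword addn0 eqxx.
- by rewrite ha !(mul1r, mul0r, add0r) pr_pword eqxx.
rewrite !mul0r addr0 hn hann //; apply: inI_mul; try exact: ispoly_pword.
  by rewrite /pword; case: eqP => // /esym.
by rewrite /pword; case: eqP => // /esym.
Qed.

Lemma ann_prim : prim n phi.
Proof. by apply: sh_primitive_prim; [exact: ann_sh | exact: ltnW]. Qed.

(** This condition is stable under multiplication ([neglM]), so it spreads from convergent F to
    every word that is not a power of y_1. *)
Definition negl (F : sta) := forall G : sta, G [::] = 0 -> prY n (psiStar phi) (F * G) = 0.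

Lemma neglD (c : rat) F F' : negl F -> negl F' -> negl (c *: F + F').
Proof. by move=> h h' G hG; rewrite mulrDl -scalerAl linearP /= h ?h' ?mulr0 ?addr0. Qed.
Lemma neglM F H : negl F -> negl (H * F).
Proof. by move=> h G hG; rewrite (mulrC H) -mulrA h // sta_nil hG mulr0. Qed.

Lemma psiStar_split F : prY n (psiStar phi) F = prY n (UY phi) F + cst n phi * F (ones n).
Proof. by have := MY_pc0 phi n1 F [::]; rewrite !MY_nil cats0 => ->. Qed.

(** Modulo R the stuffle with a convergent factor is a shuffle of positive weights, hence lies in I.
    The correction at y_1^n drops, F having neither a leading y_1 nor a constant term. *)
Lemma negl_conv F : F [::] = 0 -> yd 1 F = 0 -> negl F.
Proof.
move=> F0 F1 G G0; rewrite psiStar_split -[ones n]cats0 strip_ones // sta_nil F0 mul0r mulr0 addr0.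
set u := truncXY n F; set v := truncXY n G.
have cu : conv_poly u by exact: truncXY_conv.
have yv : yend_poly v by exact: truncXY_yend.
have pu : ispoly u by exact: truncXY_poly.
have pv : ispoly v by exact: truncXY_poly.
have u0 : u [::] = 0 by [].
have v0 : v [::] = 0 by [].
have : pr n phi (pstuffle u v) = 0.
  apply: hann; rewrite -[pstuffle _ _](subKr (u * v)); apply: spanB; first exact: inI_mul.
  by apply: inI_inR; exact: genR_stuffle.
rewrite pstuffle_XY pr_XY => <-; apply: prY_eqr => z hz sz; rewrite !staM.
apply: eq_big_seq => q /(dStar_pos hz)[h1 h2 h3].
by rewrite !UY_truncXY // -sz -h3 ?leq_addl ?leq_addr.
Qed.

Definition en m : sta := ydelta (nseq m 1%N).
Lemma yd_en k m : yd k (en m.+1) = (k == 1%N)%:R *: en m. Proof. exact: yd_delta. Qed.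

Lemma yd1M (F G : sta) : yd 1 (F * G) = yd 1 F * G + F * yd 1 G.
Proof. by rewrite ydM // !big_ord_recl big_ord0 addr0 addrC. Qed.

(** Induction on the number of leading y_1. What stands behind i leading y_1 is a convergent series
    G, so the stuffle of y_1^i with G is negligible, and subtracting it lowers that number. *)
Lemma negl_ones i F : (forall j, F (nseq j 1%N) = 0) -> iter i (yd 1) F = 0 -> negl F.
Proof.
elim: i F => [|i ih] F hF hi; first by move=> G _; rewrite [F]hi mul0r linear0.
have iE (H : sta) j z : iter j (yd 1) H z = H (nseq j 1%N ++ z).
  elim: j z => // j ihj z; rewrite iterS /yd ihj.
  by congr H; elim: j {ihj} => //= j ->.
set G := iter i (yd 1) F.
have G1 : yd 1 G = 0 by rewrite /G -iterS.
have G0 : G [::] = 0 by rewrite /G iE cats0 hF.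
have st j m : (j <= m)%N -> iter j (yd 1) (en m * G) = en (m - j) * G.
  elim: j => [|j ihj] hj; first by rewrite subn0.
  rewrite iterS ihj ?(ltnW hj) // yd1M G1 mulr0 addr0.
  by rewrite (_ : m - j = (m - j.+1).+1)%N ?yd_en ?eqxx ?scale1r //; lia.
rewrite -[F](subrK (en i * G)) -[F - _]scale1r; apply: neglD; last exact/neglM/negl_conv.
have iB j (A B : sta) : iter j (yd 1) (A - B) = iter j (yd 1) A - iter j (yd 1) B.
  by apply/funext => z; rewrite staD staN !iE.
apply: ih => [j|]; last by rewrite iB st // subnn /en ydelta_nil mul1r subrr.
rewrite staD staN hF sub0r; have [hj|hj] := leqP j i.
  by rewrite -[nseq j _]cats0 -iE st // sta_nil G0 mulr0 oppr0.
have -> : nseq j 1%N = nseq i 1%N ++ nseq (j - i) 1%N by rewrite -nseqD subnKC // ltnW.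
rewrite -iE st // subnn /en ydelta_nil mul1r.
by rewrite (_ : (j - i = (j - i).-1.+1)%N) ?[nseq _ _]/= ?ydE ?G1 ?oppr0 //; lia.
Qed.

(* [Ew k m] is the sum of the words [1^a k 1^b] with [a + b = m]. *)
Fixpoint Ew (k m : nat) : sta := fun y =>
  if y is j :: y' then (j == k)%:R * en m y' +
      (if m is m'.+1 then (j == 1%N)%:R * Ew k m' y' else 0)
  else 0.
Lemma Ew_nil k m : Ew k m [::] = 0. Proof. by case: m. Qed.
Lemma yd_Ew j k m : yd j (Ew k m) =
  (j == k)%:R *: en m + (if m is m'.+1 then (j == 1%N)%:R *: Ew k m' else 0).
Proof. by case: m. Qed.

(** The letter y_k is either inserted into y_1^{m+1} or merged with one of its letters. *)
Lemma en_mul k m y : (0 < k)%N -> posw y ->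
  (ydelta [:: k] * en m.+1) y = (Ew k m.+1 + Ew k.+1 m) y.
Proof.
move=> k0; elim: y m => [|j y ih] m; first by rewrite sta_nil -[ydelta _ [::]]/(0 : rat) mul0r staD !Ew_nil addr0.
move=> /andP[j0 hy]; have ydk i : yd i (ydelta [:: k]) = (i == k)%:R *: 1 by rewrite yd_delta.
have kk : yd k (ydelta [:: k]) = 1 by rewrite ydk eqxx scale1r.
rewrite ydE -[RHS]/((yd j (Ew k m.+1) + yd j (Ew k.+1 m)) y) !yd_Ew.
rewrite -[LHS]/(stm (ydelta [:: k]) (en m.+1) (j :: y)) stm_cons ydk yd_en.
rewrite -!stm_scaleAl -![stm _ (_ *: _)]stm_scaleAr !staD !staZ -[stm 1 _ y]/((1 * en m.+1) y) mul1r.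
rewrite -!addrA; congr (_ + _).
have -> : \sum_(i <- iota 1 j.-1) stm (yd i (ydelta [:: k])) (yd (j - i) (en m.+1)) y =
    (j == k.+1)%:R * en m y.
  have [hj|hj] := eqVneq j k.+1.
    rewrite hj /= (bigD1_seq k) ?iota_uniq ?mem_iota //=; last by lia.
    rewrite kk subSnn yd_en eqxx scale1r -[stm 1 _ y]/((1 * en m) y) !mul1r big1 ?addr0 // => i /negbTE hi.
    by rewrite ydk hi scale0r -[stm 0 _ y]/(((0 : sta) * _) y) mul0r.
  rewrite mul0r big_seq big1 // => i; rewrite mem_iota => hi; rewrite ydk yd_en.
  rewrite -stm_scaleAl -[stm _ (_ *: _)]stm_scaleAr !staZ; case: eqP => hik; rewrite ?mul0r //.
  by case: eqP => hji; rewrite ?mul0r ?mulr0 //; case/eqP: hj; lia.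
rewrite addrC; case: m ih => [|m] ih.
  rewrite sta0 addr0 [RHS]addrC; congr (_ + _ * _).
  rewrite -[en 0]/(1 : sta) mulr1.
  by case: (y) => // i z; rewrite /= addr0 /ydelta /en eqseq_cons -mulnb natrM.
by rewrite staZ [RHS]addrCA -mulrDr -staD -ih.
Qed.

Lemma Ew_ones k m j : (1 < k)%N -> Ew k m (nseq j 1%N) = 0.
Proof.
move=> k1; elim: j m => [|j ih] m; first by case: m.
rewrite [nseq _ _]/= ydE yd_Ew staD staZ (_ : (1 == k)%N = false) ?mul0r ?add0r; last by lia.
by case: m => // m; rewrite staZ ih mulr0.
Qed.
Lemma negl_Ew k m : (1 < k)%N -> negl (Ew k m).
Proof.
move=> k1; apply: (@negl_ones m.+1) => [j|]; first exact: Ew_ones.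
have k1' : (1 == k)%N = false by lia.
elim: m => [|m ih]; first by rewrite -[iter 1 _ _]/(yd 1 _) yd_Ew k1' scale0r add0r.
by rewrite iterSr yd_Ew k1' scale0r add0r scale1r.
Qed.

Lemma UY_phi_ones : UY phi (ones n) = 0.
Proof.
have e m : iotaY (nseq m 1%N) = nseq m true by elim: m => // m ih; rewrite (iotaY_cons 0) ih.
by rewrite /UY /ones e (prim_nseq _ ann_prim n1).
Qed.

Lemma Ew1 m y : posw y -> Ew 1 m y = m.+1%:R * en m.+1 y.
Proof.
elim: m y => [|m ih] [|j y] /=; rewrite ?Ew_nil ?mulr0 // => /andP[_ hy].
  by rewrite addr0 mul1r -[en 1 _]/(yd j (en 1) y) yd_en staZ.
rewrite -[en m.+2 _]/(yd j (en m.+2) y) yd_en staZ ih // -[m.+2%:R]natr1; ring.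
Qed.

Lemma prY_delta p a : posw a -> sumn a = n -> prY n p (ydelta a) = p a.
Proof.
move=> ha sa; have aY : a \in Yw n by rewrite mem_Yw ha sa eqxx.
rewrite prYE (bigD1_seq a) ?uniq_Yw //= /ydelta eqxx mulr1 big1 ?addr0 // => z /negbTE ->.
by rewrite mulr0.
Qed.

(** For k > 1 the letter y_k is convergent, so its stuffle with y_1^{m+1} is killed; by [en_mul]
    each merging of a y_1 into y_k changes the sign, down to the single letter y_n. *)
Lemma prY_Ew m k : (1 < k)%N -> (k + m = n)%N ->
  prY n (psiStar phi) (Ew k m) = (-1) ^+ m * phi (iotaY [:: n]).
Proof.
elim: m k => [|m ih] k k1 hk.
  rewrite (prY_eqr _ (F' := ydelta [:: n])); last first.
    by move=> [|j z] _ _ //=; rewrite addr0 -hk addn0 /ydelta /en eqseq_cons -mulnb natrM.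
  by rewrite prY_delta /= ?addn0 ?(ltnW n1) // /psiStar /= addr0 mul1r.
have : prY n (psiStar phi) (ydelta [:: k] * en m.+1) = 0.
  apply: negl_conv => //; rewrite yd_delta (_ : (1 == k)%N = false) ?scale0r //; lia.
rewrite (prY_eqr _ (F' := Ew k m.+1 + Ew k.+1 m)); last by move=> z hz _; rewrite en_mul // ltnW.
rewrite (linearD (prY n (psiStar phi))) /= => /eqP; rewrite addr_eq0 => /eqP ->.
rewrite ih; [by rewrite exprS; ring | exact: ltnW | by rewrite addSnnS].
Qed.

(* Newton's identities: they force the correction term of [psiStar]. *)
Lemma newton_en : prY n (psiStar phi) (en 1 * en n.-1) = 0.
Proof.
have nE : n.-1 = n.-2.+1 by case: (n) n1 => [|[]].
have nE' : n = n.-2.+2 by case: (n) n1 => [|[]].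
rewrite nE (prY_eqr _ (F' := Ew 1 n.-1 + Ew 2 n.-2)); last first.
  by move=> z hz _; rewrite -[en 1]/(ydelta [:: 1%N]) en_mul // nE.
rewrite (linearD (prY n (psiStar phi))) /= (@prY_Ew n.-2 2%N) //.
rewrite (prY_eqr _ (F' := n%:R *: en n)); last first.
  by move=> z hz _; rewrite Ew1 // staZ nE -nE'.
rewrite linearZ /= prY_delta ?posw_ones ?sumn_ones //.
rewrite (psiStarE phi n1) ?sumn_ones // -[pE phi 0 _]/(UY phi (ones n)) UY_phi_ones add0r eqxx mulr1.
rewrite /cst nE exprS; have n0 : n%:R != 0 :> rat by rewrite pnatr_eq0; lia.
by field.
Qed.

(** The stuffle of y_1 with y_1^i is (i + 1) y_1^{i+1} plus words with one letter y_2, which are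
    negligible. *)
Lemma en_divided i : negl ((i.+1)%:R *: en i.+1 - en 1 * en i).
Proof.
case: i => [|i].
  by rewrite -[en 0]/(1 : sta) mulr1 scale1r subrr => G _; rewrite mul0r linear0.
have h := negl_Ew i (isT : (1 < 2)%N); move=> G hG.
rewrite (prY_eqr _ (F' := (- Ew 2 i) * G)); last first.
  move=> z hz _; apply: (staM_posw (G := G)) => // y hy.
  rewrite staD staN -[en 1]/(ydelta [:: 1%N]) en_mul // staD Ew1 // staZ staN; ring.
by rewrite mulNr linearN /= h ?oppr0.
Qed.

(** By [en_divided] factors y_1 are moved from the first power to the second, up to nonzero
    integers, until [newton_en] applies. *)
Lemma prY_en_en i j : (0 < i)%N -> (0 < j)%N -> (i + j = n)%N -> prY n (psiStar phi) (en i * en j) = 0.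
Proof.
have red k (G : sta) : G [::] = 0 -> prY n (psiStar phi) (k.+1%:R *: en k.+1 * G) =
    prY n (psiStar phi) (en 1 * en k * G).
  by move=> hG; apply/eqP; rewrite -subr_eq0 -linearB -mulrBl; apply/eqP/en_divided.
have e0 k : (0 < k)%N -> en k [::] = 0 by case: k.
have sc (c : rat) (F : sta) : c != 0 -> prY n (psiStar phi) (c *: F) = 0 -> prY n (psiStar phi) F = 0.
  by move=> hc /eqP; rewrite linearZ /= mulf_eq0 (negbTE hc) => /eqP.
have nz k : k.+1%:R != 0 :> rat by rewrite pnatr_eq0.
elim: i j => // i ih j _ j0 hij; case: i ih hij => [|i] ih hij.
  by rewrite (_ : j = n.-1) ?newton_en //; lia.
apply: (sc i.+2%:R) => //; rewrite scalerAl red ?e0 // -mulrA mulrCA.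
have -> : en 1 * en j = j.+1%:R *: en j.+1 - (j.+1%:R *: en j.+1 - en 1 * en j) by rewrite subKr.
rewrite mulrBr linearB /= [X in _ - X](_ : _ = 0) ?subr0.
  by rewrite -scalerAr linearZ /= ih ?mulr0 //; lia.
by rewrite mulrC; apply: en_divided; rewrite e0.
Qed.

(** A word that is not a power of y_1 is negligible; two powers of y_1 are covered by
    [prY_en_en]. *)
Lemma ann_st : st_primitive (psiStar phi).
Proof.
have hs y : posw y -> sumn y != n -> psiStar phi y = 0.
  move=> hy hn; rewrite /psiStar hphi ?size_iotaY // add0r; case: ifP => // /andP[h1 /eqP h2].
  have e : sumn y = size y by rewrite h2 sumn_ones size_nseq.
  rewrite hphi ?mulr0 // size_iotaY /= ?addn0 -?e //.
  by rewrite andbT e ltnW.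
have s0 : psiStar phi [::] = 0 by rewrite hs // eq_sym -lt0n ltnW.
move=> a b ha hb; have e : deltaStar (psiStar phi) a b =
    prY (sumn a + sumn b) (psiStar phi) (ydelta a * ydelta b).
  rewrite /deltaStar /prY [RHS]big_mkcond; apply: eq_bigr => w _.
  by case: isYword; rewrite ?mul0r // mul1r ydeltaM_count.
rewrite e; have [hn|hn] := eqVneq (sumn a + sumn b)%N n; last first.
  rewrite prYE big_seq big1 => [|y]; last first.
    by rewrite mem_Yw => /andP[hy /eqP sy]; rewrite hs ?mul0r // sy.
  case: eqP => [hb0|_]; case: eqP => [ha0|_]; rewrite ?mul0r ?mul1r ?add0r ?addr0 //.
  - by rewrite ha0 hb0 s0 addr0.
  - by rewrite hs //; rewrite hb0 /= addn0 in hn.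
  - by rewrite hs //; rewrite ha0 /= add0n in hn.
rewrite hn; case: eqP => [hb0|/eqP hb0]; case: eqP => [ha0|/eqP ha0].
- by move: n1; rewrite -hn ha0 hb0.
- by rewrite hb0 ydelta_nil mulr1 prY_delta // ?mul1r ?mul0r ?addr0 // -hn hb0 /= addn0.
- by rewrite ha0 ydelta_nil mul1r prY_delta // ?mul1r ?mul0r ?add0r // -hn ha0.
rewrite !mul0r addr0.
have d0 c : c != [::] -> ydelta c [::] = 0 by rewrite /ydelta eq_sym => /negbTE ->.
have nq c : c != nseq (size c) 1%N -> negl (ydelta c).
  move=> hc; apply: (@negl_ones (size c).+1) => [j|].
    rewrite /ydelta; case: eqP => // e'; case/eqP: hc; rewrite -e' size_nseq //.
  apply/funext => z; have iE (H : sta) j w : iter j (yd 1) H w = H (nseq j 1%N ++ w).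
    elim: j w => // j ihj w; rewrite iterS /yd ihj.
    by congr H; elim: j {ihj} => //= j ->.
  rewrite iE /ydelta; case: eqP => // e'; have := congr1 size e'.
  by rewrite size_cat size_nseq; lia.
have [ca|ca] := eqVneq a (nseq (size a) 1%N); last by apply: nq => //; apply: d0.
have [cb|cb] := eqVneq b (nseq (size b) 1%N); last by rewrite mulrC; apply: nq => //; apply: d0.
rewrite ca cb; apply: prY_en_en; rewrite ?lt0n ?size_eq0 //.
by rewrite -hn ca cb !sumn_ones !size_nseq.
Qed.

Lemma ann_dm0 : dm0 phi.
Proof.
have hl a : phi [:: a] = 0 by apply: hphi; rewrite neq_ltn /= n1.
split; last by split; [exact: ann_sh | exact: ann_st].
split=> //; first exact: homog_ispoly hphi.
(* In weight 2 the coefficient of x0 x1 is the pairing with zeta(2), an element of I. *)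
have [h|h] := eqVneq n 2%N; last by apply: hphi; rewrite eq_sym.
have : pr n phi (pword [:: false; true]) = 0; last by rewrite pr_pword h.
apply: hann; apply: span_gen; right; left; exists (1 : sha); split; first exact: ispoly1.
by move=> w; rewrite mulE mulr1.
Qed.
End Annihilator.

Lemma inI_wpart n (f : sha) : inI f -> inI (wpart n f).
Proof.
apply: (@span_lin _ _ (wpart n : {linear sha -> sha})) => h [[g [p [hg hp /xpolyP ->]]]|[[p [hp /xpolyP ->]]|]].
- apply: inI_inR; apply: inR_wpart; apply: span_gen; by exists g, p; split.
- rewrite /= mulE wpartM; apply: span_sum => i _; have [->|hi] := eqVneq (i : nat) 2%N.
    rewrite (wpart_id (@homog_pword [:: false; true])); apply: span_gen; right; left.
    by exists (wpart (n - 2) p); split=> //; exact: ispoly_wpart.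
  rewrite (_ : wpart i _ = 0 :> sha) ?mul0r; first exact: span0.
  apply/funext => w; rewrite /wpart; case: eqP => // hw; apply: (@homog_pword [:: false; true]).
  by rewrite hw.
case=> a [b [ha hb a0 b0 /xpolyP ->]]; rewrite /= mulE wpartM; apply: span_sum => i _.
by apply: inI_mul; try exact: ispoly_wpart; rewrite /wpart; case: ifP.
Qed.

(** * A family of forms dual to the indecomposables *)

Lemma subspace_rows N (P : 'rV[rat]_N -> Prop) : P 0 ->
  (forall (c : rat) u v, P u -> P v -> P (c *: u + v)) ->
  exists A : 'M[rat]_N, forall v, (v <= A)%MS <-> P v.
Proof.
move=> P0 PD; pose ok k := `[< exists2 A : 'M[rat]_N, \rank A = k & forall v, (v <= A)%MS -> P v >].
have ex : exists k, ok k.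
  by exists 0%N; apply/asboolP; exists 0; rewrite ?mxrank0 // => v; rewrite submx0 => /eqP ->.
have bd k : ok k -> (k <= N)%N by move=> /asboolP[A <- _]; exact: rank_leq_row.
(* A matrix of maximal rank with rows in P works: a vector of P outside its row space would raise
   the rank. *)
case: (ex_maxnP ex bd) => k /asboolP[A rA hA] kmax; exists A => v; split; first exact: hA.
move=> hv; have : ok (\rank (A + v)%MS).
  apply/asboolP; exists (A + v)%MS => // w /sub_addsmxP[[u1 u2] /= ->].
  rewrite addrC -[u2 *m v]scale1r; apply: (PD); last by apply: hA; rewrite submxMl.
  rewrite [u2]mx11_scalar mul_scalar_mx -[_ *: v]addr0; exact: PD.
move/kmax; rewrite -rA => h; have : (A <= A + v)%MS := addsmxSl A v.
by move/mxrank_leqif_sup => /leqifP; case: ifP => [|_]; [rewrite addsmx_sub => /andP[] | rewrite ltnNge h].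
Qed.

(** The forms are the coordinates of a projection along I onto a complement. Indexing them by all
    words of weight n avoids choosing a basis of the quotient. *)
Lemma dual_projection n : exists psi : word -> sha,
  [/\ forall w, homog n (psi w), forall w f, inI f -> pr n (psi w) f = 0 &
   forall a : sha, homog n a -> inI (a - \sum_(w <- allwords n) pr n (psi w) a *: (pword w : sha))].
Proof.
pose ws := allwords n; pose N := size ws; pose x (i : 'I_N) : word := nth [::] ws i.
pose vec (v : 'rV[rat]_N) : sha := \sum_i v 0 i *: (pword (x i) : sha).
pose row (a : sha) : 'rV[rat]_N := \row_i a (x i).
have vecP c u v : vec (c *: u + v) = c *: vec u + vec v.
  by rewrite /vec scaler_sumr -big_split; apply: eq_bigr => i _; rewrite !mxE scalerDl scalerA.
have bigN (V : nmodType) (F : word -> V) : \sum_(w <- allwords n) F w = \sum_i F (x i).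
  by rewrite (big_nth [::]) big_mkord.
have rowK a : homog n a -> vec (row a) = a.
  by move=> ha; rewrite [RHS](homogP ha) bigN; apply: eq_bigr => i _; rewrite mxE.
have [A hA] : exists A : 'M[rat]_N, forall v, (v <= A)%MS <-> inI (vec v).
  apply: subspace_rows => [|c u v hu hv]; last by rewrite vecP; apply: span_closed.
  rewrite (_ : vec 0 = 0); first exact: span0.
  by rewrite /vec big1 // => i _; rewrite mxE scale0r.
pose Pi := proj_mx (A^C)%MS A.
have cap : ((A^C)%MS :&: A = 0)%MS by apply/eqP; rewrite capmxC; apply/eqP/capmx_compl.
have rowx i j : row (pword (x i)) 0 j = (i == j)%:R.
  rewrite mxE /pword /x nth_uniq ?uniq_allwords // [j == i :> nat]eq_sym //.
pose psi (w : word) : sha := fun u => if size u == n then \sum_(j | x j == w) (row (pword u) *m Pi) 0 j else 0.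
have homr u v (c : rat) : row (c *: u + v) = c *: row u + row v by apply/rowP => i; rewrite !mxE.
have prE w a : pr n (psi w) a = \sum_(j | x j == w) (row a *m Pi) 0 j.
  transitivity (\sum_i \sum_(j | x j == w) (a (x i) *: (row (pword (x i)) *m Pi)) 0 j).
    rewrite /pr bigN; apply: eq_bigr => i _; rewrite /psi.
    have -> : size (x i) == n by rewrite -mem_allwords mem_nth.
    by rewrite mulrC mulr_sumr; apply: eq_bigr => j _; rewrite [RHS]mxE.
  rewrite exchange_big; apply: eq_bigr => j _.
  have -> : row a = \sum_i a (x i) *: row (pword (x i)).
    apply/rowP => k; rewrite summxE (bigD1 k) //= !mxE -[pword _ _]/((_ == _)%:R) eqxx mulr1 big1 ?addr0 // => i hik.
    by rewrite mxE rowx (negbTE hik) mulr0.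
  by rewrite mulmx_suml summxE; apply: eq_bigr => i _; rewrite -scalemxAl.
exists psi; split=> [w u hu|w f hf|a ha]; first by rewrite /psi (negbTE hu).
  rewrite prE; have hI : (row f <= A)%MS.
    apply/hA; have -> : vec (row f) = vec (row (wpart n f)).
      apply: eq_bigr => i _; rewrite !mxE /wpart.
      by have -> : size (x i) == n by rewrite -mem_allwords mem_nth.
    by rewrite rowK; [exact: inI_wpart | exact: wpart_homog].
  by rewrite proj_mx_0 // big1 // => j _; rewrite mxE.
have -> : \sum_(w <- allwords n) pr n (psi w) a *: (pword w : sha) = vec (row a *m Pi).
  rewrite bigN; apply: eq_bigr => i _; rewrite prE; congr (_ *: _).
  rewrite (bigD1 i) //= big1 ?addr0 // => j /andP[hj hji]; move: hj.
  by rewrite /x nth_uniq ?uniq_allwords // => /eqP/val_inj e; rewrite e eqxx in hji.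
rewrite -{1}(rowK a ha) addrC -scaleN1r -vecP; apply/hA.
have : (row a <= (A^C)%MS + A)%MS by rewrite addsmxC; apply: submx_full; exact: addsmx_compl_full.
move=> /(add_proj_mx cap); rewrite -/Pi => e.
by rewrite -{2}e scaleN1r addKr proj_mx_sub.
Qed.

(** * The kernel condition *)

Lemma tensP (S T : tens) : (forall a b, S a b = T a b) -> S = T.
Proof. by move=> h; apply/funext => a; apply/funext => b. Qed.

(** Of the two kinds of generators of [kerD], one has its left factor killed by psi, the other keeps
    its right factor in R. *)
Lemma kerD_pr r T psi : dm0 psi -> kerD r T -> inR (fun b => pr r.*2.+1 psi (T ^~ b)).
Proof.
move=> hpsi; elim=> {T} [|c g f hg _ ih|f g _ ih /tensP <-] //.
  rewrite (_ : (fun b => _) = 0); first exact: span0.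
  by apply/funext => b; rewrite /pr big1 // => w _; rewrite mulr0.
rewrite (_ : (fun b => _) = c *: ((fun b => pr r.*2.+1 psi (g ^~ b)) : sha) +
   ((fun b => pr r.*2.+1 psi (f ^~ b)) : sha)); last first.
  apply/funext => b; rewrite shaD shaZ /pr mulr_sumr -big_split; apply: eq_bigr => w _ /=; ring.
have e (k q : sha) : (fun b => pr r.*2.+1 psi ((ptens k q) ^~ b)) = pr r.*2.+1 psi k *: q.
  by apply/funext => b; rewrite shaZ /pr mulr_suml; apply: eq_bigr => w _; rewrite /ptens mulrA.
apply: span_closed => //; case: hg => [[k [q [pk pq hk /tensP ->]]]|[p [rho [pp prho hrho /tensP ->]]]].
  rewrite e (@pr_eqr r.*2.+1 psi k (wpart r.*2.+1 k)) => [|w hw]; last by rewrite /wpart hw eqxx.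
  by rewrite inI_annihil // scale0r; exact: span0.
by rewrite e; apply: spanZ.
Qed.

Lemma tspanD P S T : tspan P S -> tspan P T -> tspan P (fun a b => S a b + T a b).
Proof.
move=> hS hT; elim: hS => [|c g f hg _ ih|f g _ ih e].
- by apply: (tspanE hT) => a b; rewrite add0r.
- by apply: (tspanE (tspanS c hg ih)) => a b; rewrite addrA.
- by apply: (tspanE ih) => a b; rewrite e.
Qed.

(** T is expanded over its left words, finitely many thanks to B. Those outside weight n are in the
    kernel; one of weight n is an element of I plus its projection, and the right factors of the
    projected part are contractions of T. *)
Lemma kerD_intro r B (T : tens) :
  (forall a b, (B < size a)%N || (B < size b)%N -> T a b = 0) -> (r.*2.+1 <= B)%N ->
  (forall psi, homog r.*2.+1 psi -> (forall f, inI f -> pr r.*2.+1 psi f = 0) ->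
     inR (fun b => pr r.*2.+1 psi (T ^~ b))) -> kerD r T.
Proof.
set n := r.*2.+1 => hT nB hpsi; have [psi [h1 h2 h3]] := dual_projection n.
have pT a : ispoly (T a) by exists B.+1 => b hb; rewrite hT // hb orbT.
pose ia (a : word) : sha := (pword a : sha) - \sum_(w <- allwords n) pr n (psi w) (pword a) *: (pword w : sha).
have hi a : homog n (pword a) -> inI (wpart n (ia a)).
  move=> ha; apply: inI_wpart; exact: h3.
have pia a : ispoly (ia a).
  have -> : ia a = (-1) *: (\sum_(w <- allwords n) pr n (psi w) (pword a) *: (pword w : sha)) + (pword a : sha).
    by rewrite scaleN1r addrC.
  apply: ispolyD; last exact: ispoly_pword; apply: ispolyZ.
  by elim/big_ind: _ => [|x y hx hy|w _]; [exact: ispoly0 | exact: ispolyD | apply/ispolyZ/ispoly_pword].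
have hpn a : size a = n -> homog n (pword a) by move=> <-; exact: homog_pword.
pose rho w : sha := fun b => pr n (psi w) (T ^~ b).
have prho w : ispoly (rho w).
  exists B.+1 => b hb; rewrite /rho /pr big1 // => a _; rewrite hT ?mulr0 //.
  by rewrite hb orbT.
have gen1 u : size u != n -> kerD r (ptens (pword u) (T u)).
  move=> hu; apply: (tspanE (tspanS 1 _ (tspan0 _))) => [|a b]; last first.
    by rewrite mul1r addr0.
  left; exists (pword u), (T u); split=> //; first exact: ispoly_pword.
  rewrite (_ : wpart _ _ = 0); first exact: span0.
  apply/funext => w; rewrite /wpart; case: eqP => // hw; apply: homog_pword.
  by rewrite hw eq_sym.
have gen2 u : size u == n -> kerD r (ptens (ia u) (T u)).
  move=> /eqP hu; apply: (tspanE (tspanS 1 _ (tspan0 _))) => [|a b]; last first.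
    by rewrite mul1r addr0.
  by left; exists (ia u), (T u); split=> //; apply/hi/hpn.
have gen3 w : kerD r (ptens (pword w) (rho w)).
  apply: (tspanE (tspanS 1 _ (tspan0 _))) => [|a b]; last by rewrite mul1r addr0.
  right; exists (pword w), (rho w); split=> //; first exact: ispoly_pword.
  by apply: hpsi; [exact: h1 | exact: h2].
have bigk (I : eqType) (s : seq I) (F : I -> tens) (Q : pred I) : (forall i, i \in s -> Q i -> kerD r (F i)) ->
    kerD r (fun a b => \sum_(i <- s | Q i) F i a b).
  elim: s => [|i s ih] h; first by apply: (tspanE (tspan0 _)) => a b; rewrite big_nil.
  have {}ih : kerD r (fun a b => \sum_(j <- s | Q j) F j a b).
    by apply: ih => j hj; apply: h; rewrite inE hj orbT.
  case hq: (Q i); last by apply: (tspanE ih) => a b; rewrite big_cons hq.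
  apply: (tspanE (tspanD (h i (mem_head _ _) hq) ih)) => a b; by rewrite big_cons hq.
have k1 : kerD r (fun a b => \sum_(k <- iota 0 B.+1 | k != n) \sum_(u <- allwords k) ptens (pword u) (T u) a b).
  apply: (bigk _ (iota 0 B.+1)) => k _ kn; apply: (bigk _ (allwords k) (fun u => ptens (pword u) (T u)) xpredT) => u.
  by rewrite mem_allwords => /eqP hu _; apply: gen1; rewrite hu.
have k2 : kerD r (fun a b => \sum_(u <- allwords n) ptens (ia u) (T u) a b).
  apply: bigk => u; rewrite mem_allwords => hu _; exact: gen2.
have k3 : kerD r (fun a b => \sum_(w <- allwords n) ptens (pword w) (rho w) a b).
  by apply: bigk => u _ _.
apply: (tspanE (tspanD k1 (tspanD k2 k3))) => a b.
have -> : \sum_(w <- allwords n) ptens (pword w) (rho w) a b =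
    \sum_(u <- allwords n) (\sum_(w <- allwords n) pr n (psi w) (pword u) *: (pword w : sha)) a * T u b.
  rewrite /ptens /rho; under [RHS]eq_bigr do rewrite sha_sum mulr_suml.
  rewrite [RHS]exchange_big; apply: eq_bigr => w _; rewrite {1}/pr mulr_sumr.
  apply: eq_big_allwords => u hu; rewrite shaZ pr_pword hu eqxx; ring.
have -> : \sum_(u <- allwords n) ptens (ia u) (T u) a b +
    \sum_(u <- allwords n) (\sum_(w <- allwords n) pr n (psi w) (pword u) *: (pword w : sha)) a * T u b =
    \sum_(u <- allwords n) ptens (pword u) (T u) a b.
  by rewrite -big_split; apply: eq_bigr => u _; rewrite /ptens /ia shaD shaN /=; ring.
have inn : n \in iota 0 B.+1 by rewrite mem_iota.
rewrite addrC -(bigD1_seq n inn (iota_uniq _ _) (F := fun k => \sum_(u <- allwords k) ptens (pword u) (T u) a b)).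
have e k : \sum_(u <- allwords k) ptens (pword u) (T u) a b = if size a == k then T a b else 0.
  by rewrite -(big_allwords_delta k a (fun u => T u b)); apply: eq_bigr => u _; rewrite /ptens /pword mulrC eq_sym.
rewrite (eq_bigr _ (fun k _ => e k)); have [ha|ha] := leqP (size a) B; last first.
  by rewrite hT ?ha // big1 // => k _; case: ifP.
rewrite (bigD1_seq (size a)) ?iota_uniq ?mem_iota //= eqxx big1 ?addr0 // => k.
by rewrite eq_sym => /negbTE ->.
Qed.

Lemma Ipiece_size a f b c g : Ipiece a f b = Some (c, g) -> size g = size f.
Proof.
rewrite /Ipiece; case: eqP => _; first by case: f => // -[_ <-].
by case: a => -[_ <-]; rewrite ?size_rev.
Qed.
Lemma gleft_homog ps : homog (sumn [seq size p.1.2 | p <- ps]) (gleft ps).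
Proof.
elim: ps => [|[[a f] b] ps ih]; first exact: (@homog_pword [::]).
rewrite /=; case e: (Ipiece a f b) => [[c g]|]; last by [].
rewrite pscaleE mulE; apply: homogZ; apply: homogM => //.
by rewrite -(Ipiece_size e); exact: homog_pword.
Qed.
Lemma gpieces_size a acc w m :
  (sumn [seq size p.1.2 | p <- gpieces a acc w m] <= size acc + size w)%N.
Proof.
elim: w a acc m => [|x w ih] a acc m; first by rewrite /= addn0.
case: m => [|[] m] /=; first by rewrite addn0 leq_addr.
  by rewrite leq_add2l; apply: leq_trans (ih _ _ _) _; rewrite add0n.
by apply: leq_trans (ih _ _ _) _; rewrite size_rcons addSnnS.
Qed.
Lemma gon_big w a b : (size w < size a)%N || (size w < size b)%N -> gon w a b = 0.
Proof.
move=> h; rewrite /gon big_seq big1 // => m; rewrite mem_allwords => hm.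
case/orP: h => h.
  rewrite gleft_homog ?mulr0 // neq_ltn; apply/orP; right.
  by apply: leq_ltn_trans (gpieces_size _ _ _ _) _.
case: eqP => [e|_]; last by rewrite mul0r.
have := size_maskC (eqP hm); rewrite e => h'; move: h; rewrite -h'.
by rewrite ltnNge leq_addr.
Qed.
Lemma Tf_big N f a b : homog N f -> (0 < N)%N -> (N < size a)%N || (N < size b)%N -> Tf N f a b = 0.
Proof.
move=> hf N0 h; rewrite /Tf big_seq big1 ?sub0r => [|w]; last first.
  by rewrite mem_allwords => /eqP hw; rewrite gon_big ?mulr0 // hw.
case/orP: h => h; last by rewrite hf ?mulr0 ?oppr0 // neq_ltn h orbT.
by case: eqP h => [->|_] //; rewrite mul0r oppr0.
Qed.

(** * Truncated harmonic sums *)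

(* [cw w n] is the n-th Taylor coefficient of the multiple polylogarithm attached to w, so
   [Hs n w] is a truncated multiple zeta value. *)
Fixpoint cw (w : word) (n : nat) : rat :=
  match w with
  | [::] => (n == 0)%:R
  | false :: w' => cw w' n / n%:R
  | true :: w' => (\sum_(m < n) cw w' m) / n%:R
  end.
Definition Hs n : sha := fun w => \sum_(m < n) cw w m.
Definition cs n : sha := fun w => cw w n.

(** Sum over n > m_1 > m_2 > ...; the index 0 contributes nothing for positive exponents because the
    inverse of 0 is 0. *)
Fixpoint hY (y : seq nat) (n : nat) : rat :=
  if y is k :: y' then \sum_(m < n) hY y' m / m%:R ^+ k else 1.

Lemma hYS k y n : hY (k :: y) n.+1 = hY (k :: y) n + hY y n / n%:R ^+ k.
Proof. by rewrite /= big_ord_recr. Qed.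

(** Both sides grow equally from n to n + 1: the new largest index belongs to the first word, to the
    second, or to both. *)
Lemma hY_stuffle a b n : \sum_(c <- stuffle a b) hY c n = hY a n * hY b n.
Proof.
elim: a b n => [|i a iha] b n; first by rewrite big_seq1 mul1r.
elim: b n => [|j b ihb] n; first by rewrite big_seq1 mulr1.
rewrite [stuffle _ _]/= !big_cat !big_map.
have e k s (F : nat -> rat) : (forall m, \sum_(c <- s) hY c m = F m) ->
    \sum_(c <- s) hY (k :: c) n = \sum_(m < n) F m / m%:R ^+ k.
  by move=> h /=; rewrite exchange_big; apply: eq_bigr => m _; rewrite -mulr_suml h.
rewrite (e _ _ _ (iha (j :: b))) (e _ _ _ (iha b)) (e _ _ (fun m => hY (i :: a) m * hY b m)); last first.
  exact: ihb.
elim: n {iha ihb e} => [|n ih]; first by rewrite /= !big_ord0 !addr0 mul0r.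
rewrite !hYS !big_ord_recr /= -!/(hY (_ :: _) n) mulrDl !mulrDr -ih exprD invfM /=; ring.
Qed.

Lemma cw_letter k w m : cw (nseq k false ++ true :: w) m = Hs m w / m%:R ^+ k.+1.
Proof.
elim: k => [|k ih]; first by rewrite expr1.
by rewrite /= ih [in RHS]exprSr invfM mulrA.
Qed.
Lemma Hs_iotaY y n : posw y -> (0 < n)%N -> Hs n (iotaY y) = hY y n.
Proof.
elim: y n => [|[|k] y ih] n // hy n0.
  by rewrite /Hs; case: n n0 => // n _; rewrite big_ord_recl big1 ?addr0.
rewrite iotaY_cons /Hs /=; apply: eq_bigr => -[[|m] hm] _; rewrite cw_letter /=.
  by rewrite exprS mul0r invr0 !mulr0.
by rewrite ih.
Qed.

Lemma pr_Hs_pstuffle N n (u v : sha) : (0 < n)%N -> yend_poly u -> yend_poly v ->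
  pr N (Hs n) (pstuffle u v) = \sum_(i < N.+1) pr i (Hs n) u * pr (N - i) (Hs n) v.
Proof.
move=> n0 yu yv; transitivity (\sum_(i < N.+1) \sum_(a <- allwords i) \sum_(b <- allwords (N - i))
   \sum_(w <- allwords N) Hs n w * (u a * v b * stcoef a b w)).
  rewrite /pr; transitivity (\sum_(w <- allwords N) \sum_(i < N.+1) \sum_(a <- allwords i)
     \sum_(b <- allwords (N - i)) Hs n w * (u a * v b * stcoef a b w)).
    apply: eq_big_allwords => w hw; rewrite /pstuffle hw mulr_sumr; apply: eq_bigr => i _.
    by rewrite mulr_sumr; apply: eq_bigr => a _; rewrite mulr_sumr.
  rewrite exchange_big; apply: eq_bigr => i _; rewrite exchange_big; apply: eq_bigr => a _.
  by rewrite exchange_big.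
apply: eq_bigr => i _; rewrite /pr mulr_suml; apply: eq_big_allwords => a ha.
rewrite mulr_sumr; apply: eq_big_allwords => b hb.
have [ya|ya] := boolP (isYword a); last first.
  rewrite big1 => [|w _]; last by rewrite /stcoef (negbTE ya) !mulr0.
  by rewrite (_ : u a = 0) ?(mulr0, mul0r) //; apply/eqP/negP => /negP /yu; rewrite (negbTE ya).
have [yb|yb] := boolP (isYword b); last first.
  rewrite big1 => [|w _]; last by rewrite /stcoef (negbTE yb) andbF !mulr0.
  by rewrite (_ : v b = 0) ?(mulr0, mul0r) //; apply/eqP/negP => /negP /yv; rewrite (negbTE yb).
transitivity (u a * v b * \sum_(c <- stuffle (toY a) (toY b)) Hs n (iotaY c)).
  transitivity (u a * v b * \sum_(c <- stuffle (toY a) (toY b)) \sum_(w <- allwords N) Hs n w * (w == iotaY c)%:R).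
    rewrite exchange_big mulr_sumr; apply: eq_bigr => w _; rewrite /stcoef ya yb /= -mulr_sumr.
    rewrite mulrCA; congr (_ * (_ * _)); rewrite count_map -sum1_count natr_sum big_mkcond.
    by apply: eq_bigr => c _ /=; rewrite eq_sym; case: eqP.
  congr (_ * _); rewrite big_seq [RHS]big_seq; apply: eq_bigr => c hc.
  have pc : posw c := stuffle_pos (posw_toY a) (posw_toY b) hc.
  have : (ydelta (toY a) * ydelta (toY b)) c != 0.
    by rewrite ydeltaM_stuffle ?posw_toY // pnatr_eq0 -lt0n -has_count has_pred1.
  rewrite ydeltaM_count pnatr_eq0 -lt0n -has_count has_pred1 => /(dStar_pos pc)[_ _ /= hs].
  rewrite big_allwords_delta size_iotaY // -hs !sumn_toY // ha hb subnKC ?eqxx // -ltnS.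
  exact: ltn_ord.
have -> : \sum_(c <- stuffle (toY a) (toY b)) Hs n (iotaY c) = \sum_(c <- stuffle (toY a) (toY b)) hY c n.
  rewrite big_seq [RHS]big_seq; apply: eq_bigr => c hc; apply: Hs_iotaY => //.
  exact: stuffle_pos (posw_toY a) (posw_toY b) hc.
by rewrite hY_stuffle -!Hs_iotaY ?posw_toY // !toYK //; ring.
Qed.

(** Division by 0 gives 0, so nonempty words have constant Taylor coefficient 0. *)
Lemma cs0 N f : pr N (cs 0) f = (N == 0)%:R * f [::].
Proof.
case: N => [|N]; first by rewrite pr0.
rewrite mul0r /pr big_seq big1 // => -[|[] w]; rewrite mem_allwords //= => _.
  by rewrite /cs /= big_ord0 !mul0r.
by rewrite /cs /= invr0 mulr0 mul0r.
Qed.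
Lemma pr0_cs n f : pr 0 (cs n) f = (n == 0)%:R * f [::]. Proof. exact: pr0. Qed.
Lemma csS N n f : n%:R * pr N.+1 (cs n) f =
  (0 < n)%:R * (pr N (cs n) (lder false f) + \sum_(m < n) pr N (cs m) (lder true f)).
Proof.
case: n => [|n]; first by rewrite !mul0r.
have nz : n.+1%:R != 0 :> rat by rewrite pnatr_eq0.
rewrite mul1r prS mulrDr; congr (_ + _).
  rewrite /pr mulr_sumr; apply: eq_bigr => w _; rewrite {1}/lder /cs [cw _ _]/=.
  by rewrite mulrA mulrCA divff // mulr1.
rewrite /pr mulr_sumr exchange_big; apply: eq_bigr => w _; rewrite {1}/lder /cs [cw _ _]/=.
by rewrite mulrA mulrCA divff // mulr1 mulr_suml.
Qed.

(** * Shuffle products of Taylor coefficients *)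

Definition cauchy (a b : nat -> rat) n := \sum_(k < n.+1) a k * b (n - k)%N.
(** Coefficients of t / (1 - t) times the power series of [a]. *)
Definition psum (a : nat -> rat) n := \sum_(m < n) a m.
Lemma cauchyC a b n : cauchy a b n = cauchy b a n.
Proof.
rewrite /cauchy (reindex_inj rev_ord_inj); apply: eq_bigr => k _ /=.
by rewrite subSS subKn 1?mulrC // -ltnS.
Qed.
Lemma psum0 a : psum a 0 = 0. Proof. exact: big_ord0. Qed.
Lemma psumS a n : psum a n.+1 = psum a n + a n. Proof. exact: big_ord_recr. Qed.
Lemma cauchy_psum a b n : cauchy (psum a) b n = psum (cauchy a b) n.
Proof.
elim: n => [|n ih]; first by rewrite psum0 /cauchy big_ord1 psum0 mul0r.
rewrite psumS -ih /cauchy big_ord_recl psum0 mul0r add0r -big_split; apply: eq_bigr => k _ /=.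
by rewrite /bump add1n subSS psumS mulrDl.
Qed.
Lemma cauchyD a a' b n : cauchy (fun k => a k + a' k) b n = cauchy a b n + cauchy a' b n.
Proof. by rewrite /cauchy -big_split; apply: eq_bigr => k _; rewrite mulrDl. Qed.

Lemma homog_lder N a f : homog N.+1 f -> homog N (lder a f).
Proof. by move=> h w hw; apply: h. Qed.

(** Multiplication by n is t d/dt, which strips a leading x0 and replaces a leading x1 by the factor
    t / (1 - t); both sides satisfy the same differential equation. A trailing x0 would call for
    logarithms, hence the restriction to words ending in x1. *)
Lemma cs_shuffle i j (f g : sha) n : homog i f -> homog j g -> yend_poly f -> yend_poly g ->
  pr (i + j) (cs n) (f * g) = cauchy (fun k => pr i (cs k) f) (fun k => pr j (cs k) g) n.
Proof.
elim: (i + j)%N {-2}i {-2}j (erefl (i + j)%N) f g n => [|N ih] {}i {}j hN f g n hf hg yf yg.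
  have [-> ->] : i = 0%N /\ j = 0%N by lia.
  rewrite add0n [LHS]pr0_cs sha_nil /cauchy big_ord_recl /= !pr0_cs subn0 mul1r big1 ?addr0 => [|k _].
    by rewrite mulrCA.
  by rewrite pr0_cs mul0r mul0r.
have [i0|i0] := posnP i.
  move: hf; rewrite i0 => /homog0P ->; rewrite -scalerAl mul1r linearZ /= /cauchy big_ord_recl.
  rewrite pr0_cs subn0 big1 ?addr0 => [|k _]; last by rewrite pr0_cs !mul0r.
  by rewrite mul1r -[1 : sha]/(sh1) shaZ mulr1; congr (_ * pr _ _ _); lia.
have [j0|j0] := posnP j.
  move: hg; rewrite j0 => /homog0P ->; rewrite -scalerAr mulr1 linearZ /= cauchyC /cauchy big_ord_recl.
  rewrite pr0_cs subn0 big1 ?addr0 => [|k _]; last by rewrite pr0_cs !mul0r.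
  by rewrite mul1r shaZ mulr1; congr (_ * pr _ _ _); lia.
have [n0|n0] := posnP n.
  rewrite n0 cs0 hN mul0r /cauchy big_ord1 cs0 (_ : (i == 0)%N = false) ?mul0r //; lia.
have nz : n%:R != 0 :> rat by rewrite pnatr_eq0 -lt0n.
apply: (mulfI nz); rewrite hN csS n0 mul1r !lderM.
have th k (h : sha) l : (0 < l)%N -> yend_poly h -> k%:R * pr l (cs k) h =
    pr l.-1 (cs k) (lder false h) + psum (fun m => pr l.-1 (cs m) (lder true h)) k.
  case: l => // l _ yh; rewrite csS; case: k => [|k]; rewrite ?mul1r //= mul0r.
  rewrite cs0 /psum big_ord0 addr0 /lder; have /yend_polyP := yh => /(_ [::]) /= ->.
  by rewrite mulr0.
have hi : (i.-1 + j = N)%N by lia.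
have hj : (i + j.-1 = N)%N by lia.
have [hf' hg'] : homog i.-1.+1 f /\ homog j.-1.+1 g by rewrite !prednK.
have eN a m : pr N (cs m) (lder a f * g + f * lder a g) =
   cauchy (fun k => pr i.-1 (cs k) (lder a f)) (fun k => pr j (cs k) g) m +
   cauchy (fun k => pr j.-1 (cs k) (lder a g)) (fun k => pr i (cs k) f) m.
  rewrite linearD /= -{1}hi (ih _ _ hi) //; last exact: lder_yend; last exact: homog_lder.
  by rewrite -hj (ih _ _ hj) //; [rewrite [X in _ + X]cauchyC | exact: homog_lder | exact: lder_yend].
have -> : \sum_(m < n) pr N (cs m) (lder true f * g + f * lder true g) =
   psum (cauchy (fun k => pr i.-1 (cs k) (lder true f)) (fun k => pr j (cs k) g)) n +
   psum (cauchy (fun k => pr j.-1 (cs k) (lder true g)) (fun k => pr i (cs k) f)) n.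
  by rewrite /psum -big_split; apply: eq_bigr => m _; exact: eN.
rewrite eN -!cauchy_psum addrACA -!cauchyD /cauchy mulr_sumr [X in _ + X](reindex_inj rev_ord_inj) -big_split.
apply: eq_bigr => k _ /=; have hk : (k <= n)%N by rewrite -ltnS.
rewrite subSS subKn // -!th // (_ : n%:R = k%:R + (n - k)%:R :> rat); last by rewrite -natrD subnKC.
by ring.
Qed.

(** The summand 1 keeps [ell] at least 1, so that higher powers dominate lower ones. *)
Definition ell (n : nat) : rat := 1 + \sum_(m < n) m%:R^-1.
Lemma ell_cat m k : ell (m + k) = ell m + \sum_(l < k) (m + l)%:R^-1.
Proof. by rewrite /ell big_split_ord addrA. Qed.
Lemma ell_mono m n : (m <= n)%N -> ell m <= ell n.
Proof.
by move=> h; rewrite -(subnKC h) ell_cat lerDl; apply: sumr_ge0 => l _; rewrite invr_ge0.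
Qed.
Lemma ell_ge1 n : 1 <= ell n.
Proof. by rewrite lerDl; apply: sumr_ge0 => l _; rewrite invr_ge0. Qed.
Lemma ell_ge0 n : 0 <= ell n. Proof. exact: le_trans (ell_ge1 n). Qed.
Lemma ellX_mono m n i j : (m <= n)%N -> (i <= j)%N -> ell m ^+ i <= ell n ^+ j.
Proof.
move=> hm hi; apply: (le_trans (y := ell n ^+ i)).
  by rewrite lerXn2r // ?nnegrE ?ell_ge0 ?ell_mono.
by rewrite ler_weXn2l ?ell_ge1.
Qed.

Lemma cw_ge0 w k : 0 <= cw w k.
Proof.
elim: w k => [|[] w ih] k /=; first by rewrite ler0n.
  by rewrite mulr_ge0 ?invr_ge0 //; apply: sumr_ge0.
by rewrite mulr_ge0 ?invr_ge0.
Qed.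
Lemma invn_le1 k : (k%:R : rat)^-1 <= 1.
Proof. by case: k => [|k]; rewrite ?invr0 // invf_le1 ?ltr0Sn // ler1n. Qed.

Lemma cw_bound w k : w != [::] -> cw w k <= ell k ^+ size w / k%:R.
Proof.
elim: w k => [|a w ih] // k _; case: (eqVneq w [::]) => [->|w0].
  case: a => /=; rewrite ler_pM ?invr_ge0 ?expr1 //; last first.
  - by case: k => [|k]; rewrite ?mulr0 //= ?invr0 ?mul0r ?ell_ge0 // /ell big_ord0 addr0.
  - apply: le_trans (ell_ge1 k); case: k => [|k]; first by rewrite big_ord0.
    by rewrite big_ord_recl big1 ?addr0.
  by apply: sumr_ge0 => m _; rewrite ler0n.
rewrite [size _]/=; case: a => /=.
  rewrite ler_pM ?invr_ge0 //; first by apply: sumr_ge0 => m _; exact: cw_ge0.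
  apply: (le_trans (y := \sum_(m < k) ell k ^+ size w * m%:R^-1)).
    apply: ler_sum => m _; apply: le_trans (ih _ w0) _; rewrite ler_wpM2r ?invr_ge0 //.
    by apply: ellX_mono => //; apply: ltnW.
  rewrite -mulr_sumr exprSr ler_wpM2l ?exprn_ge0 ?ell_ge0 //.
  by rewrite /ell lerDr.
rewrite -[X in _ <= X]mulr1 ler_pM ?cw_ge0 ?invr_ge0 ?invn_le1 //.
apply: le_trans (ih _ w0) _; rewrite ler_wpM2r ?invr_ge0 //.
by apply: ellX_mono.
Qed.

(** A leading x0 gains a second factor 1/k, the decay needed of the convergent factor in
    [Hs_shuffle]. *)
Lemma cw_bound2 w k : w != [::] -> cw (false :: w) k <= ell k ^+ (size w).+1 / k%:R ^+ 2.
Proof.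
move=> w0 /=; rewrite expr2 invfM mulrA ler_wpM2r ?invr_ge0 //.
apply: le_trans (cw_bound k w0) _; rewrite ler_wpM2r ?invr_ge0 //.
by apply: ellX_mono.
Qed.

Definition norm1 i (f : sha) : rat := \sum_(w <- allwords i) `|f w|.
Lemma norm1_ge0 i f : 0 <= norm1 i f. Proof. by apply: sumr_ge0. Qed.

Lemma pr_bound i (phi f : sha) B : (forall w, size w = i -> f w != 0 -> `|phi w| <= B) ->
  `|pr i phi f| <= norm1 i f * B.
Proof.
move=> h; rewrite /pr /norm1 mulr_suml; apply: le_trans (ler_norm_sum _ _ _) _.
rewrite big_seq [leRHS]big_seq; apply: ler_sum => w; rewrite mem_allwords => /eqP hw.
rewrite normrM mulrC; have [->|f0] := eqVneq (f w) 0; first by rewrite normr0 !mul0r.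
by rewrite ler_wpM2l // h.
Qed.

Lemma cs_bound i k f : (0 < i)%N -> `|pr i (cs k) f| <= norm1 i f * (ell k ^+ i / k%:R).
Proof.
move=> i0; apply: pr_bound => w hw _; rewrite ger0_norm ?cw_ge0 //.
by rewrite -hw; apply: cw_bound; rewrite -size_eq0 hw -lt0n.
Qed.
Lemma cs_bound2 i k f : (0 < i)%N -> conv_poly f ->
  `|pr i (cs k) f| <= norm1 i f * (ell k ^+ i / k%:R ^+ 2).
Proof.
move=> i0 cf; apply: pr_bound => w hw /cf; rewrite ger0_norm ?cw_ge0 //.
rewrite -size_eq0 hw eqn0Ngt i0 /=; case: w hw => [|[] w] //= hw hl.
by rewrite -hw; apply: cw_bound2; case: w hw hl.
Qed.

(* Errors of order (log n)^K / n, with the rational [ell] in place of the logarithm. *)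
Definition logb (u : nat -> rat) := exists C K, 0 <= C /\ forall n, (0 < n)%N -> `|u n| <= C * ell n ^+ K.
Definition small (u : nat -> rat) := exists C K, 0 <= C /\ forall n, (0 < n)%N -> `|u n| <= C * ell n ^+ K / n%:R.

Lemma smallD u v : small u -> small v -> small (fun n => u n + v n).
Proof.
move=> [C [K [C0 hu]]] [C' [K' [C0' hv]]]; exists (C + C'), (K + K')%N; split; first exact: addr_ge0.
move=> n n0; apply: le_trans (ler_normD _ _) _; rewrite !mulrDl lerD //.
  by apply: le_trans (hu n n0) _; rewrite ler_wpM2r ?invr_ge0 // ler_wpM2l // ellX_mono // leq_addr.
by apply: le_trans (hv n n0) _; rewrite ler_wpM2r ?invr_ge0 // ler_wpM2l // ellX_mono // leq_addl.
Qed.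
Lemma small0 : small (fun _ => 0).
Proof. by exists 0, 0%N; split=> // n _; rewrite normr0 !mul0r. Qed.
Lemma smallM u v : small u -> logb v -> small (fun n => u n * v n).
Proof.
move=> [C [K [C0 hu]]] [C' [K' [C0' hv]]]; exists (C * C'), (K + K')%N; split; first exact: mulr_ge0.
move=> n n0; rewrite normrM; apply: (le_trans (y := C * ell n ^+ K / n%:R * (C' * ell n ^+ K'))).
  by rewrite ler_pM // ?hu ?hv.
by rewrite exprD le_eqVlt; apply/orP; left; apply/eqP; ring.
Qed.
Lemma logb_cst c : logb (fun _ => c).
Proof. by exists `|c|, 0%N; split=> // n _; rewrite mulr1. Qed.
Lemma small_ext u v : (forall n, (0 < n)%N -> u n = v n) -> small u -> small v.
Proof. by move=> h [C [K [C0 hu]]]; exists C, K; split=> // n n0; rewrite -h // hu. Qed.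
Lemma smallN u : small u -> small (fun n => - u n).
Proof. by move=> [C [K [C0 hu]]]; exists C, K; split=> // n n0; rewrite normrN hu. Qed.
Lemma small_sum (I : Type) (s : seq I) (P : pred I) (u : I -> nat -> rat) :
  (forall i, P i -> small (u i)) -> small (fun n => \sum_(i <- s | P i) u i n).
Proof.
move=> h; elim: s => [|i s ih].
  by apply: (small_ext _ small0) => n _; rewrite big_nil.
case hP: (P i).
  by apply: (small_ext _ (smallD (h i hP) ih)) => n _; rewrite big_cons hP.
by apply: (small_ext _ ih) => n _; rewrite big_cons hP.
Qed.

Lemma Hs_psum i n f : pr i (Hs n) f = psum (fun k => pr i (cs k) f) n.
Proof.
rewrite /psum /pr exchange_big; apply: eq_bigr => w _; rewrite -mulr_suml; by [].
Qed.

Lemma logb_Hs i f : logb (fun n => pr i (Hs n) f).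
Proof.
exists (norm1 i f), i.+1; split; first exact: norm1_ge0.
move=> n n0; apply: pr_bound => w hw _; rewrite ger0_norm; last by apply: sumr_ge0 => m _; exact: cw_ge0.
case: (eqVneq w [::]) => [e|w0].
  rewrite e /Hs; case: n n0 => // n _; rewrite big_ord_recl big1 ?addr0 //=.
  by rewrite -hw e expr1 ell_ge1.
apply: (le_trans (y := \sum_(m < n) ell n ^+ i * m%:R^-1)).
  apply: ler_sum => m _; apply: le_trans (cw_bound _ w0) _; rewrite hw ler_wpM2r ?invr_ge0 //.
  by apply: ellX_mono => //; apply: ltnW.
by rewrite -mulr_sumr exprSr ler_wpM2l ?exprn_ge0 ?ell_ge0 // /ell lerDr.
Qed.

(** For m = n - k + l one has n <= k + m, hence n / (k^2 m) <= 1/k^2 + 1/(k m); summing over l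
    bounds each part by [ell n] / k. *)
Lemma tail_bound k n : (0 < k)%N -> (k < n)%N ->
  (k%:R ^+ 2)^-1 * \sum_(l < k) (n - k + l)%:R^-1 <= 2 * ell n / k%:R / n%:R :> rat.
Proof.
move=> k0 kn; have n0 : (0 < n)%N by lia.
have kr : (k%:R : rat) != 0 by rewrite pnatr_eq0 -lt0n.
rewrite ler_pdivlMr ?ltr0n // mulrAC mulr_sumr.
apply: (le_trans (y := \sum_(l < k) ((k%:R ^+ 2)^-1 + k%:R^-1 * (n - k + l)%:R^-1))).
  apply: ler_sum => l _; set m := (n - k + l)%N; have m0 : (0 < m)%N by rewrite /m; lia.
  have mr : (m%:R : rat) != 0 by rewrite pnatr_eq0 -lt0n.
  have -> : (k%:R ^+ 2)^-1 + k%:R^-1 * m%:R^-1 = (k%:R ^+ 2)^-1 * (k + m)%:R * m%:R^-1 :> rat.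
    by rewrite natrD; field; rewrite kr mr.
  rewrite ler_wpM2r ?invr_ge0 // ler_wpM2l ?invr_ge0 ?exprn_ge0 //.
  by rewrite ler_nat /m; lia.
rewrite big_split /= sumr_const card_ord -mulr_sumr.
have h : \sum_(l < k) (n - k + l)%:R^-1 <= ell n.
  by rewrite -{2}(subnK (ltnW kn)) ell_cat lerDr ell_ge0.
have -> : 2 * ell n / k%:R = k%:R^-1 * ell n + k%:R^-1 * ell n by ring.
rewrite lerD //; last by rewrite ler_wpM2l ?invr_ge0.
have -> : (k%:R ^+ 2)^-1 *+ k = k%:R^-1 * 1 :> rat.
  by rewrite -[LHS]mulr_natr; field.
by rewrite ler_wpM2l ?invr_ge0 // ell_ge1.
Qed.

(** The product sums over a square of index pairs, the shuffle over a triangle. The missing pairs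
    (k, n - k + l) with l < k carry a factor 1/k^2 from the convergent f, and [tail_bound]
    applies. *)
Lemma Hs_shuffle i j (f g : sha) : homog i f -> homog j g -> conv_poly f -> yend_poly g ->
  small (fun n => pr (i + j) (Hs n) (f * g) - pr i (Hs n) f * pr j (Hs n) g).
Proof.
move=> hf hg cf yg; have [yf _] := (conv_polyP f).1 cf.
have [i0|i0] := posnP i.
  apply: (small_ext _ small0) => n n0; move: hf; rewrite i0 add0n => /homog0P ->.
  rewrite -scalerAl mul1r !linearZ /= pr0 /Hs; case: n n0 => // n _.
  by rewrite big_ord_recl big1 //= addr0 !mulr1 subrr.
exists (2 * (norm1 i f * norm1 j g)), (i + j + 2)%N; split.
  by rewrite !mulr_ge0 ?norm1_ge0.
move=> n n0; rewrite !Hs_psum; set a := fun k => pr i (cs k) f; set b := fun k => pr j (cs k) g.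
have -> : psum (fun k => pr (i + j) (cs k) (f * g)) n = \sum_(k < n) a k * psum b (n - k).
  transitivity (psum (cauchy b a) n).
    by apply: eq_bigr => k _; rewrite cs_shuffle // cauchyC.
  rewrite -cauchy_psum cauchyC /cauchy big_ord_recr /= subnn psum0 mulr0 addr0; by [].
have -> : psum a n * psum b n = \sum_(k < n) a k * psum b n by rewrite mulr_suml.
rewrite -sumrB; apply: le_trans (ler_norm_sum _ _ _) _.
have e1 : 2 * (norm1 i f * norm1 j g) * ell n ^+ (i + j + 2) / n%:R =
   ell n * (2 * (norm1 i f * norm1 j g) * ell n ^+ (i + j) * ell n / n%:R) by rewrite exprD; ring.
rewrite e1; apply: (le_trans (y := \sum_(k < n) k%:R^-1 *
   (2 * (norm1 i f * norm1 j g) * ell n ^+ (i + j) * ell n / n%:R))); last first.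
  rewrite -mulr_suml ler_wpM2r // ?lerDr //.
  by rewrite !mulr_ge0 ?invr_ge0 ?norm1_ge0 ?exprn_ge0 ?ell_ge0.
apply: ler_sum => k _; have kn := ltn_ord k; have [k0|k0] := posnP k.
  by rewrite k0 /a cs0 (_ : (i == 0)%N = false) ?mul0r ?subrr ?normr0 ?invr0 ?mul0r //; lia.
rewrite -mulrBr normrM.
have -> : psum b (n - k) - psum b n = - \sum_(l < k) b (n - k + l)%N.
  have -> : psum b n = psum b (n - k + k) by rewrite subnK // ltnW.
  by rewrite /psum big_split_ord opprD addNKr.
rewrite normrN; apply: (le_trans (y := norm1 i f * (ell n ^+ i / k%:R ^+ 2) *
   \sum_(l < k) norm1 j g * (ell n ^+ j * (n - k + l)%:R^-1))).
  rewrite ler_pM //.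
    apply: le_trans (cs_bound2 k i0 cf) _; rewrite ler_wpM2l ?norm1_ge0 // ler_wpM2r ?invr_ge0 ?exprn_ge0 //.
    by apply: ellX_mono => //; apply: ltnW.
  apply: le_trans (ler_norm_sum _ _ _) _; apply: ler_sum => l _.
  have l0 : (0 < n - k + l)%N by lia.
  have [j0|j0] := posnP j.
    rewrite /b j0 pr0_cs (_ : (_ == 0)%N = false) ?mul0r ?normr0; last by lia.
    by rewrite !mulr_ge0 ?norm1_ge0 ?invr_ge0 ?exprn_ge0 ?ell_ge0.
  apply: le_trans (cs_bound _ _ j0) _; rewrite ler_wpM2l ?norm1_ge0 // ler_wpM2r ?invr_ge0 //.
  by apply: ellX_mono => //; have := ltn_ord l; lia.
rewrite -!mulr_sumr.
have h := tail_bound k0 kn; set S := \sum_(l < k) _ in h *.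
have -> : norm1 i f * (ell n ^+ i / k%:R ^+ 2) * (norm1 j g * (ell n ^+ j * S)) =
  norm1 i f * norm1 j g * ell n ^+ (i + j) * ((k%:R ^+ 2)^-1 * S) by rewrite exprD; ring.
apply: le_trans (ler_wpM2l _ h) _; first by rewrite !mulr_ge0 ?norm1_ge0 ?exprn_ge0 ?ell_ge0.
by rewrite le_eqVlt; apply/orP; left; apply/eqP; ring.
Qed.

(** Each dyadic block of the harmonic series adds at most 1. *)
Lemma ell_pow2 m : ell (2 ^ m) <= m.+1%:R.
Proof.
elim: m => [|m ih]; first by rewrite /ell big_ord1 invr0 addr0.
rewrite expnS mul2n -addnn ell_cat -[m.+2%:R]natr1 lerD //.
apply: (le_trans (y := \sum_(l < 2 ^ m) ((2 ^ m)%:R : rat)^-1)).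
  apply: ler_sum => l _; rewrite lef_pV2 ?posrE ?ltr0n ?addn_gt0 ?expn_gt0 //.
  by rewrite ler_nat leq_addr.
rewrite sumr_const card_ord -[leLHS]mulr_natr mulVf //.
by rewrite pnatr_eq0 -lt0n expn_gt0.
Qed.

(** Doubling m squares 2^m: one factor absorbs the induction bound, with 2^{K+1} accounting for 2m +
    1 <= 2 (m + 1), and the other absorbs the new m + 1. *)
Lemma pow_lt_exp K (C : rat) : 0 <= C -> exists m, C * m.+1%:R ^+ K < (2 ^ m)%:R.
Proof.
elim: K C => [|K ih] C C0.
  have [m hm] : exists m : nat, C < m%:R by exists (Num.bound C); exact: archi_boundP.
  exists m; rewrite mulr1; apply: lt_trans hm _; rewrite ltr_nat; exact: ltn_expl.
have [m hm] := ih (C * 2 ^+ K.+1) (mulr_ge0 C0 (exprn_ge0 _ (ler0n _ 2))).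
exists (m + m)%N; rewrite expnD natrM.
apply: (le_lt_trans (y := C * 2 ^+ K.+1 * m.+1%:R ^+ K * m.+1%:R)).
  rewrite -!mulrA ler_wpM2l // -exprSr -exprMn lerXn2r ?nnegrE ?mulr_ge0 //.
  by rewrite -natrM ler_nat; lia.
apply: (lt_le_trans (y := (2 ^ m)%:R * m.+1%:R)).
  by rewrite ltr_pM2r ?ltr0n.
by rewrite ler_wpM2l // ler_nat; exact: ltn_expl.
Qed.

(** Along n = 2^m the bound is a polynomial in m divided by 2^m. *)
Lemma small_lt1 u : small u -> exists2 n, (1 < n)%N & `|u n| < 1.
Proof.
move=> [C [K [C0 hu]]]; have C0' : 0 <= C + 1 by rewrite addr_ge0.
have [m hm] := pow_lt_exp K C0'; have m0 : (0 < m)%N.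
  rewrite lt0n; apply/eqP => e; move: hm; rewrite e expr1n mulr1 expn0 => h.
  by move: h; rewrite gtrDr ltNge C0.
have p0 : (0 : rat) < (2 ^ m)%:R by rewrite ltr0n expn_gt0.
exists (2 ^ m)%N; first by case: m m0 {hm p0} => // m _; rewrite expnS; have := expn_gt0 2 m; lia.
apply: le_lt_trans (hu _ _) _; first by rewrite expn_gt0.
rewrite ltr_pdivrMr // mul1r; apply: le_lt_trans hm.
rewrite ler_pM ?exprn_ge0 ?ell_ge0 ?lerDl // lerXn2r ?nnegrE ?ell_ge0 //.
exact: ell_pow2.
Qed.

(** * Shuffle regularization *)

(** Common pattern of two regularizations: [d] strips a fixed letter at one end of words, and [e k]
    is the k-th power of that letter, that is, the divided shuffle power of [e 1]. *)
Record regularizing (d : {linear sha -> sha}) (e : nat -> sha) : Prop := Regularizing {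
  rg_deriv : derivation d;
  rg_homog : forall N f, homog N.+1 f -> homog N (d f);
  rg_bound : forall B (f : sha), (forall w, (B <= size w)%N -> f w = 0) ->
    forall w, (B.-1 <= size w)%N -> d f w = 0;
  rg_e0 : e 0 = 1;
  rg_d1 : d 1 = 0;
  rg_dS : forall k, d (e k.+1) = e k;
  rg_e_homog : forall k, homog k (e k);
  rg_eS : forall k, k.+1%:R *: e k.+1 = e 1 * e k }.

Section Regularization.
Variables (d : {linear sha -> sha}) (e : nat -> sha).

(** Formally exp(- e_1 d) applied to f: it sets e_1 to 0 in f viewed as a polynomial in e_1 over the
    kernel of d. *)
Definition reg N (f : sha) : sha := \sum_(k < N.+1) (-1) ^+ k *: (e k * iter k d f).

Lemma reg_is_linear N : linear (reg N).
Proof.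
move=> c f g; rewrite /reg scaler_sumr -big_split /=; apply: eq_bigr => k _.
have -> : iter k d (c *: f + g) = c *: iter k d f + iter k d g.
  by elim: (k : nat) => //= m ->; rewrite linearP.
by rewrite mulrDr scalerDr -scalerAr !scalerA mulrC.
Qed.

Hypothesis rde : regularizing d e.
Let dM := rg_deriv rde. Let d_homog := rg_homog rde. Let d_bound := rg_bound rde.
Let e0 := rg_e0 rde. Let de0 := rg_d1 rde. Let deS := rg_dS rde.
Let ek_homog := rg_e_homog rde. Let eS := rg_eS rde.

Lemma iter_d_bound B (f : sha) : (forall w, (B <= size w)%N -> f w = 0) -> iter B d f = 0.
Proof.
elim: B f => [|B ih] f h; first by apply/funext => w; exact: h.
by rewrite iterSr; apply: ih; exact: (d_bound h).
Qed.
Lemma iter_d_homog N k f : homog N f -> (k <= N)%N -> homog (N - k) (iter k d f).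
Proof.
elim: k => [|k ih] h hk; first by rewrite subn0.
by rewrite iterS; apply: d_homog; rewrite -subSn // subSS; apply: ih => //; apply: ltnW.
Qed.
Lemma iter_d_homog0 N k f : homog N f -> (N < k)%N -> iter k d f = 0.
Proof.
move=> h hk; rewrite -(subnK hk) iterD (@iter_d_bound N.+1); last first.
  by move=> w hw; apply: h; rewrite neq_ltn hw orbT.
by elim: (k - N.+1)%N => //= m ->; rewrite linear0.
Qed.

Lemma d_reg N f : homog N f -> d (reg N f) = 0.
Proof.
move=> h; rewrite /reg linear_sum /=.
under eq_bigr do rewrite linearZ /= dM scalerDr.
rewrite big_split /= big_ord_recl [X in _ + X]big_ord_recr /= e0 de0 mul0r scaler0 add0r.
rewrite -iterS (iter_d_homog0 h) // mulr0 scaler0 addr0 -big_split /=; apply: big1 => k _.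
by rewrite /bump /= add1n deS exprS mulN1r scaleNr addNr.
Qed.
Lemma reg_homog N f : homog N f -> homog N (reg N f).
Proof.
move=> h; rewrite /reg; apply: (big_ind (fun g : sha => homog N g)); [by []|exact: homogD|].
move=> k _; apply: homogZ; have hk : (k <= N)%N by rewrite -ltnS.
by rewrite -{1}(subnKC hk); apply: homogM => //; exact: iter_d_homog.
Qed.
Lemma reg_id N f : d f = 0 -> reg N f = f.
Proof.
move=> h; rewrite /reg big_ord_recl /= e0 mul1r scale1r big1 ?addr0 // => k _.
rewrite /bump /= add1n /= (_ : d (iter k d f) = 0) ?mulr0 ?scaler0 //.
by elim: (k : nat) => //= m ->; rewrite linear0.
Qed.

(** Describes the result of [reg] without its weight; multiplicativity then follows from
    uniqueness. *)
Definition regular_part (f h : sha) := d h = 0 /\ exists2 p : sha, ispoly p & f = h + e 1 * p.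

(** Repeated application of d to d(e_1 p) = 0 gives (k + 1) d^k p = - e_1 d^{k+1} p. As d is
    nilpotent on the polynomial p, descending in k yields p = 0. *)
Lemma regular_part0 (h p : sha) : ispoly p -> d h = 0 -> h = e 1 * p -> h = 0.
Proof.
move=> [B hB] dh hp; have de1 : d (e 1) = 1 by rewrite deS e0.
have step k : iter k d p *+ k.+1 = - (e 1 * iter k.+1 d p).
  elim: k => [|k ih]; first by apply/eqP; move: dh => /eqP; rewrite hp dM de1 mul1r addr_eq0.
  have := congr1 d ih; rewrite linearMn linearN /= dM de1 mul1r => h'.
  by rewrite mulrS {}h' opprD addrA subrr add0r.
have z k : (k <= B)%N -> iter (B - k) d p = 0.
  elim: k => [|k ih] hk; first by rewrite subn0; exact: iter_d_bound.
  have := step (B - k.+1)%N; rewrite -subSn // subSS ih ?mulr0 ?oppr0; last exact: ltnW.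
  rewrite -scaler_nat => /eqP; rewrite scaler_eq0 pnatr_eq0 => /orP[/eqP hk'|/eqP //].
  by move: hk; rewrite -subn_gt0 lt0n hk'.
by rewrite hp -[p]/(iter 0 d p) -(subnn B) z ?mulr0.
Qed.
Lemma regular_part_uniq f h h' : regular_part f h -> regular_part f h' -> h = h'.
Proof.
move=> [dh [p hp ->]] [dh' [p' hp' eq]]; apply/eqP; rewrite -subr_eq0; apply/eqP.
apply: (@regular_part0 _ (p' - p)); last 1 first.
- by rewrite mulrBr; apply/eqP; rewrite subr_eq addrAC eq_sym subr_eq [X in _ == X]eq addrC.
- by apply: ispolyD => //; rewrite -scaleN1r; exact: ispolyZ.
- by rewrite linearB /= dh dh' subrr.
Qed.
Lemma regular_partM (f g h k : sha) : ispoly g -> ispoly h ->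
  regular_part f h -> regular_part g k -> regular_part (f * g) (h * k).
Proof.
move=> pg ph [dh [p hp ef]] [dk [q hq eg]]; split; first by rewrite dM dh dk mul0r mulr0 addr0.
exists (p * g + h * q); first by apply: ispolyD; apply: ispolyM.
by rewrite ef mulrDl {1}eg; ring.
Qed.
Lemma reg_regular_part N f : homog N f -> regular_part f (reg N f).
Proof.
move=> h; split; first exact: d_reg.
exists (\sum_(k < N) ((-1) ^+ k / k.+1%:R) *: (e k * iter k.+1 d f)).
  apply: (big_ind (fun g : sha => ispoly g)); [exact: ispoly0|exact: ispolyD|] => k _; apply: ispolyZ.
  by apply: ispolyM; apply: homog_ispoly => //; exact: (iter_d_homog h).
rewrite /reg big_ord_recl /= e0 mul1r scale1r -addrA [X in _ + X](_ : _ = 0) ?addr0 //.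
rewrite mulr_sumr -big_split /=; apply: big1 => k _; rewrite /bump /= add1n -scalerAr mulrA -eS.
rewrite -scalerAl scalerA mulfVK ?pnatr_eq0 // exprS mulN1r scaleNr addNr //.
Qed.
Lemma regM i j (f g : sha) : homog i f -> homog j g -> reg (i + j) (f * g) = reg i f * reg j g.
Proof.
move=> hf hg; apply: (@regular_part_uniq (f * g)).
  by apply: reg_regular_part; exact: homogM.
apply: regular_partM; try exact: reg_regular_part; apply: homog_ispoly; first exact: hg.
exact: reg_homog.
Qed.
(** Taylor expansion in e_1. The difference of the two sides is a multiple of e_1, and d kills it by
    induction applied to d f, so it is 0. *)
Lemma reg_decomp N f : homog N f -> f = \sum_(k < N.+1) e k * reg (N - k) (iter k d f).
Proof.
elim: N f => [|N ih] f h.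
  have df : d f = 0 by rewrite -[d f]/(iter 1 d f) (iter_d_homog0 h).
  by rewrite big_ord1 e0 mul1r reg_id.
set F := \sum_(k < _) _; apply/eqP; rewrite -subr_eq0; apply/eqP.
have [_ [p hp ef]] := reg_regular_part h.
have hr k : (k <= N.+1)%N -> homog (N.+1 - k) (iter k d f) by exact: iter_d_homog.
have eF : F = reg N.+1 f + \sum_(k < N.+1) e k.+1 * reg (N - k) (iter k d (d f)).
  rewrite /F big_ord_recl e0 mul1r subn0; congr (_ + _); apply: eq_bigr => k _.
  by rewrite lift0 subSS iterSr.
apply: (@regular_part0 _ (p - \sum_(k < N.+1) k.+1%:R^-1 *: (e k * reg (N - k) (iter k d (d f))))).
- apply: ispolyD => //; rewrite -scaleN1r; apply: ispolyZ.
  apply: (big_ind (fun g : sha => ispoly g)); [exact: ispoly0|exact: ispolyD|] => k _; apply: ispolyZ.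
  have hk : (k <= N)%N by rewrite -ltnS.
  apply: ispolyM; first by apply: homog_ispoly; exact: ek_homog.
  by apply: homog_ispoly; apply: reg_homog; apply: iter_d_homog => //; exact: d_homog.
- rewrite linearB /= {1}(ih _ (d_homog h)) eF linearD /= d_reg // add0r linear_sum /=.
  apply/eqP; rewrite subr_eq0; apply/eqP/eq_bigr => k _; rewrite dM deS d_reg ?mulr0 ?addr0 //.
  by apply: iter_d_homog; [exact: d_homog | rewrite -ltnS].
rewrite eF {1}ef opprD addrACA subrr add0r mulrBr mulr_sumr; congr (_ - _).
apply: eq_bigr => k _; rewrite -scalerAr mulrA -eS -scalerAl scalerA mulVf ?pnatr_eq0 //.
by rewrite scale1r.
Qed.
End Regularization.

Definition e_ a k : sha := pword (nseq k a).
Lemma e_homog a k : homog k (e_ a k).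
Proof. by rewrite -{1}(size_nseq k a); exact: homog_pword. Qed.
Lemma e_S a k : k.+1%:R *: e_ a k.+1 = e_ a 1 * e_ a k.
Proof. by rewrite /e_ pword_nseqM add1n bin1. Qed.
Lemma rder_pword a b w : rder a (pword (rcons w b)) = (a == b)%:R *: (pword w : sha) :> sha.
Proof.
by apply/funext => u; rewrite -rderE shaZ /pword eqseq_rcons andbC -mulnb natrM.
Qed.
Lemma lder_e a b k : lder a (e_ b k.+1) = (a == b)%:R *: e_ b k.
Proof. by rewrite /e_ /= lder_pword. Qed.
Lemma rder_e a b k : rder a (e_ b k.+1) = (a == b)%:R *: e_ b k.
Proof. by rewrite /e_ -rder_pword -cats1 -(nseqD k 1) addn1. Qed.
Lemma rder1 a : rder a (1 : sha) = 0.
Proof. by apply/funext => w; rewrite -rderE sha1E -size_eq0 size_rcons. Qed.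

Lemma lder_regularizing a : regularizing (lder a) (e_ a).
Proof.
split=> //=; first exact: lderM.
- by move=> N f; exact: homog_lder.
- by move=> B f h w hw; rewrite /lder h //; case: B h hw.
- by move=> k; rewrite lder_e eqxx scale1r.
- exact: e_homog.
- exact: e_S.
Qed.
Lemma rder_regularizing a : regularizing (rder a) (e_ a).
Proof.
split=> //=; first exact: rderM.
- by move=> N f h w hw; rewrite -rderE h // size_rcons.
- by move=> B f h w hw; rewrite -rderE h // size_rcons; case: B h hw.
- exact: rder1.
- by move=> k; rewrite rder_e eqxx scale1r.
- exact: e_homog.
- exact: e_S.
Qed.

Definition regl N : sha -> sha := reg (lder true) (e_ true) N.
Definition regr N : sha -> sha := reg (rder false) (e_ false) N.
HB.instance Definition _ N := GRing.isLinear.Build rat sha sha _ (regl N) (reg_is_linear (lder true) (e_ true) N).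
HB.instance Definition _ N := GRing.isLinear.Build rat sha sha _ (regr N) (reg_is_linear (rder false) (e_ false) N).
(** Trailing x0 are removed first; [regl_yend] keeps them absent while the leading x1 are removed,
    so the result is convergent. *)
Definition REG N (f : sha) : sha := regl N (regr N f).
HB.instance Definition _ N := GRing.Linear.copy (REG N) (regl N \o regr N).

Definition regl_spec := lder_regularizing true.
Definition regr_spec := rder_regularizing false.

Lemma REGM i j (f g : sha) : homog i f -> homog j g -> REG (i + j) (f * g) = REG i f * REG j g.
Proof.
move=> hf hg; rewrite /REG /regr (regM regr_spec) // /regl (regM regl_spec) //; exact: (reg_homog regr_spec).
Qed.
Lemma REG_homog N f : homog N f -> homog N (REG N f).
Proof. by move=> h; apply: (reg_homog regl_spec); exact: (reg_homog regr_spec). Qed.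

Lemma yend_rder (f : sha) : yend_poly f <-> rder false f = 0.
Proof.
split=> [/yend_polyP h|h]; first by apply/funext => w; rewrite -rderE h.
by apply/yend_polyP => w; rewrite rderE h.
Qed.
Lemma iter_lder_yend k f : yend_poly f -> yend_poly (iter k (lder true) f).
Proof. by move=> h; elim: k => //= k; exact: lder_yend. Qed.
Lemma e_true_yend k : yend_poly (e_ true k).
Proof. by case: k => [|k]; apply/yend_rder; [exact: rder1 | rewrite rder_e scale0r]. Qed.
Lemma yendM (f g : sha) : yend_poly f -> yend_poly g -> yend_poly (f * g).
Proof. by move=> /yend_rder h /yend_rder h'; apply/yend_rder; rewrite rderM h h' mul0r mulr0 addr0. Qed.
Lemma yendB (f g : sha) : yend_poly f -> yend_poly g -> yend_poly (f - g).
Proof. by move=> /yend_rder h /yend_rder h'; apply/yend_rder; rewrite linearB /= h h' subrr. Qed.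
Lemma pstuffle_yend (u v : sha) : yend_poly (pstuffle u v).
Proof. by move=> w; rewrite pstuffleE; case: ifP => //; rewrite eqxx. Qed.
Lemma regl_yend N f : yend_poly f -> yend_poly (regl N f).
Proof.
move=> h; apply/yend_rder; rewrite /regl /reg linear_sum /= big1 // => k _; rewrite linearZ /= rderM.
have /yend_rder -> := @e_true_yend k; have /yend_rder -> := @iter_lder_yend k _ h.
by rewrite mulr0 mul0r addr0 scaler0.
Qed.
Lemma regl_conv N f : homog N f -> yend_poly f -> conv_poly (regl N f).
Proof.
by move=> hf yf; apply/conv_polyP; split; [exact: regl_yend | exact: (d_reg regl_spec)].
Qed.
Lemma REG_conv N f : homog N f -> conv_poly (REG N f).
Proof.
move=> h; apply: regl_conv; first exact: (reg_homog regr_spec).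
by apply/yend_rder; exact: (d_reg regr_spec).
Qed.
Lemma REG_yend N f : yend_poly f -> REG N f = regl N f.
Proof. by move=> /yend_rder h; rewrite /REG /regr (reg_id regr_spec). Qed.
Lemma REG_id N f : conv_poly f -> REG N f = f.
Proof. by move=> /conv_polyP[yf hf]; rewrite REG_yend // /regl (reg_id regl_spec). Qed.

Lemma lder_pstuffle (u v : sha) : lder true u = 0 ->
  lder true (pstuffle u v) = pstuffle u (lder true v).
Proof.
move=> hu; have eU (f : sha) : yd 1 (UY f) = UY (lder true f) by [].
apply/funext => w; rewrite /lder !pstuffleE.
have -> : isYword (true :: w) = isYword w by case: w => //= a w; rewrite /isYword.
by case: ifP => // _; rewrite -[toY (true :: w)]/(1%N :: toY w) ydE yd1M eU hu
  (_ : UY 0 = 0) // mul0r add0r eU.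
Qed.

Lemma homog_pstuffle i j (u v : sha) : homog i u -> homog j v -> homog (i + j) (pstuffle u v).
Proof.
move=> hu hv w hw; rewrite /pstuffle big1 // => k _; rewrite big_seq big1 // => a; rewrite mem_allwords => /eqP ha.
rewrite big_seq big1 // => b; rewrite mem_allwords => /eqP hb.
have [ea|ea] := eqVneq (size a) i; last by rewrite hu // !mul0r.
rewrite (hv b) ?mulr0 ?mul0r //; apply: contra hw => /eqP eb.
by rewrite -eb -ea ha hb subnKC // -ltnS.
Qed.

Lemma smallZ c u : small u -> small (fun n => c * u n).
Proof.
by move=> h; apply: (small_ext _ (smallM h (logb_cst c))) => n _; rewrite mulrC.
Qed.

(** As u has no leading x1, [lder true] acts on v alone in both products, so derivatives of the
    relation g are relations with v of lower weight. [reg_decomp] writes [regl] of g as g minus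
    products of powers of x1 with terms small by induction, and g is small because [Hs] respects
    both products. *)
Lemma small_regl i j (u v : sha) : conv_poly u -> yend_poly v -> homog i u -> homog j v ->
  small (fun n => pr (i + j) (Hs n) (regl (i + j) (u * v - (pstuffle u v : sha)))).
Proof.
move=> cu; have [yu du] := (conv_polyP u).1 cu; move=> + hu.
elim/ltn_ind: j v => j ih v yv hv; set g := u * v - _.
have hg : homog (i + j) g by apply: homogB; [exact: homogM | exact: homog_pstuffle].
have ig k : iter k (lder true) g = u * iter k (lder true) v - (pstuffle u (iter k (lder true) v) : sha).
  elim: k => //= k ->; rewrite linearB /= lderM du mul0r add0r lder_pstuffle //.
have yg k : yend_poly (iter k (lder true) g).
  by apply: iter_lder_yend; apply: yendB; [exact: yendM | exact: pstuffle_yend].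
have e n : (0 < n)%N -> pr (i + j) (Hs n) g =
    \sum_(k < (i + j).+1) pr (i + j) (Hs n) (e_ true k * regl (i + j - k) (iter k (lder true) g)).
  by move=> _; rewrite {1}(reg_decomp regl_spec hg) linear_sum.
have sg : small (fun n => pr (i + j) (Hs n) g).
  apply: (small_ext _ (Hs_shuffle hu hv cu yv)) => n n0; rewrite linearB /=; congr (_ - _).
  have hij : (i < (i + j).+1)%N by rewrite ltnS leq_addr.
  rewrite pr_Hs_pstuffle // (bigD1 (Ordinal hij)) //= addKn big1 ?addr0 // => k; rewrite -val_eqE /= => hk.
  by rewrite (_ : pr k (Hs n) u = 0) ?mul0r // /pr big_seq big1 // => w; rewrite mem_allwords => /eqP hw; rewrite hu ?mulr0 // hw.
have st (k : 'I_(i + j)) : small (fun n => pr (i + j) (Hs n) (e_ true k.+1 * regl (i + j - k.+1) (iter k.+1 (lder true) g))).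
  have hk : (k.+1 <= i + j)%N := ltn_ord k.
  have hgk : homog (i + j - k.+1) (iter k.+1 (lder true) g) by exact: (iter_d_homog regl_spec).
  have sk : small (fun n => pr (i + j - k.+1) (Hs n) (regl (i + j - k.+1) (iter k.+1 (lder true) g))).
    rewrite ig; have [hkj|hkj] := leqP k.+1 j.
      rewrite -addnBA //; apply: ih; first by lia.
        exact: iter_lder_yend.
      exact: (iter_d_homog regl_spec).
    rewrite (iter_d_homog0 regl_spec hv hkj) mulr0 (_ : (pstuffle u (0 : sha) : sha) = 0); last first.
      apply/funext => w; rewrite /pstuffle big1 // => a _; rewrite big1 // => b _.
      by rewrite big1 // => c _; rewrite mulr0 mul0r.
    by apply: (small_ext _ small0) => n _; rewrite subrr !linear0.
  have := @Hs_shuffle _ _ _ (e_ true k.+1) ((reg_homog regl_spec) _ _ hgk) (@e_homog true k.+1) (regl_conv hgk (yg _)) (@e_true_yend _).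
  rewrite subnK // => /smallD /(_ (smallM sk (@logb_Hs k.+1 (e_ true k.+1)))).
  by apply: small_ext => n _; rewrite subrK mulrC.
apply: (small_ext _ (smallD sg (smallN (@small_sum _ (index_enum 'I_(i + j)) predT _ (fun k _ => st k))))) => n n0.
by rewrite e // big_ord_recl /= mul1r subn0 addrK.
Qed.


Lemma small_gen i g : genR g -> small (fun n => pr i (Hs n) (REG i (wpart i g))).
Proof.
have hx a : REG 1 (pword [:: a]) = 0.
  rewrite -[pword _]/(e_ a 1) /REG /regl /regr; case: a.
    rewrite (reg_id regr_spec); last by rewrite /= rder_e scale0r.
    by rewrite /reg big_ord_recl big_ord1 /= lder_e eqxx !scale1r mul1r mulr1 expr1 scaleN1r subrr.
  rewrite {2}/reg big_ord_recl big_ord1 /= rder_e eqxx !scale1r mul1r mulr1 expr1 scaleN1r subrr.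
  exact: (linear0 (regl 1)).
have hx' a : small (fun n => pr i (Hs n) (REG i (wpart i (pword [:: a])))).
  apply: (small_ext _ small0) => n _; have [->|hi] := eqVneq i 1%N.
    by rewrite wpart_id ?hx ?linear0 //; exact: (@homog_pword [:: a]).
  rewrite (_ : wpart i _ = 0) ?linear0 //; apply/funext => w; rewrite /wpart; case: eqP => // hw.
  by apply: (@homog_pword [:: a]); rewrite hw.
case=> [/xpolyP ->|[/xpolyP ->|[u [v [hu hv cu yv /xpolyP ->]]]]]; [exact: hx'|exact: hx'|].
rewrite -[psub _ _]/((u : sha) * v - (pstuffle u v : sha)) linearB /= wpartM wpart_pstuffle -sumrB.
apply: (small_ext (u := fun n => \sum_(j < i.+1) pr i (Hs n) (REG i ((wpart j u : sha) * wpart (i - j) v - (pstuffle (wpart j u) (wpart (i - j) v) : sha))))).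
  by move=> n _; rewrite (linear_sum (REG i)) (linear_sum (pr i (Hs n))).
apply: small_sum => j _; have hj : (j + (i - j) = i)%N by rewrite subnKC // -ltnS.
have := @small_regl j (i - j) (wpart j u) (wpart (i - j) v); rewrite hj => h.
have cu' := @wpart_poly_conv j _ cu; have yv' := @wpart_poly_yend (i - j) _ yv.
apply: (small_ext _ (h cu' yv' (@wpart_homog _ _) (@wpart_homog _ _))) => n _.
have [yu _] := (conv_polyP _).1 cu'; rewrite REG_yend //.
by apply: yendB; [exact: yendM | exact: pstuffle_yend].
Qed.

(** [REG] is multiplicative, and so is [Hs] on convergent elements up to small errors; smallness
    passes from the generators to the ideal. *)
Lemma small_inR N h : inR h -> small (fun n => pr N (Hs n) (REG N (wpart N h))).
Proof.
elim=> {h} [|c g f [x [p [hx hp /xpolyP ->]]] _ ih|f g _ ih /xpolyP <-] //.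
  by apply: (small_ext _ small0) => n _; rewrite (_ : pzero = (0 : sha)) // !linear0.
rewrite -[padd _ _]/(c *: ((x : sha) * p) + (f : sha)).
have e n : pr N (Hs n) (REG N (wpart N (c *: ((x : sha) * p) + (f : sha)))) =
    c * pr N (Hs n) (REG N (wpart N ((x : sha) * p))) + pr N (Hs n) (REG N (wpart N f)).
  by rewrite !linearP.
apply: (small_ext (u := fun n => c * pr N (Hs n) (REG N (wpart N ((x : sha) * p))) + pr N (Hs n) (REG N (wpart N f)))).
  by move=> n _; rewrite e.
apply: smallD => //; apply: smallZ; rewrite wpartM.
apply: (small_ext (u := fun n => \sum_(i < N.+1) pr N (Hs n) (REG N ((wpart i x : sha) * wpart (N - i) p)))).
  by move=> n _; rewrite (linear_sum (REG N)) (linear_sum (pr N (Hs n))).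
apply: small_sum => i _; have hi : (i + (N - i) = N)%N by rewrite subnKC // -ltnS.
have hx1 := @wpart_homog i x; have hp1 := @wpart_homog (N - i) p.
have := @Hs_shuffle i (N - i) (REG i (wpart i x)) (REG (N - i) (wpart (N - i) p)) (REG_homog hx1) (REG_homog hp1)
  (REG_conv hx1) ((conv_polyP _).1 (REG_conv hp1)).1.
rewrite -REGM // hi => /smallD /(_ (smallM (small_gen i hx) (@logb_Hs (N - i) (REG (N - i) (wpart (N - i) p))))).
by apply: small_ext => n _; rewrite subrK.
Qed.
Lemma small_conv N (f : sha) : inR f -> conv_poly f -> homog N f -> small (fun n => pr N (Hs n) f).
Proof.
by move=> hR cf hf; apply: (small_ext _ (small_inR N hR)) => n _; rewrite wpart_id // REG_id.
Qed.

(** * Zeta values outside R *)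

Lemma Hs_z1 k n : (1 < n)%N -> 1 <= Hs n (rcons (nseq k false) true).
Proof.
move=> n1; rewrite /Hs (bigD1 (Ordinal n1)) //= -cats1 cw_letter /Hs big_ord1 /= expr1n divr1 lerDl.
by apply: sumr_ge0 => m _; exact: cw_ge0.
Qed.
Lemma z1_homog k : homog k.+1 (z1 k).
Proof. by have := @homog_pword (rcons (nseq k false) true); rewrite size_rcons size_nseq. Qed.
Lemma z1_conv k : conv_poly (z1 k.+1).
Proof.
move=> w; rewrite /z1 /pword; case: (w =P rcons _ _) => [->|_] h; last by rewrite eqxx in h.
by rewrite /= last_rcons.
Qed.
Lemma pr_Hs_z1 k n : pr k.+1 (Hs n) (z1 k) = Hs n (rcons (nseq k false) true).
Proof. by rewrite /z1 pr_pword size_rcons size_nseq eqxx. Qed.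

Lemma not_small_ge1 u : (forall n, (1 < n)%N -> 1 <= u n) -> ~ small u.
Proof.
move=> h /small_lt1 [n n1]; apply/negP; rewrite -leNgt; apply: le_trans (h n n1) _.
exact: ler_norm.
Qed.

Lemma zeta_notin_R k : ~ inR (z1 k.+1).
Proof.
move=> h; apply: (@not_small_ge1 (fun n => pr k.+2 (Hs n) (z1 k.+1))).
  by move=> n n1; rewrite pr_Hs_z1; exact: Hs_z1.
by apply: small_conv => //; [exact: z1_conv | exact: z1_homog].
Qed.

Lemma zeta2X_homog k : homog k.*2 ((z1 1) ^+ k).
Proof.
elim: k => [|k ih]; first by rewrite expr0; exact: (@homog_pword [::]).
by rewrite exprS doubleS -add2n; apply: homogM => //; exact: z1_homog.
Qed.
Lemma convM (f g : sha) : conv_poly f -> conv_poly g -> conv_poly (f * g).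
Proof.
move=> /conv_polyP[h1 h2] /conv_polyP[h3 h4]; apply/conv_polyP; split; first exact: yendM.
by rewrite lderM h2 h4 mul0r mulr0 addr0.
Qed.
Lemma zeta2X_conv k : conv_poly ((z1 1) ^+ k).
Proof.
elim: k => [|k ih]; last by rewrite exprS; apply: convM => //; exact: z1_conv.
by rewrite expr0 => w; rewrite sha1E; case: (w =P [::]) => [->|_] //; rewrite eqxx.
Qed.
(** H_n of zeta(2)^k is the k-th power of H_n of zeta(2) up to a small error; the latter is at least
    1, while membership in R would make the former small. *)
Lemma zeta2X_notin_R k (c : rat) : inR (c *: (z1 1) ^+ k) -> c = 0.
Proof.
move=> h; apply/eqP/negP => /negP c0; have : inR ((z1 1) ^+ k).
  by rewrite -[_ ^+ k]scale1r -(mulVf c0) -scalerA; exact: spanZ.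
move=> {h} /small_conv /(_ (@zeta2X_conv k) (@zeta2X_homog k)) h.
set u := fun n => pr 2 (Hs n) (z1 1).
have hu : small (fun n => pr k.*2 (Hs n) ((z1 1) ^+ k) - u n ^+ k).
  elim: k {h} => [|k ih].
    apply: (small_ext _ small0) => n n0; rewrite !expr0 pr0 mulr1 /Hs; case: n n0 => // n _.
    by rewrite big_ord_recl big1 ?addr0 ?subrr.
  have := Hs_shuffle (@z1_homog 1) (@zeta2X_homog k) (@z1_conv 0) ((conv_polyP _).1 (@zeta2X_conv k)).1.
  move=> /smallD /(_ (smallM ih (@logb_Hs 2 (z1 1)))); apply: small_ext => n _.
  by rewrite exprS doubleS -add2n exprS /u; ring.
apply: (@not_small_ge1 (fun n => u n ^+ k)); last first.
  by apply: (small_ext _ (smallD h (smallN hu))) => n _; ring.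
by move=> n n1; rewrite exprn_ege1 // /u pr_Hs_z1 Hs_z1.
Qed.

(** * Weighted Euler operator *)

Definition zeta2 : sha := z1 1.
Lemma zeta2_homog : homog 2 zeta2. Proof. exact: z1_homog. Qed.
Lemma zeta2_poly : ispoly zeta2. Proof. exact: (homog_ispoly zeta2_homog). Qed.
Lemma D_zeta2 m psi : dm0 psi -> (0 < m)%N -> D m psi zeta2 = 0.
Proof.
move=> h m0; have [m1|m1] := leqP m 1%N; first by apply: D_z1; [exact: dm0_nseq | rewrite m0].
have [m2|m2] := ltnP 2 m; first exact: (D_homog0 _ m2 zeta2_homog).
have -> : m = 2%N by lia.
rewrite (D_homogn _ zeta2_homog) pr_pword /=; case: h => -[_ _ _ ->] _; exact: scale0r.
Qed.

Definition inJ (f : sha) := exists2 p : sha, ispoly p & inR (f - zeta2 * p).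
Lemma inJ_inR (f : sha) : inR f -> inJ f.
Proof. by move=> h; exists 0; [exact: ispoly0 | rewrite mulr0 subr0]. Qed.
Lemma inJ_lin (c : rat) (f g : sha) : inJ f -> inJ g -> inJ (c *: f + g).
Proof.
move=> [p hp hf] [q hq hg]; exists (c *: p + q).
  by apply: ispolyD => //; exact: ispolyZ.
rewrite mulrDr -scalerAr opprD addrACA -scalerBr; apply: spanD => //; exact: spanZ.
Qed.
Lemma inJM (f g : sha) : inJ f -> ispoly g -> inJ (f * g).
Proof.
move=> [p hp hf] hg; exists (p * g); first exact: ispolyM.
by rewrite mulrA -mulrBl; exact: inRM.
Qed.

(* [Pw k n f]: modulo the ideal (zeta(2)) + R, f is a combination of products of at least k
   factors of positive weight, of total weight n. *)
Inductive Pw : nat -> nat -> sha -> Prop :=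
| Pw_homog n (f : sha) : homog n f -> Pw 0 n f
| Pw_J k n (f : sha) : inJ f -> Pw k n f
| Pw_mul k i j n (a g : sha) : (0 < i)%N -> (i + j = n)%N -> homog i a ->
    ispoly g -> Pw k j g -> Pw k.+1 n (a * g)
| Pw_weaken k n f : Pw k.+1 n f -> Pw k n f
| Pw_lin k n (c : rat) (f g : sha) : Pw k n f -> Pw k n g -> Pw k n (c *: f + g).

Lemma Pw_0 k n : Pw k n 0. Proof. by apply/Pw_J/inJ_inR; exact: span0. Qed.
Lemma PwD k n (f g : sha) : Pw k n f -> Pw k n g -> Pw k n (f + g).
Proof. by move=> hf hg; rewrite -[f]scale1r; exact: Pw_lin. Qed.
Lemma PwZ k n (c : rat) (f : sha) : Pw k n f -> Pw k n (c *: f).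
Proof. by move=> hf; rewrite -[_ *: _]addr0; apply: Pw_lin => //; exact: Pw_0. Qed.
Lemma PwB k n (f g : sha) : Pw k n f -> Pw k n g -> Pw k n (f - g).
Proof. by move=> hf hg; rewrite -scaleN1r addrC; exact: Pw_lin. Qed.
Lemma Pw_sum k n I (r : seq I) (F : I -> sha) : (forall i, Pw k n (F i)) -> Pw k n (\sum_(i <- r) F i).
Proof. by move=> h; elim/big_rec: _ => [|i f _]; [exact: Pw_0 | exact: PwD]. Qed.

Lemma Pw_large k n f : Pw k n f -> (n < k)%N -> inJ f.
Proof.
elim=> {k n f} [n f _|k n f h|k i j n a g i0 hn ha pg _ ih|k n f _ ih|k n c f g _ ihf _ ihg] hk //.
- have hj : (j < k)%N by lia.
  by rewrite mulrC; apply: inJM; [exact: ih | exact: (homog_ispoly ha)].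
- by apply: ih; lia.
- by apply: inJ_lin; [exact: ihf | exact: ihg].
Qed.

Lemma wpart_mul_eq0 n (f g : sha) (k : nat) : homog k f -> (k <= n)%N ->
  wpart n (f * g) = f * wpart (n - k) g.
Proof.
move=> hf hk; rewrite wpartM; have hk' : (k < n.+1)%N by [].
rewrite (bigD1 (Ordinal hk')) //= (wpart_id hf) big1 ?addr0 // => i; rewrite -val_eqE /= => hi.
rewrite (_ : wpart i f = 0) ?mul0r //; apply/funext => w; rewrite /wpart; case: eqP => // hw.
by apply: hf; rewrite hw.
Qed.
Lemma wpart_mul_lt n (f g : sha) (k : nat) : homog k f -> (n < k)%N -> wpart n (f * g) = 0.
Proof.
move=> hf hk; rewrite wpartM big1 // => i _.
rewrite (_ : wpart i f = 0) ?mul0r //; apply/funext => w; rewrite /wpart; case: eqP => // hw.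
by apply: hf; rewrite hw; have := ltn_ord i; lia.
Qed.

Lemma inI_Pw n (f : sha) : inI f -> Pw 2 n (wpart n f).
Proof.
elim=> {f} [|c g f hg _ ih|f g _ ih /xpolyP <-] //.
  by rewrite (_ : pzero = (0 : sha)) // linear0; exact: Pw_0.
rewrite -[padd _ _]/(c *: (g : sha) + (f : sha)) linearP /=; apply: Pw_lin => // {c f ih}.
case: hg => [hg|[[p [hp /xpolyP ->]]|[a [b [pa pb a0 b0 /xpolyP ->]]]]].
- by apply/Pw_J/inJ_inR/inR_wpart; exact: span_gen.
- apply: Pw_J; rewrite mulE -[pword _]/zeta2; have [h|h] := leqP 2 n; last first.
    by rewrite (wpart_mul_lt _ zeta2_homog h); apply/inJ_inR/span0.
  rewrite (wpart_mul_eq0 _ zeta2_homog h); exists (wpart (n - 2) p); first exact: ispoly_wpart.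
  by rewrite subrr; exact: span0.
rewrite mulE wpartM; apply: Pw_sum => i; have hi : (i <= n)%N by rewrite -ltnS.
have w0 (f : sha) : f [::] = 0 -> wpart 0 f = 0 :> sha.
  by move=> h; apply/funext => -[|x w] //; rewrite /wpart /= h.
have [->|i0] := posnP i; first by rewrite (w0 a a0) mul0r; exact: Pw_0.
have [e|ni] := posnP (n - i)%N; first by rewrite e (w0 b b0) mulr0; exact: Pw_0.
apply: (@Pw_mul 1 i (n - i)) => //; [exact: subnKC | exact: wpart_homog | exact: ispoly_wpart |].
rewrite -[wpart (n - i) b](mulr1 (wpart (n - i) b : sha)).
apply: (@Pw_mul 0 (n - i) 0) => //; [by rewrite addn0 | exact: wpart_homog | exact: ispoly1 |].
by apply: Pw_homog; exact: (@homog_pword [::]).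
Qed.

Section Euler.
Hypothesis dm0_preservesR : forall n psi, dm0 psi -> preservesR n psi.
Hypothesis dm0_zero : dm0 (0 : sha).

Lemma annihilator_dm0 n psi : (0 < n)%N -> homog n psi ->
  (forall f : sha, inI f -> pr n psi f = 0) -> dm0 psi.
Proof.
move=> n0 hpsi ann; have [n1|n1] := ltnP 1 n; first exact: (ann_dm0 n1).
(* In weight 1 both letters lie in R, so the form is 0. *)
have e : n = 1%N by lia.
rewrite (_ : psi = (0 : sha)) //; apply/funext => w; have [hw|hw] := eqVneq (size w) n; last exact: hpsi.
case: w hw => [|a [|b w]]; rewrite e // => _.
have := ann (pword [:: a]); rewrite e pr_pword /= => -> //; apply/inI_inR/inR_gen.
by case: a; [right; left | left].
Qed.

Definition killed (f : sha) := forall m psi, dm0 psi -> (0 < m)%N -> inR (D m psi f).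

Section Operator.
Variables (B : nat) (psi : nat -> word -> sha).
Hypothesis psi_homog : forall m w, homog m (psi m w).
Hypothesis psi_ann : forall m w f, inI f -> pr m (psi m w) f = 0.
Hypothesis psi_proj : forall m a, homog m a ->
  inI (a - \sum_(w <- allwords m) pr m (psi m w) a *: (pword w : sha)).

Let psi_dm0 m w : dm0 (psi m.+1 w).
Proof. by apply: (@annihilator_dm0 m.+1) => // f; exact: psi_ann. Qed.

(* On a product of k indecomposables [Eop] is multiplication by k up to longer products. *)
Definition Eop (f : sha) : sha :=
  \sum_(m < B) \sum_(w <- allwords m.+1) (pword w : sha) * D m.+1 (psi m.+1 w) f.

Lemma Eop_deriv : derivation Eop.
Proof.
move=> f g; rewrite /Eop mulr_suml mulr_sumr -big_split; apply: eq_bigr => m _.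
rewrite mulr_suml mulr_sumr -big_split; apply: eq_bigr => w _.
rewrite (D_deriv (dm0_prim (psi_dm0 _ _) _)) //= mulrDr mulrA; congr (_ + _).
by rewrite mulrCA.
Qed.
Lemma Eop_lin (c : rat) f g : Eop (c *: f + g) = c *: Eop f + Eop g.
Proof.
rewrite /Eop scaler_sumr -big_split; apply: eq_bigr => m _ /=.
rewrite scaler_sumr -big_split; apply: eq_bigr => w _ /=.
by rewrite linearP mulrDr -scalerAr.
Qed.
Lemma Eop_inR f : inR f -> inR (Eop f).
Proof.
move=> h; apply: span_sum => m _; apply: span_sum => w _; apply: inRMl.
  by apply: dm0_preservesR => //; exact: psi_dm0.
exact: ispoly_pword.
Qed.
Lemma Eop_killed f : killed f -> inR (Eop f).
Proof.
move=> h; apply: span_sum => m _; apply: span_sum => w _; apply: inRMl.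
  by apply: h => //; exact: psi_dm0.
exact: ispoly_pword.
Qed.
Lemma Eop_zeta2 p : Eop (zeta2 * p) = zeta2 * Eop p.
Proof.
rewrite Eop_deriv (_ : Eop zeta2 = 0) ?mul0r ?add0r // /Eop big1 // => m _.
by rewrite big1 // => w _; rewrite D_zeta2 ?mulr0 //; exact: psi_dm0.
Qed.
Lemma Eop_poly f : ispoly f -> ispoly (Eop f).
Proof.
move=> h; apply: (big_ind (fun g : sha => ispoly g)); [exact: ispoly0|exact: ispolyD|] => m _.
apply: (big_ind (fun g : sha => ispoly g)); [exact: ispoly0|exact: ispolyD|] => w _.
by apply: ispolyM; [exact: ispoly_pword | exact: D_ispoly].
Qed.
Lemma Eop_inJ (f : sha) : inJ f -> inJ (Eop f).
Proof.
move=> [p hp hf]; exists (Eop p); first exact: Eop_poly.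
have -> : Eop f - zeta2 * Eop p = Eop ((-1) *: (zeta2 * p) + f).
  by rewrite Eop_lin Eop_zeta2 scaleN1r addrC.
by apply: Eop_inR; rewrite scaleN1r addrC.
Qed.
Lemma word_D_Pw n m w f : homog n f -> (m < n)%N -> size w = m.+1 ->
  Pw 1 n ((pword w : sha) * D m.+1 (psi m.+1 w) f).
Proof.
move=> hf hm hw.
have hh : homog (n - m.+1) (D m.+1 (psi m.+1 w) f) by apply: D_homog; rewrite subnKC.
apply: (@Pw_mul 0 m.+1 (n - m.+1)) => //; first exact: subnKC.
- by rewrite -hw; exact: homog_pword.
- exact: (homog_ispoly hh).
- exact: Pw_homog.
Qed.

Lemma Eop_Pw0 n f : homog n f -> Pw 1 n (Eop f).
Proof.
move=> hf; apply: Pw_sum => m; rewrite big_seq; elim/big_rec: _ => [|w g]; first exact: Pw_0.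
rewrite mem_allwords => /eqP hw hg; apply: PwD => //.
have [hm|hm] := ltnP m n; first exact: word_D_Pw.
by rewrite (@D_homog0 _ _ n) // mulr0; exact: Pw_0.
Qed.

(** The weight-i part of [Eop] is the projection of [a] modulo I; the parts of lower weight are
    products of two factors of positive weight. *)
Lemma Eop_homog i (a : sha) : (0 < i)%N -> (i <= B)%N -> homog i a -> Pw 2 i (Eop a - a).
Proof.
case: i => // i _ hi ha; rewrite /Eop (bigD1 (Ordinal hi)) //.
set T := \sum_(j < B | _) _.
set S : sha := \sum_(w <- allwords i.+1) (pword w : sha) * D i.+1 (psi i.+1 w) a.
rewrite -[X in X - a]/(S + T) addrAC; apply: PwD; last first.
  rewrite /T; elim/big_rec: _ => [|m g]; first exact: Pw_0.
  rewrite -val_eqE => /eqP hm hg; apply: PwD => // {g hg}; have {}hm : (m : nat) <> i := hm.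
  rewrite big_seq; elim/big_rec: _ => [|w g]; first exact: Pw_0.
  rewrite mem_allwords => /eqP hw hg; apply: PwD => // {g hg}.
  have [hmi|hmi] := ltnP m i; last first.
    by rewrite (@D_homog0 _ _ i.+1) ?mulr0 //; [exact: Pw_0 | lia].
  have hh : homog (i.+1 - m.+1) (D m.+1 (psi m.+1 w) a) by apply: D_homog; rewrite subnKC // ltnW.
  apply: (@Pw_mul 1 m.+1 (i.+1 - m.+1)) => //; [by lia | by rewrite -hw; exact: homog_pword | exact: (homog_ispoly hh) |].
  rewrite -[D _ _ _]mulr1; apply: (@Pw_mul 0 (i.+1 - m.+1) 0) => //; [by lia | by lia | exact: ispoly1 |].
  by apply: Pw_homog; exact: (@homog_pword [::]).
rewrite -opprB; have -> : S = \sum_(w <- allwords i.+1) pr i.+1 (psi i.+1 w) a *: (pword w : sha).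
  by apply: eq_bigr => w _; rewrite (D_homogn _ ha) -scalerAr mulr1.
rewrite -scaleN1r; apply: PwZ; set b := a - _.
have hb : homog i.+1 b.
  apply: homogB => //; rewrite big_seq; apply: (big_ind (fun g : sha => homog i.+1 g)); [by []|exact: homogD|].
  by move=> w; rewrite mem_allwords => /eqP hw; apply: homogZ; rewrite -hw; exact: homog_pword.
by rewrite -(wpart_id hb); apply: inI_Pw; exact: psi_proj.
Qed.

Lemma PwM k i (f : sha) l j n (g : sha) : Pw k i f -> Pw l j g -> (i + j = n)%N -> ispoly g -> Pw (k + l) n (f * g).
Proof.
move=> hf; elim: hf l j n g => {k i f} [i f hf|k i f hf|k a b i f f' a0 hi ha pf _ ih|k i f _ ih|k i c f f' _ ih _ ih'] l j n g hg hn pg.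
- have [i0|i0] := posnP i.
    move: hf hn; rewrite i0 => /homog0P -> <-; rewrite -scalerAl mul1r; exact: PwZ.
  by apply: Pw_weaken; exact: (Pw_mul i0 hn hf pg).
- by apply: Pw_J; exact: inJM.
- rewrite addSn -mulrA; apply: (Pw_mul (j := b + j) a0 _ ha); [by lia | exact: ispolyM | exact: (ih _ _ _ _ hg)].
- by apply: Pw_weaken; rewrite -addSn; exact: (ih _ _ _ _ hg).
by rewrite mulrDl -scalerAl; apply: Pw_lin; [exact: (ih _ _ _ _ hg) | exact: (ih' _ _ _ _ hg)].
Qed.

(** Leibniz rule over the factors, with [Eop_homog] for each one; the ideal (zeta(2)) + R is stable
    since [Eop] kills zeta(2) and preserves R. *)
Lemma Eop_Pw k n (f : sha) : Pw k n f -> (n <= B)%N -> Pw k.+1 n (Eop f - k%:R *: f).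
Proof.
elim=> {k n f} [n f hf|k n f hf|k i j n a g i0 hn ha pg hg ih|k n f hf ih|k n c f g _ ihf _ ihg] hB.
- by rewrite scale0r subr0; exact: Eop_Pw0.
- by apply: Pw_J; rewrite addrC -scaleNr; apply: inJ_lin => //; exact: Eop_inJ.
- have hj : (j <= B)%N by lia.
  have hi : (i <= B)%N by lia.
  have -> : Eop (a * g) - k.+1%:R *: (a * g) = (Eop a - a) * g + a * (Eop g - k%:R *: g).
    rewrite Eop_deriv mulrBl mulrBr -scalerAr -[k.+1%:R]nat1r scalerDl scale1r opprD.
    by rewrite addrACA.
  apply: PwD; last first.
    apply: (Pw_mul i0 hn ha) (ih hj); apply: ispolyD; first exact: Eop_poly.
    by rewrite -scaleNr; exact: ispolyZ.
  exact: (PwM (Eop_homog i0 hi ha) hg hn pg).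
- have -> : Eop f - k%:R *: f = (Eop f - k.+1%:R *: f) + f.
    by rewrite -[k.+1%:R]natr1 scalerDl scale1r opprD addrA subrK.
  by apply: PwD => //; apply: Pw_weaken; exact: ih.
have -> : Eop (c *: f + g) - k%:R *: (c *: f + g) = c *: (Eop f - k%:R *: f) + (Eop g - k%:R *: g).
  by rewrite Eop_lin scalerDr scalerBr opprD addrACA !scalerA mulrC.
by apply: Pw_lin; [exact: ihf | exact: ihg].
Qed.

(** In f = (Eop f - (Eop f - (k + 1) f)) / (k + 1) the first term is in R and the second is one
    factor longer. *)
Lemma killed_Pw n (f : sha) k : (0 < n)%N -> (n <= B)%N -> homog n f -> killed f -> Pw k.+1 n f.
Proof.
move=> n0 hB hf kf; elim: k => [|k ih].
  rewrite -[f]mulr1; apply: (@Pw_mul 0 n 0) => //; [by rewrite addn0 | exact: ispoly1 |].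
  by apply: Pw_homog; exact: (@homog_pword [::]).
have nz : k.+1%:R != 0 :> rat by rewrite pnatr_eq0.
have -> : f = k.+1%:R^-1 *: (Eop f - (Eop f - k.+1%:R *: f)).
  by rewrite opprB addrC subrK scalerA mulVf // scale1r.
apply: PwZ; apply: PwB; first by apply/Pw_J/inJ_inR/Eop_killed.
exact: Eop_Pw.
Qed.
End Operator.

Lemma killed_inJ n (f : sha) : (0 < n)%N -> homog n f -> killed f -> inJ f.
Proof.
move=> n0 hf kf; have [psi hpsi] := choice dual_projection.
(* More than n factors of positive weight do not fit into weight n. *)
apply: (@Pw_large n.+1 n) => //; apply: (@killed_Pw n psi) => //.
- by move=> m w; have [] := hpsi m.
- by move=> m w g; have [_ h _] := hpsi m; exact: h.
- by move=> m a; have [_ _ h] := hpsi m; exact: h.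
Qed.

Lemma inJ_homog n (f : sha) : homog n f -> inJ f ->
  inR f \/ (1 < n)%N /\ exists2 p : sha, homog (n - 2) p & inR (f - zeta2 * p).
Proof.
move=> hf [p _ /(inR_wpart n)]; rewrite linearB /= (wpart_id hf).
have [h|h] := leqP 2 n; last by rewrite (wpart_mul_lt _ zeta2_homog h) subr0; left.
rewrite (wpart_mul_eq0 _ zeta2_homog h) => hR; right; split=> //.
by exists (wpart (n - 2) p); first exact: wpart_homog.
Qed.

Lemma D_zeta2X m psi k (f : sha) : dm0 psi -> (0 < m)%N ->
  D m psi (zeta2 ^+ k * f) = zeta2 ^+ k * D m psi f.
Proof.
move=> h m0; have dD := D_deriv (dm0_prim h m0).
elim: k f => [|k ih] f; first by rewrite !mul1r.
by rewrite exprS -!mulrA dD D_zeta2 // mul0r add0r ih.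
Qed.

(** [D] commutes with multiplication by zeta(2), so D z is torsion of lower weight, hence in R. Then
    z is killed, and unless it is in R it equals zeta(2) p modulo R, with p torsion of weight n - 2.
    In weight 0 a nonzero scalar would put a power of zeta(2) into R. *)
Lemma zeta2_torsion n (z : sha) k : homog n z -> inR (zeta2 ^+ k * z) -> inR z.
Proof.
elim/ltn_ind: n z k => n ih z k hz hR; have [n0|n0] := posnP n.
  move: hR; move: hz; rewrite n0 => /homog0P ->; rewrite -scalerAr mulr1 => /zeta2X_notin_R ->.
  by rewrite scale0r; exact: span0.
have kz : killed z.
  move=> m psi h m0; have [hm|hm] := leqP m n; last by rewrite (D_homog0 _ hm hz); exact: span0.
  apply: (ih (n - m)%N _ _ k); first by lia.
    by apply: D_homog; rewrite subnKC.
  by rewrite -D_zeta2X //; exact: dm0_preservesR.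
have [//|[n1 [p hp hR']]] := inJ_homog hz (killed_inJ n0 hz kz).
rewrite -[z](subrK (zeta2 * p)); apply: spanD => //; apply: inRMl; last exact: zeta2_poly.
apply: (ih (n - 2)%N _ _ k.+1) => //; first by lia.
have -> : zeta2 ^+ k.+1 * p = zeta2 ^+ k * z - zeta2 ^+ k * (z - zeta2 * p).
  by rewrite exprSr; ring.
apply: spanB => //; apply: inRMl => //; elim: (k) => [|l hl]; first exact: ispoly1.
by rewrite exprS; apply: ispolyM => //; exact: zeta2_poly.
Qed.

(** Modulo R a killed z is 0 or zeta(2) p, and absence of torsion makes p killed as well. The
    descent by 2 reaches a scalar in even weight only. *)
Lemma killed_zeta2 n (z : sha) : homog n z -> killed z ->
  exists c : rat, inR (z - ((~~ odd n)%:R * c) *: zeta2 ^+ n./2).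
Proof.
elim/ltn_ind: n z => n ih z hz kz; have [n0|n0] := posnP n.
  exists (z [::]); move: hz; rewrite n0 => /homog0P {1}->; rewrite mul1r subrr; exact: span0.
have [hR|[n1 [p hp hR]]] := inJ_homog hz (killed_inJ n0 hz kz).
  by exists 0; rewrite mulr0 scale0r subr0.
have [||c hc] := ih (n - 2)%N _ p hp; first by lia.
  move=> m psi h m0; have [hm|hm] := leqP m (n - 2); last by rewrite (D_homog0 _ hm hp); exact: span0.
  apply: (@zeta2_torsion (n - 2 - m) _ 1).
    by apply: D_homog; rewrite subnKC.
  rewrite -D_zeta2X // expr1 -[_ * p](subKr z) linearB /=; apply: spanB; first exact: kz.
  exact: dm0_preservesR.
exists c; have -> : z - ((~~ odd n)%:R * c) *: zeta2 ^+ n./2 =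
    (z - zeta2 * p) + zeta2 * (p - ((~~ odd (n - 2))%:R * c) *: zeta2 ^+ (n - 2)./2).
  have e : n = (n - 2).+2 by lia.
  by rewrite {1 2}e /= negbK exprS mulrBr -scalerAr addrA subrK.
by apply: spanD => //; apply: inRMl => //; exact: zeta2_poly.
Qed.
End Euler.

(** * The kernel of the coaction *)

Section Reduction.
Variable sigma : nat -> xpoly.
Hypothesis sigmaP : forall k, dm0 (sigma k) /\ homog (k.*2 + 3) (sigma k).
Hypothesis closedP : forall c, dm0 (lincombI sigma c).
Hypothesis genP : forall psi, dm0 psi -> exists c, forall w, psi w = lincombI sigma c w.

Let presR := dm0_preserves sigmaP closedP genP.
Let dm0_zero : dm0 (0 : sha).
Proof. by have := closedP [::]; congr dm0; apply/funext => w; rewrite /lincombI big_nil. Qed.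

(** A bracket acts by a commutator of operators preserving R, so it sends f into R as soon as both
    entries do; beyond weight N everything vanishes. *)
Lemma generators_kill N (f : sha) : homog N f ->
  (forall k, (k.*2 + 3 <= N)%N -> inR (D (k.*2 + 3) (sigma k) f)) -> killed f.
Proof.
move=> hf gen; have big m (psi : sha) : (N < m)%N -> D m psi f = 0 by move=> h; exact: (D_homog0 _ h hf).
have R0 : inR (0 : sha) by exact: span0.
have ht t : inR (D (wt t) (evalI sigma t) f).
  elim: t => [k|t1 ih1 t2 ih2].
    have [h|h] := leqP (k.*2 + 3) N; [exact: gen | by rewrite (big _ _ h)].
  by rewrite (D_br sigmaP); apply: spanB; apply: (evalI_preserves sigmaP closedP).
move=> m psi h m0; have [c [-> _]] := D_generated sigmaP genP m f h.
by apply: span_sum => x /eqP <-; apply: spanZ; exact: ht.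
Qed.

Lemma D_zeta m psi N : dm0 psi -> (0 < m < N)%N -> D m psi (z1 N.-1) = 0.
Proof.
move=> h /andP[m0 hm]; apply: D_z1; first exact: dm0_nseq.
by rewrite m0 -ltnS (ltn_predK hm).
Qed.

Theorem kernel_mod_zeta N (f : sha) : (2 <= N)%N -> homog N f ->
  (forall k, (k.*2 + 3 < N)%N -> inR (D (k.*2 + 3) (sigma k) f)) ->
  exists c : rat, inR (f - c *: z1 N.-1).
Proof.
move=> N2 hf gen; have hz : homog N (z1 N.-1) by case: N N2 {hf gen} => // N _; exact: z1_homog.
have zR : ~ inR (z1 N.-1) by case: N N2 {hf gen hz} => [|[|N]] // _; exact: zeta_notin_R.
have cl (g : sha) := @killed_zeta2 presR dm0_zero N g.
have genz k : (k.*2 + 3 < N)%N -> inR (D (k.*2 + 3) (sigma k) (z1 N.-1)).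
  move=> hk; rewrite D_zeta //; [exact: span0 | by case: (sigmaP k) | by lia].
have [oN|eN] := boolP (odd N); last first.
  (* Generators have odd weight, so for even N none of them has weight N. *)
  have low k : (k.*2 + 3 <= N)%N -> (k.*2 + 3 < N)%N.
    by move=> h; rewrite ltn_neqAle h andbT; apply: contraNneq eN => <-; rewrite addn3 /= negbK odd_double.
  have [a ha] := cl f hf (generators_kill hf (fun k h => gen k (low k h))).
  have [b hb] := cl _ hz (generators_kill hz (fun k h => genz k (low k h))).
  move: ha hb; rewrite eN !mul1r => ha hb.
  have b0 : b != 0 by apply/eqP => b0; apply: zR; move: hb; rewrite b0 scale0r subr0.
  exists (a / b); have -> : f - (a / b) *: z1 N.-1 =
     (f - a *: zeta2 ^+ N./2) - (a / b) *: (z1 N.-1 - b *: zeta2 ^+ N./2).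
    by rewrite scalerBr scalerA mulfVK // opprB addrA subrK.
  by apply: spanB => //; exact: spanZ.
have odd_case (g : sha) : homog N g -> killed g -> inR g.
  by move=> hg kg; have [c] := cl g hg kg; rewrite oN mul0r scale0r subr0.
have [k eN] : exists k, N = (k.*2 + 3)%N by exists (N./2.-1); have := odd_double_half N; rewrite oN; lia.
have top (g : sha) : homog N g -> (forall k, (k.*2 + 3 < N)%N -> inR (D (k.*2 + 3) (sigma k) g)) ->
    pr N (sigma k) g = 0 -> inR g.
  move=> hg gg g0; apply: odd_case => //; apply: (generators_kill hg) => j.
  rewrite leq_eqVlt => /orP[/eqP ej|]; last exact: gg.
  have -> : j = k by lia.
  by rewrite -eN (D_homogn _ hg) g0 scale0r; exact: span0.
(* The lower generators kill zeta(N); were this pairing 0 too, [top] would put zeta(N) into R. *)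
have s0 : pr N (sigma k) (z1 N.-1) != 0 by apply/eqP => h; apply: zR; exact: top.
exists (pr N (sigma k) f / pr N (sigma k) (z1 N.-1)); apply: top.
- by apply: homogB => //; exact: homogZ.
- move=> j hj; rewrite linearB linearZ /=; apply: spanB; first exact: gen.
  by apply: spanZ; exact: genz.
- by rewrite linearB linearZ /= mulfVK // subrr.
Qed.
End Reduction.

Theorem mainTheorem3 :
  free_odd_generation ->
  forall N : nat, (2 <= N)%N ->
  forall f : xpoly, homog N f ->
    ((forall r : nat, (3 <= r.*2.+1)%N -> (r.*2.+1 < N)%N -> kerD r (Tf N f))
     <-> exists c : rat, inR (fun w => f w - c * zetaN N w)).
Proof.
move=> [sigma [sigmaP _ closedP genP]] N N2 f hf; split=> [hk|[c hc]].
  apply: (kernel_mod_zeta sigmaP closedP genP N2 hf) => k hkN.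
  have [hd _] := sigmaP k.
  (* [sigma k] has weight 2k + 3, which is [r.*2.+1] for r = k + 1. *)
  have := kerD_pr hd (hk k.+1 _ _); rewrite (_ : k.+1.*2.+1 = k.*2 + 3)%N; last by lia.
  move=> /(_ _ hkN) h; have {}h := h (leq_addl _ _); move: h.
  by congr inR; apply/funext => b; apply: pr_Tf => //; [apply: dm0_prim => //; lia | lia].
move=> r r1 rN; apply: (@kerD_intro r N) => [a b hab||psi hpsi ann]; first by apply: Tf_big => //; lia.
  exact: ltnW.
(* The forms tested by [kerD_intro] belong to dm_0, so their operators preserve R, and they kill
   zeta(N) because 2r + 1 < N. *)
have hd : dm0 psi by apply: (@ann_dm0 r.*2.+1) => //; lia.
rewrite (_ : (fun b => _) = D r.*2.+1 psi f); last first.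
  by apply/funext => b; apply: pr_Tf => //; exact: dm0_prim.
have z0 : D r.*2.+1 psi (c *: z1 N.-1) = 0 by rewrite linearZ /= D_zeta // scaler0.
rewrite -[f : sha](subrK (c *: z1 N.-1)) linearD /= z0 addr0.
by apply: (dm0_preserves sigmaP closedP genP) => //; exact: hc.
Qed.
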